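(* Let $\mathbf{X}$ be an isotropic unimodal Lévy process on $\mathbb{R}^d$ with Lévy–Khintchine exponent $\psi\in\Pi^\infty_\ell$ for some bounded $\ell\in\mathcal{R}^\infty_0$. Then \[ \lim_{t\to0^+,\ t\psi(|x|^{-1})\to\infty}\frac{p(t,x)}{t|x|^{-d}\ell(|x|^{-1})e^{-t\psi(|x|^{-1})}}=\frac{\Gamma(d/2)}{2\pi^{d/2}}. \]
   Context: An isotropic unimodal Lévy process on $\mathbb{R}^d$ is a pure-jump Lévy process $\mathbf{X}=(X_t)_{t\ge0}$, $X_0=0$, with $\mathbb{E}e^{i\langle\xi,X_t\rangle}=e^{-t\psi(\xi)}$, $\psi(\xi)=\int_{\mathbb{R}^d}(1-\cos\langle\xi,x\rangle)\,\nu(\mathrm{d}x)$, where the Lévy measure has a radial, radially non-increasing density $\nu$; for $t>0$ the law of $X_t$ on $\mathbb{R}^d\setminus\{0\}$ has a radial non-increasing density $p(t,x)$. Radial functions are written as functions of $|x|$. $\ell\in\mathcal{R}^\infty_0$ means $\ell$ positive on some $[a,\infty)$ with $\ell(\lambda x)/\ell(x)\to1$ as $x\to\infty$ for all $\lambda>0$; $\Pi^\infty_\ell$ is the set of $f:[a,\infty)\to[0,\infty)$ with $\lim_{x\to\infty}(f(\lambda x)-f(x))/\ell(x)=\log\lambda$ for all $\lambda>0$. The joint limit is along all sequences $t_n\to0^+$, $x_n\neq0$, with $t_n\psi(|x_n|^{-1})\to\infty$. *)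

(* Defs.v *)
From HB Require Import structures.
From mathcomp Require Import all_boot all_order all_algebra.
From mathcomp Require Import all_classical all_reals all_analysis.
Set Implicit Arguments. Unset Strict Implicit. Unset Printing Implicit Defensive.
Import Order.TTheory GRing.Theory Num.Theory.
Import numFieldNormedType.Exports.
Local Open Scope classical_set_scope.
Local Open Scope ring_scope.

Section Rd.
Variable R : realType.

Definition tzero (d : nat) : d.-tuple R := [tuple 0 | i < d].
Definition tsub (d : nat) (x y : d.-tuple R) : d.-tuple R :=
  [tuple tnth x i - tnth y i | i < d].
Definition tdot (d : nat) (x y : d.-tuple R) : R := \sum_(i < d) tnth x i * tnth y i.
Definition tnorm (d : nat) (x : d.-tuple R) : R := Num.sqrt (tdot x x).

(* Lebesgue integral on R^d of a function with values in \bar R,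
   as the iterated one-dimensional Lebesgue integral *)
Fixpoint intRd (n : nat) : (n.-tuple R -> \bar R) -> \bar R :=
  match n return (n.-tuple R -> \bar R) -> \bar R with
  | 0 => fun f => f [tuple]
  | n'.+1 => fun f => (\int[@lebesgue_measure R]_(x in setT)
                         intRd (fun t : n'.-tuple R => f (cons_tuple x t)))%E
  end.

Definition Gamma (s : R) : R :=
  fine (\int[@lebesgue_measure R]_(u in [set u : R | (0 < u)%R])
          ((powR u (s - 1)) * expR (- u))%R%:E)%E.
End Rd.

Section Levy.
Local Open Scope ring_scope.

Definition is_cadlag (R : realType) (f : R -> R) : Prop :=
  (forall s, 0 <= s -> f x @[x --> s^'+] --> f s) /\
  (forall s, 0 < s -> cvg (f x @[x --> s^'-])).

(* X = (X_t)_{t >= 0} is a Lévy process on R^d (over the probability space P),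
   X_0 = 0, with E exp(i<xi, X_t>) = exp(- t psi(xi)), written through its
   real and imaginary parts *)
Definition levy_process (R : realType) (dO : measure_display) (O : measurableType dO)
    (P : probability O R) (d : nat) (X : R -> O -> d.-tuple R)
    (psi : d.-tuple R -> R) : Prop :=
  [/\ (forall w, X 0 w = tzero R d),
      (forall t, 0 <= t -> measurable_fun setT (X t)),
      (forall (n : nat) (ts : nat -> R) (A : nat -> set (d.-tuple R)),
         0 <= ts 0%N -> (forall k, ts k <= ts k.+1) ->
         (forall k, measurable (A k)) ->
         P [set w | forall k, (k < n)%N -> A k (tsub (X (ts k.+1) w) (X (ts k) w))]
         = (\prod_(k < n) P [set w | A k (tsub (X (ts k.+1) w) (X (ts k) w))])%E)
      /\
      (forall s t (A : set (d.-tuple R)), 0 <= s -> 0 <= t -> measurable A ->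
         P [set w | A (tsub (X (s + t) w) (X s w))] = P [set w | A (X t w)]),
      ({ae P, forall w, forall i : 'I_d, is_cadlag (fun s => tnth (X s w) i)}) &
      (forall t (xi : d.-tuple R), 0 <= t ->
         (\int[P]_(w in setT) (cos (tdot xi (X t w)))%:E = (expR (- (t * psi xi)))%:E)%E
         /\ (\int[P]_(w in setT) (sin (tdot xi (X t w)))%:E = 0)%E)].

Definition pure_jump_isotropic_unimodal_exponent (R : realType) (d : nat)
    (nu : R -> R) (psi : d.-tuple R -> R) : Prop :=
  [/\ (forall r, 0 < r -> 0 <= nu r),
      (forall r s, 0 < r -> r <= s -> nu s <= nu r),
      (intRd (fun x : d.-tuple R => (Num.min 1 (tnorm x ^+ 2) * nu (tnorm x))%:E) < +oo)%E &
      (forall xi : d.-tuple R,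
         (psi xi)%:E = intRd (fun x : d.-tuple R => ((1 - cos (tdot xi x)) * nu (tnorm x))%:E))].

Definition radial_unimodal_density (R : realType) (dO : measure_display)
    (O : measurableType dO) (P : probability O R) (d : nat)
    (X : R -> O -> d.-tuple R) (p : R -> R -> R) : Prop :=
  forall t, 0 < t ->
  [/\ (forall r, 0 < r -> 0 <= p t r),
      (forall r s, 0 < r -> r <= s -> p t s <= p t r) &
      (forall A : set (d.-tuple R), measurable A ->
         P [set w | A (X t w) /\ X t w <> tzero R d]
         = intRd (fun x : d.-tuple R => (p t (tnorm x) * \1_A x)%:E))].

Definition slowly_varying (R : realType) (l : R -> R) (a : R) : Prop :=
  (forall x, a <= x -> 0 < l x) /\
  (forall lam, 0 < lam -> (fun x => l (lam * x) / l x) @ +oo --> (1 : R)).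

Definition in_Pi (R : realType) (l f : R -> R) (a : R) : Prop :=
  (forall x, a <= x -> 0 <= f x) /\
  (forall lam, 0 < lam -> (fun x => (f (lam * x) - f x) / l x) @ +oo --> ln lam).
End Levy.

(* Main.v *)
Require Import Defs.
From HB Require Import structures.
From mathcomp Require Import all_boot all_order all_algebra.
From mathcomp Require Import all_classical all_reals all_analysis.
From mathcomp Require Import measurable_realfun.
From mathcomp Require Import ring lra.
Set Implicit Arguments. Unset Strict Implicit. Unset Printing Implicit Defensive.
Import Order.TTheory GRing.Theory Num.Theory.
Import numFieldNormedType.Exports.
Local Open Scope classical_set_scope.
Local Open Scope ring_scope.

(** Put [x := |x_n|^-1], [Y := x X_t] and [c := t l(x) exp(- t psi(x))]. Averaging the
    characteristic function over a Gaussian frequency writes the Laplace transform of [|Y|^2]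
    at [s] as a Gamma average over [v] of [exp(- t psi(2 sqrt(s v) x))]. Since [t l(x)] tends
    to 0 and [psi] lies in the de Haan class, the difference of the integrands at [s] and [s'],
    divided by [c], tends to [(ln s' - ln s) / 2]; Potter bounds for [l] provide the domination,
    so the same limit holds for the Laplace transforms. By the Frullani integral this says
    that the moments of [exp(- |Y|^2)] under the law of [|Y|^2] divided by [c], weighted by
    [w (1 - w)], converge to those of [dv / (2 v)], and polynomial approximation gives
    convergence on bump functions of [exp(- v)]. Finally the monotonicity of [p(t, .)] compares
    the law of [|Y|^2] just outside and just inside the unit sphere with the constant density
    [p(t, x_n)], and letting the shells shrink identifies the limit as the inverse of twice the
    constant of the radial integration formula, [pi^(d/2) / Gamma(d/2)]. *)

(** * Slow variation *)

(** Only differences of Laplace transforms can converge: the limit measure dv / (2 v) has infinite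
    mass at 0 and at infinity. In the weight w (1 - w), with w = exp(- v), the factor w tames
    infinity and 1 - w tames 0; the k-th weighted moment is then a difference of Laplace transforms
    at k + 1 and k + 2. The obstacle is domination. The normalisation [c] contains exp(- t psi(x)),
    which itself tends to 0, so t (psi(w x) - psi(x)) has to be controlled for all w > 0 at once,
    whereas the de Haan and slow variation hypotheses give a limit for each fixed w. Uniformity
    comes from Baire and the continuity of psi, which is read off the characteristic function; [l],
    for which no continuity is at hand, is then bounded through increments of psi. Boundedness of
    [l] enters twice: it makes t l(x) tend to 0, and for small t it makes exp(t |psi(v x) - psi(x)|)
    grow no faster than a small power of v. *)

(** If no set contained an interval, the complements of the sets [E n] cut down to [a, b] would all
    be open and dense, and Baire would give a point of ]a, b[ that no [E n] covers. Cutting down to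
    [a, b] also forces any ball found inside to lie in [a, b]. *)
Lemma closed_cover_interval (R : realType) (E : nat -> set R) (a b : R) :
  a < b -> (forall n, closed (E n)) ->
  (forall v, a <= v <= b -> exists n, E n v) ->
  exists n al be, [/\ a <= al, al < be, be <= b &
    forall v, al <= v <= be -> E n v].
Proof.
move=> ab cE covE; apply: contrapT => noE.
pose D : set R := `]a, b[%classic.
have oD : open D by exact: interval_open.
have D0 : D !=set0.
  by exists ((a + b) / 2); rewrite /D /= in_itv/=; apply/andP; split; lra.
pose G n : set R := ~` (E n `&` `[a, b]%classic).
have oG n : open (G n) /\ dense (G n).
  split.
    by apply: closed_openC; apply: closedI => //; exact: interval_closed.
  move=> U U0 oU; apply: contrapT => UG; apply: noE.
  case: U0 => u Uu.
  have sub v : U v -> (E n `&` `[a, b]%classic) v.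
    by move=> Uv; apply: contrapT => nE; apply: UG; exists v.
  have /nbhs_ballP[e /= e0 bU] : nbhs u U by exact: open_nbhs_nbhs.
  have bUv v : `|u - v| < e -> (E n `&` `[a, b]%classic) v.
    by move=> h; apply/sub/bU.
  have [_ ] : (E n `&` `[a, b]%classic) (u - e / 2).
    by apply: bUv; rewrite opprB addrC subrK gtr0_norm; lra.
  rewrite /= in_itv/= => /andP[h1 h2].
  have [_ ] : (E n `&` `[a, b]%classic) (u + e / 2).
    by apply: bUv; rewrite opprD addNKr normrN gtr0_norm; lra.
  rewrite /= in_itv/= => /andP[h3 h4].
  exists n, (u - e / 2), (u + e / 2); split => //; first lra.
  move=> v /andP[v1 v2]; apply: (bUv v _).1.
  by rewrite ltr_norml; apply/andP; split; lra.
have [v [Dv Gv]] := Baire oG D0 oD.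
move: Dv; rewrite /D /= in_itv/= => /andP[v1 v2].
have [n Env] : exists n, E n v by apply: covE; rewrite !ltW.
by have := Gv n I; apply; split => //=; rewrite in_itv/= !ltW.
Qed.

Lemma bernoulli_le (R : realDomainType) (x : R) n : 0 <= x -> 1 + n%:R * x <= (1 + x) ^+ n.
Proof.
move=> x0; elim: n => [|n IH]; first by rewrite mul0r addr0 expr0.
rewrite exprS; apply: le_trans (ler_wpM2l _ IH); last by rewrite addr_ge0.
have : 0 <= n%:R * x by rewrite mulr_ge0.
by rewrite -natr1 => h; nra.
Qed.

Lemma expR_sub1_le (R : realType) (z : R) : expR z - 1 <= z * expR z.
Proof.
have h1 := expR_ge1Dx (- z); have h2 := expR_gt0 z.
have : (1 - z) * expR z <= expR (- z) * expR z by rewrite ler_pM2r.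
by rewrite -expRD addNr expR0 mulrBl mul1r => h; lra.
Qed.

Lemma norm_expR_sub1 (R : realType) (z : R) : `|expR z - 1| <= `|z| * expR `|z|.
Proof.
have h1 := expR_ge1Dx z; have h2 := expR_sub1_le z.
have h3 : 1 <= expR `|z| by rewrite -expR0 ler_expR.
have [z0|z0] := leP 0 z.
  by rewrite (ger0_norm z0) ger0_norm//; lra.
rewrite ler0_norm; last by rewrite subr_le0 -expR0 ler_expR ltW.
rewrite (ltr0_norm z0) in h3 *; nra.
Qed.

Lemma norm_expR_subD (R : realType) (z : R) : `|expR z - 1 - z| <= z ^+ 2 * expR `|z|.
Proof.
have h1 := expR_ge1Dx z; have h2 := expR_sub1_le z; have h3 := norm_expR_sub1 z.
rewrite ger0_norm; last lra.
have h4 : z * (expR z - 1) <= `|z| * `|expR z - 1|.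
  by rewrite -normrM; exact: ler_norm.
have h5 : `|z| * `|expR z - 1| <= `|z| * (`|z| * expR `|z|) by rewrite ler_wpM2l.
by rewrite mulrA -expr2 real_normK ?num_real// in h5; lra.
Qed.

(** The factor [expR (- a)] must survive in the bound, because these differences are later divided
    by an exponential that tends to 0. *)
Lemma norm_expRN_sub (R : realType) (a b : R) :
  `|expR (- a) - expR (- b)| <= `|a - b| * expR (- a) * expR `|a - b|.
Proof.
have -> : expR (- a) - expR (- b) = - (expR (- a) * (expR (a - b) - 1)).
  by rewrite mulrBr mulr1 -expRD addrA addNr add0r opprB.
rewrite normrN normrM (gtr0_norm (expR_gt0 _)) mulrAC mulrC.
by rewrite ler_pM2r ?expR_gt0//; exact: norm_expR_sub1.
Qed.

Section slow_variation.
Variables (R : realType) (psi l : R -> R) (a M : R).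
Hypothesis cpsi : continuous psi.
Hypothesis psi_ge0 : forall x, 0 <= psi x.
Hypothesis l_gt0 : forall x, a <= x -> 0 < l x.
Hypothesis l_sv : forall lam : R, 0 < lam -> (fun x => l (lam * x) / l x) @ +oo --> (1 : R).
Hypothesis l_leM : forall x, a <= x -> l x <= M.
Hypothesis psi_Pi : forall lam : R, 0 < lam ->
  (fun x => (psi (lam * x) - psi x) / l x) @ +oo --> ln lam.

Lemma near_pinftyE (Q : set R) : (\forall x \near +oo, Q x) ->
  exists A, 0 < A /\ forall x, A <= x -> Q x.
Proof.
move=> [A [_ AQ]]; exists (Num.max (A + 1) 1); split.
  by rewrite lt_max ltr01 orbT.
by move=> x; rewrite ge_max => /andP[h _]; apply: AQ; lra.
Qed.

Lemma psi_increment_near (lam e : R) : 0 < lam -> 0 < e ->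
  exists A, 0 < A /\ forall x, A <= x ->
    0 < l x /\ `|psi (lam * x) - psi x - ln lam * l x| <= e * l x.
Proof.
move=> lam0 e0; apply: near_pinftyE; near=> x.
have lx : 0 < l x by apply: l_gt0; near: x; exact/nbhs_pinfty_ge/num_real.
split=> //.
have : `|ln lam - (psi (lam * x) - psi x) / l x| <= e.
  by near: x; move: e e0; apply/cvgrPdist_le; exact: psi_Pi.
rewrite distrC => h.
rewrite (_ : _ - _ = ((psi (lam * x) - psi x) / l x - ln lam) * l x).
  by rewrite normrM (gtr0_norm lx) ler_pM2r.
by rewrite mulrBl mulfVK ?gt_eqF.
Unshelve. all: by end_near. Qed.

Lemma l_ratio_near (lam q : R) : 0 < lam -> 1 < q ->
  exists A, 0 < A /\ forall x, A <= x ->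
    [/\ 0 < l x, 0 < l (lam * x), l (lam * x) <= q * l x & l x <= q * l (lam * x)].
Proof.
move=> lam0 q1; apply: near_pinftyE.
(* With this accuracy the ratio lies between 1/q and 2 - 1/q, and 2 - 1/q <= q because q + 1/q >= 2;
   one constant thus serves in both directions. *)
have e0 : 0 < 1 - q^-1 by rewrite subr_gt0 invf_lt1//; lra.
near=> x.
have lx : 0 < l x by apply: l_gt0; near: x; exact/nbhs_pinfty_ge/num_real.
have llx : 0 < l (lam * x).
  apply: l_gt0; suff : a / lam <= x by rewrite ler_pdivrMr// mulrC.
  by near: x; apply: nbhs_pinfty_ge; exact: num_real.
have : `|1 - l (lam * x) / l x| <= 1 - q^-1.
  near: x; move: (1 - q^-1) e0; apply/cvgrPdist_le; exact: l_sv.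
rewrite ler_norml => /andP[h1 h2].
have h3 : q^-1 <= l (lam * x) / l x by lra.
have h4 : l (lam * x) / l x <= q.
  have : q^-1 >= 2 - q.
    rewrite -(ler_pM2l (_ : 0 < q)); last lra.
    rewrite divff ?gt_eqF//; last lra.
    by nra.
  lra.
split => //.
  by rewrite -ler_pdivrMr.
move: h3; rewrite ler_pdivlMr// ler_pdivrMl//; lra.
Unshelve. all: by end_near. Qed.

Lemma ln2_lt1 : ln (2 : R) < 1.
Proof.
by rewrite -ltr_expR lnK ?posrE//; have := expR_gt1Dx (oner_neq0 R); lra.
Qed.

(* The pointwise limits are bounded uniformly on some interval by Baire's theorem. *)
Lemma psi_increment_interval : exists al be N, [/\ 1 <= al, al < be &
  forall v x, al <= v <= be -> N <= x -> `|psi (v * x) - psi x| <= 2 * l x].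
Proof.
(* The constant 2 is the bound 1 for [ln v] on [1, 2] plus an accuracy 1. Continuity of [psi] makes
   these sets closed. *)
pose E n := [set v : R | forall x, n%:R <= x -> `|psi (v * x) - psi x| <= 2 * l x].
have cE n : closed (E n).
  rewrite (_ : E n = \bigcap_(x in [set x | n%:R <= x])
     [set v : R | `|psi (v * x) - psi x| <= 2 * l x]); last first.
    by apply/seteqP; split => v /=.
  apply: closed_bigI => x _.
  rewrite (_ : mkset _ = (fun v => `|psi (v * x) - psi x|) @^-1`
    [set y | y <= 2 * l x])//.
  apply: preimage_closed; last exact: closed_le.
  move=> v _; apply: cvg_norm; apply: cvgB; last exact: cvg_cst.
  apply: continuous_comp; last exact: cpsi.
  by apply: cvgMl; exact: cvg_id.
have [v /andP[v1 v2]|] := closed_cover_interval (ltr1n R 2) cE.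
  have v0 : 0 < v by lra.
  have [A [A0 hA]] := psi_increment_near v0 (@ltr01 R).
  have [n An] : exists n, A <= n%:R.
    by exists (Num.truncn A).+1; apply/ltW; exact: truncnS_gt.
  exists n => x nx; have [lx] := hA x (le_trans An nx).
  have lnv : 0 <= ln v <= 1.
    rewrite ln_ge0//= (le_trans _ (ltW ln2_lt1))// ler_ln// posrE; lra.
  by rewrite !ler_norml => /andP[h1 h2]; apply/andP; split; nra.
move=> n [al [be [h1 h2 h3 h4]]]; exists al, be, n%:R; split => //.
by move=> v x hv; exact: h4.
Qed.

(** The interval [al, be] supplied by Baire is moved to [1, q] with q = be / al by changing the base
    point, and then extended to [1, 2] by chaining finitely many factors q. *)
Lemma psi_increment_ub : exists K A, [/\ 0 < K, 0 < A &
  forall v x, 1 <= v <= 2 -> A <= x ->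
   [/\ 0 < l x, l x <= M & `|psi (v * x) - psi x| <= K * l x]].
Proof.
have [al [be [N [al1 albe hN]]]] := psi_increment_interval.
have al0 : 0 < al by lra.
have [q q1 qE] : exists2 q, 1 < q & q * al = be.
  by exists (be / al); rewrite ?mulfVK ?gt_eqF// ltr_pdivlMr// mul1r.
have [A1 [A10 hA1]] := l_ratio_near al0 (ltr1n R 2).
(* Both [x] and [v * x] are multiples of x / al by factors in [al, be], so their distance is at most
   4 l(x / al); the comparison l(x / al) <= 2 l(x) turns this into 8 l(x). *)
have base v x : 1 <= v <= q -> Num.max (al * A1) (al * N) <= x ->
    `|psi (v * x) - psi x| <= 8 * l x.
  rewrite ge_max => /andP[v1 vq] /andP[x1 x2].
  have y1 : A1 <= x / al by rewrite ler_pdivlMr// mulrC.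
  have y2 : N <= x / al by rewrite ler_pdivlMr// mulrC.
  have xE : al * (x / al) = x by rewrite mulrC mulfVK ?gt_eqF.
  have [_ _ _] := hA1 _ y1; rewrite xE => ly.
  have h1 : `|psi x - psi (x / al)| <= 2 * l (x / al).
    by rewrite -{1}xE; apply: hN => //; rewrite lexx ltW.
  have h2 : `|psi (v * x) - psi (x / al)| <= 2 * l (x / al).
    rewrite -{1}xE mulrA; apply: hN => //; apply/andP; split; first nra.
    by rewrite -qE ler_pM2r.
  have := ler_normB (psi (v * x) - psi (x / al)) (psi x - psi (x / al)).
  rewrite (_ : _ - _ - _ = psi (v * x) - psi x); last ring.
  move=> h3; lra.
have q0 : 0 < q by lra.
have [A2 [A20 hA2]] := l_ratio_near q0 (ltr1n R 2).
(* One more factor q costs 8 for the increment from x to q x, and a factor 2 on the old constant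
   because l(q x) <= 2 l(x). *)
have step m : exists K A, [/\ 0 < K, 0 < A &
    forall v x, 1 <= v <= q ^+ m.+1 -> A <= x -> `|psi (v * x) - psi x| <= K * l x].
  elim: m => [|m [K [A [K0 A0 IH]]]].
    exists 8, (Num.max 1 (Num.max (al * A1) (al * N))); split => //.
      by rewrite lt_max ltr01.
    by move=> v x vq; rewrite ge_max expr1 in vq * => /andP[_]; exact: base.
  exists (8 + 2 * K), (Num.max (Num.max 1 (Num.max (al * A1) (al * N))) (Num.max A2 A)); split.
  - lra.
  - by rewrite !lt_max ltr01.
  move=> v x /andP[v1 vq]; rewrite ge_max => /andP[].
  rewrite ge_max => /andP[x1 x2].
  rewrite ge_max => /andP[x3 x4].
  have [lx _ lqx _] := hA2 _ x3.
  have [vq'|vq'] := leP v q.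
    by apply: le_trans (base _ _ _ _) _ => //; [apply/andP|nra].
  have h1 : `|psi (v / q * (q * x)) - psi (q * x)| <= K * l (q * x).
    apply: IH; last nra.
    rewrite ler_pdivlMr// mul1r ler_pdivrMr// -exprSr vq andbT; lra.
  have h2 : `|psi (q * x) - psi x| <= 8 * l x.
    by apply: base => //; rewrite lexx ltW.
  rewrite mulrA mulfVK ?gt_eqF// in h1.
  have := ler_normD (psi (v * x) - psi (q * x)) (psi (q * x) - psi x).
  rewrite (_ : _ + (_ - _) = psi (v * x) - psi x); last ring.
  move=> h3; nra.
have [m hm] : exists m, 2 <= q ^+ m.+1.
  have q10 : 0 < q - 1 by lra.
  exists (Num.truncn (q - 1)^-1); have := truncnS_gt (q - 1)^-1.
  rewrite -[X in X < _]mul1r ltr_pdivrMr// => h.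
  have := bernoulli_le (Num.truncn (q - 1)^-1).+1 (ltW q10).
  rewrite (_ : 1 + (q - 1) = q); last ring.
  move=> h'; lra.
have [K [A [K0 A0 hK]]] := step m.
exists K, (Num.max A (Num.max A1 a)); split => //; first by rewrite lt_max A0.
move=> v x /andP[v1 v2]; rewrite !ge_max => /and3P[x1 x2 x3]; split.
- exact: l_gt0.
- exact: l_leM.
- by apply: hK => //; rewrite v1 (le_trans v2 hm).
Qed.

(** The size of [l] at y is read off an increment of [psi]: psi(2 y) - psi(y) is at least (ln 2 / 2)
    l(y) for large y. At y = v x this increment is a combination of three increments bounded by K
    l(2 x), K l(x) and K l(x), together at most 4 K l(x); this explains [H]. *)
Lemma l_ratio_ub : exists K A, [/\ 0 < K, 0 < A &
  forall v x, 1 <= v <= 2 -> A <= x -> l (v * x) <= K * l x /\ l x <= K * l (v * x)].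
Proof.
have [K [A [K0 A0 hK]]] := psi_increment_ub.
have [A1 [A10 hA1]] := l_ratio_near (ltr0n R 2) (ltr1n R 2).
have ln2_gt0 : 0 < ln 2 :> R by rewrite ln_gt0// ltr1n.
have e0 : 0 < ln 2 / 2 :> R by rewrite divr_gt0.
have [A2 [A20 hA2]] := psi_increment_near (ltr0n R 2) e0.
pose B := Num.max A (Num.max A1 A2).
pose H := (ln 2 / 2)^-1 * (4 * K) : R.
have H0 : 0 < H by rewrite mulr_gt0 ?invr_gt0//; lra.
have up v x : 1 <= v <= 2 -> B <= x -> l (v * x) <= H * l x.
  rewrite !ge_max => /andP[v1 v2] /and3P[x1 x2 x3].
  have x0 : 0 < x by lra.
  have xvx : x <= v * x by nra.
  have x2x : x <= 2 * x by nra.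
  have [lx _ l2x _] := hA1 _ x2.
  have [lvx] := hA2 _ (le_trans x3 xvx).
  rewrite ler_norml => /andP[h _].
  have [_ _ h1] : [/\ 0 < l x, l x <= M & `|psi (v * x) - psi x| <= K * l x].
    by apply: hK => //; rewrite v1.
  have [_ _ h2] : [/\ 0 < l (2 * x), l (2 * x) <= M
      & `|psi (v * (2 * x)) - psi (2 * x)| <= K * l (2 * x)].
    by apply: hK => //; [rewrite v1|exact: le_trans x2x].
  have [_ _ h3] : [/\ 0 < l x, l x <= M & `|psi (2 * x) - psi x| <= K * l x].
    by apply: hK => //; rewrite lexx ler1n.
  move: h h1 h2 h3; rewrite mulrCA !ler_norml.
  move=> h /andP[h1 h1'] /andP[h2 h2'] /andP[h3 h3'].
  have h4 : K * l (2 * x) <= K * (2 * l x) by rewrite ler_pM2l.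
  rewrite /H -mulrA ler_pdivlMl//; lra.
exists (Num.max H (2 * H)), B; split.
- by rewrite lt_max H0.
- by rewrite lt_max A0.
move=> v x /andP[v1 v2] Bx; move: (Bx); rewrite !ge_max => /and3P[x1 x2 x3].
have x0 : 0 < x by lra.
have [lx _ _ l2x] := hA1 _ x2.
have h1 : l (v * x) <= H * l x by apply: up => //; rewrite v1.
(* The reverse inequality is the direct one applied from v x to 2 x, since the ratio 2 / v is again
   in [1, 2]. *)
have h2 : l (2 * x) <= H * l (v * x).
  have v0 : 0 < v by lra.
  have -> : 2 * x = (2 / v) * (v * x) by rewrite mulrA mulfVK ?gt_eqF.
  apply: up; first by rewrite ler_pdivlMr// mul1r v2 ler_pdivrMr//=; lra.
  by apply: (le_trans Bx); nra.
have h3 : H <= Num.max H (2 * H) by rewrite le_max lexx.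
have h4 : 2 * H <= Num.max H (2 * H) by rewrite le_max lexx orbT.
have xvx : x <= v * x by nra.
have [lvx _] := hA2 _ (le_trans x3 xvx).
split; first by apply: (le_trans h1); rewrite ler_pM2r.
apply: (le_trans l2x); apply: (@le_trans _ _ (2 * H * l (v * x))).
  by rewrite -mulrA ler_pM2l.
by rewrite ler_pM2r.
Qed.

Lemma dyadic_induction (Q : R -> Prop) :
  (forall v, 1 <= v <= 2 -> Q v) -> (forall v, 2 <= v -> Q (v / 2) -> Q v) ->
  forall v, 1 <= v -> Q v.
Proof.
move=> Q1 Q2.
have H m : forall v : R, 1 <= v <= 2 ^+ m.+1 -> Q v.
  elim: m => [|m IH] v; first by rewrite expr1; exact: Q1.
  move=> /andP[v1 v2]; have [h|/ltW h] := leP v 2; first by apply: Q1; rewrite v1.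
  apply: Q2 => //; apply: IH; rewrite ler_pdivlMr// mul1r h ler_pdivrMr//.
  by rewrite -exprSr.
move=> v v1; apply: (H (Num.truncn v)); rewrite v1/=.
apply/ltW/(lt_le_trans (truncnS_gt v)).
by rewrite -natrX ler_nat ltnW// ltn_expl.
Qed.

(** Beyond a threshold a doubling of the argument changes [l] by at most the factor 2^del. Halving
    [v] down to [1, 2] accumulates v^del, and the remaining scale costs the uniform constant of
    [l_ratio_ub]. *)
Lemma potter (del : R) : 0 < del -> exists K A, [/\ 0 < K, 0 < A &
  forall v x, 1 <= v -> A <= x ->
    [/\ 0 < l x, l (v * x) <= K * v `^ del * l x & l x <= K * v `^ del * l (v * x)]].
Proof.
move=> del0; have [K [A [K0 A0 hK]]] := l_ratio_ub.
have d2 : 1 < 2 `^ del :> R.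
  by have := @gt0_ltr_powR R del del0 1 2; rewrite powR1; apply; rewrite ?nnegrE ?ltr1n.
have [A1 [A10 hA1]] := l_ratio_near (ltr0n R 2) d2.
exists K, (Num.max A A1); split => //; first by rewrite lt_max A0.
move=> v x v1; move: v v1 x; apply: dyadic_induction.
  move=> v v12 x; rewrite ge_max => /andP[x1 x2].
  have [lx _ _ _] := hA1 _ x2; have [h1 h2] := hK _ _ v12 x1.
  have v1 : 1 <= v by case/andP: v12.
  have vd : 1 <= v `^ del by rewrite -(powRr0 v) ler_powR// ltW.
  have Kv : K <= K * v `^ del by rewrite ler_peMr// ltW.
  split => //; first by apply: (le_trans h1); rewrite ler_pM2r.
  have lvx : 0 < l (v * x).
    by rewrite -(pmulr_rgt0 _ K0); lra.
  by apply: (le_trans h2); rewrite ler_pM2r.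
move=> v v2 IH x xA; move: (xA); rewrite ge_max => /andP[x1 x2].
have [lx l2x h1 h2] := hA1 _ x2.
have xA' : Num.max A A1 <= 2 * x by apply: (le_trans xA); lra.
have [_] := IH _ xA'.
rewrite mulrA mulfVK ?pnatr_eq0// => h3 h4.
have vE : v `^ del = 2 `^ del * (v / 2) `^ del.
  by rewrite -powRM ?divr_ge0//; [congr (_ `^ _); field|lra].
have vd : 0 < (v / 2) `^ del by rewrite powR_gt0 ?divr_gt0//; lra.
have Kv : 0 < K * (v / 2) `^ del by rewrite mulr_gt0.
split => //; rewrite vE.
  apply: (le_trans h3); rewrite mulrA [_ * 2 `^ _ * _]mulrAC -[leRHS]mulrA.
  by rewrite ler_pM2l.
by apply: (le_trans h2); rewrite [K * (_ * _)]mulrCA -mulrA ler_pM2l//; lra.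
Qed.

(** Since l <= M, each doubling changes [psi] by at most K M, so it multiplies the exponential by at
    most exp(t K M). Choosing t small makes this at most 2^del, and the doublings accumulate to a
    power of v. *)
Lemma exp_psi_increment (del : R) : 0 < del -> exists T A, [/\ 0 < T, 0 < A &
  forall t v x, 0 < t <= T -> 1 <= v -> A <= x ->
    expR (t * `|psi (v * x) - psi x|) <= 2 `^ del * v `^ del].
Proof.
move=> del0; have [K [A [K0 A0 hK]]] := psi_increment_ub.
have M0 : 0 < M.
  have [] : [/\ 0 < l A, l A <= M & `|psi (1 * A) - psi A| <= K * l A].
    by apply: hK => //; rewrite lexx ler1n.
  lra.
have d2 : 1 < 2 `^ del :> R.
  by have := @gt0_ltr_powR R del del0 1 2; rewrite powR1; apply; rewrite ?nnegrE ?ltr1n.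
have ld2 : 0 < ln (2 `^ del) :> R by rewrite ln_gt0.
exists (ln (2 `^ del) / (K * M)), A; split => //; first by rewrite divr_gt0// mulr_gt0.
move=> t v x /andP[t0 tT] v1.
have base w y : 1 <= w <= 2 -> A <= y -> expR (t * `|psi (w * y) - psi y|) <= 2 `^ del.
  move=> w12 Ay; have [ly lM h] := hK _ _ w12 Ay.
  rewrite -[leRHS]lnK ?posrE; last lra.
  rewrite ler_expR; move: tT; rewrite ler_pdivlMr ?mulr_gt0// => tT.
  apply: le_trans tT; rewrite ler_pM2l//; apply: (le_trans h); nra.
move: v v1 x; apply: dyadic_induction.
  move=> v v12 x Ax; apply: (le_trans (base _ _ v12 Ax)).
  have v1 : 1 <= v by case/andP: v12.
  have vd : 1 <= v `^ del by rewrite -(powRr0 v) ler_powR// ltW.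
  by rewrite ler_peMr//; lra.
move=> v v2 IH x Ax.
have := IH (2 * x) (le_trans Ax _); rewrite mulrA mulfVK ?pnatr_eq0// => h1.
have h2 : expR (t * `|psi (2 * x) - psi x|) <= 2 `^ del.
  by apply: base => //; rewrite lexx ler1n.
have vE : v `^ del = 2 `^ del * (v / 2) `^ del.
  by rewrite -powRM ?divr_ge0//; [congr (_ `^ _); field|lra].
rewrite vE; apply: (@le_trans _ _ (expR (t * `|psi (v * x) - psi (2 * x)|) *
   expR (t * `|psi (2 * x) - psi x|))).
  rewrite -expRD ler_expR -mulrDr ler_pM2l//.
  by apply: le_trans (ler_normD _ _); rewrite addrA subrK.
rewrite mulrCA mulrC; apply: ler_pM; rewrite ?expR_ge0//.
by apply: h1; lra.
Qed.

(** This is the domination for the limit theorem. The exponent 2 del collects one del from the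
    Potter bound for [l] and one from the growth of the exponential. Small [w] with w x below the
    threshold [A] need a separate argument, as the asymptotic bounds say nothing there. *)
Lemma exp_psi_difference_ub (del : R) : 0 < del -> exists C T B,
  [/\ 0 < C, 0 < T, 0 < B & forall t x w rho,
    0 < t <= T -> B <= x -> 0 < w -> 1 <= rho <= 2 ->
    0 < l x /\ `|expR (- (t * psi (w * x))) - expR (- (t * psi (rho * (w * x))))| <=
      C * (w `^ (2 * del) + w^-1 `^ (2 * del)) * (t * l x * expR (- (t * psi x)))].
Proof.
move=> del0.
have [K1 [A1 [K10 A10 h1]]] := psi_increment_ub.
have [K [A2 [K0 A20 h2]]] := potter del0.
have [T [A3 [T0 A30 h3]]] := exp_psi_increment del0.
pose A := Num.max A1 (Num.max A2 A3).
have A0 : 0 < A by rewrite lt_max A10.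
have [A1A A2A A3A] : [/\ A1 <= A, A2 <= A & A3 <= A].
  by rewrite /A !le_max !lexx ?orbT.
(* The range reaches 2 A because [rho * (w * x)] can be as large as that when w x < A. *)
have [S S0 hS] : exists2 S, 0 < S & forall y, 0 <= y <= 2 * A -> psi y <= S.
  have [||c _ hc] := @EVT_max R psi 0 (2 * A).
  - by rewrite mulr_ge0// ltW.
  - exact: continuous_subspaceT.
  exists (psi c + 1); first by have := psi_ge0 c; lra.
  move=> y yA; have := hc y; rewrite in_itv/= => /(_ yA); lra.
have lA : 0 < l A by have [] := h2 1 A (lexx _) A2A.
pose c := 2 `^ del : R.
have c1 : 0 < c by rewrite powR_gt0.
pose C1 := K1 * (c * c) * c * K.
pose C2 := S * (K / l A) * (expR (T * S) * c).
have C10 : 0 < C1 by rewrite /C1 !mulr_gt0.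
have C20 : 0 < C2 by rewrite /C2 !mulr_gt0 ?invr_gt0 ?expR_gt0.
exists (C1 + C2), T, A; split => //; first by rewrite addr_gt0.
move=> t x w rho tT Ax w0 rho12.
have t0 : 0 < t by case/andP: tT.
have rho1 : 1 <= rho by case/andP: rho12.
have x0 : 0 < x by lra.
have [lx _ _] := h2 1 x (lexx _) (le_trans A2A Ax).
split => //.
have powR2 (u : R) : 0 < u -> u `^ (2 * del) = u `^ del * u `^ del.
  by move=> u0; rewrite mulrC powRrM powR_mulrn ?powR_ge0// expr2.
have pw : 0 < w `^ (2 * del) by rewrite powR_gt0.
have w'0 : 0 < w^-1 by rewrite invr_gt0.
have pw' : 0 < w^-1 `^ (2 * del) by rewrite powR_gt0.
set D := t * l x * expR (- (t * psi x)).
have D0 : 0 < D by rewrite /D !mulr_gt0 ?expR_gt0.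
have [wxA|wxA] := leP A (w * x).
  (* Stated for a generic [u] so as to serve for w >= 1 with u = w and for w <= 1 with u = 1 / w,
     where the Potter bounds are applied from w x up to x. *)
  have main u : 0 < u -> l (w * x) <= K * u `^ del * l x ->
      expR (t * `|psi (w * x) - psi x|) <= c * u `^ del ->
      `|expR (- (t * psi (w * x))) - expR (- (t * psi (rho * (w * x))))| <=
      C1 * u `^ (2 * del) * D.
    move=> u0 hl he.
    have ud : 0 < u `^ del by rewrite powR_gt0.
    apply: (le_trans (norm_expRN_sub _ _)).
    have [lwx _ h1'] := h1 rho (w * x) rho12 (le_trans A1A wxA).
    have e1 : `|t * psi (w * x) - t * psi (rho * (w * x))| <= t * K1 * (K * u `^ del * l x).
      rewrite -mulrBr normrM (gtr0_norm t0) distrC -mulrA ler_pM2l//.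
      by apply: (le_trans h1'); rewrite ler_pM2l.
    have e2 : expR `|t * psi (w * x) - t * psi (rho * (w * x))| <= c * c.
      rewrite -mulrBr normrM (gtr0_norm t0) distrC.
      apply: (le_trans (h3 _ _ _ tT rho1 (le_trans A3A wxA))).
      rewrite ler_pM2l//; apply: ge0_ler_powR; rewrite ?nnegrE ?(ltW del0)//.
        by lra.
      by case/andP: rho12.
    have e3 : expR (- (t * psi (w * x))) <= expR (- (t * psi x)) * (c * u `^ del).
      apply: le_trans (_ : expR (- (t * psi x)) * expR (t * `|psi (w * x) - psi x|) <= _).
        rewrite -expRD ler_expR.
        have := ler_norm (psi x - psi (w * x)); rewrite distrC.
        by rewrite -(ler_pM2l t0); lra.
      by rewrite ler_pM2l ?expR_gt0.
    apply: (@le_trans _ _ ((t * K1 * (K * u `^ del * l x)) *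
       (expR (- (t * psi x)) * (c * u `^ del)) * (c * c))).
      apply: ler_pM; rewrite ?mulr_ge0 ?expR_ge0//.
      by apply: ler_pM; rewrite ?expR_ge0.
    by rewrite /D /C1 powR2// le_eqVlt; apply/orP; left; apply/eqP; ring.
  have [w1|/ltW w1] := leP 1 w.
    have [_ hl _] := h2 w x w1 (le_trans A2A Ax).
    apply: (le_trans (main w w0 hl (h3 _ _ _ tT w1 (le_trans A3A Ax)))).
    rewrite ler_pM2r//; apply: ler_pM; rewrite ?ltW//; lra.
  have w'1 : 1 <= w^-1 by rewrite invf_ge1.
  have wE : w^-1 * (w * x) = x by rewrite mulKf ?gt_eqF.
  have [_ _ hl] := h2 _ (w * x) w'1 (le_trans A2A wxA); rewrite wE in hl.
  have he := h3 _ _ (w * x) tT w'1 (le_trans A3A wxA); rewrite wE distrC in he.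
  apply: (le_trans (main w^-1 w'0 hl he)).
  rewrite ler_pM2r//; apply: ler_pM; rewrite ?ltW//; lra.
(* Here w x < A. The difference is bounded crudely by t S, and the missing factors l(x) and exp(- t
   psi(x)) are inserted by comparing x with the fixed point A. Each insertion costs (x / A)^del, and
   x / A < 1 / w. *)
have xA1 : 1 <= x / A by rewrite ler_pdivlMr// mul1r.
have xAE : x / A * A = x by rewrite mulfVK ?gt_eqF.
have [_ _ hl] := h2 _ A xA1 A2A; rewrite xAE in hl.
have he := h3 _ _ A tT xA1 A3A; rewrite xAE in he.
set q := (x / A) `^ del in hl he.
have q0 : 0 < q by rewrite powR_gt0 ?divr_gt0.
have wx0 : 0 < w * x by rewrite mulr_gt0.
have qw : q * q <= w^-1 `^ (2 * del).
  rewrite -powR2 ?divr_gt0//; apply: ge0_ler_powR; rewrite ?nnegrE ?ltW ?divr_gt0 ?mulr_gt0//.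
  by rewrite ltr_pdivrMr// mulrC -ltr_pdivrMr// invrK mulrC.
have p1 := psi_ge0 (w * x); have p2 := psi_ge0 (rho * (w * x)).
have s1 : psi (w * x) <= S by apply: hS; rewrite ltW//=; lra.
have s2 : psi (rho * (w * x)) <= S.
  by case/andP: rho12 => _ r2; apply: hS; apply/andP; split; nra.
have e1 : `|expR (- (t * psi (w * x))) - expR (- (t * psi (rho * (w * x))))| <= t * S.
  have ub (y z : R) : 0 <= y -> y <= S -> 0 <= z -> z <= S ->
      expR (- (t * y)) - expR (- (t * z)) <= t * S.
    move=> y0 yS z0 zS.
    have := expR_ge1Dx (- (t * z)).
    have : expR (- (t * y)) <= 1 by rewrite -expR0 ler_expR oppr_le0 mulr_ge0// ltW.
    have : t * z <= t * S by rewrite ler_pM2l.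
    lra.
  by rewrite ler_norml -lerN2 opprK opprB !ub.
have e2 : 1 <= K / l A * q * l x.
  by rewrite (_ : _ * _ = (K * q * l x) / l A); [rewrite ler_pdivlMr// mul1r|ring].
have e3 : 1 <= expR (- (t * psi x)) * (expR (T * S) * c * q).
  rewrite expRN mulrC ler_pdivlMr ?expR_gt0// mul1r.
  apply: le_trans (_ : expR (T * S) * expR (t * `|psi x - psi A|) <= _).
    rewrite -expRD ler_expR.
    have : t * psi A <= T * S.
      apply: ler_pM; rewrite ?(ltW t0)//; first by case/andP: tT.
      by apply: hS; lra.
    have := ler_wpM2l (ltW t0) (ler_norm (psi x - psi A)); lra.
  by rewrite -mulrA ler_pM2l ?expR_gt0.
apply: (le_trans e1).
apply: (@le_trans _ _ (C2 * (q * q) * D)).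
  have -> : C2 * (q * q) * D = t * S * ((K / l A * q * l x) *
     (expR (- (t * psi x)) * (expR (T * S) * c * q))) by rewrite /C2 /D; ring.
  have tS : 0 < t * S by rewrite mulr_gt0.
  by rewrite ler_peMr ?(ltW tS)// -[leLHS]mulr1; apply: ler_pM.
rewrite ler_pM2r//; apply: ler_pM; [exact: ltW|by rewrite mulr_ge0// ltW|lra|lra].
Qed.

Section sequences.
Variables (t x : nat -> R).
Hypothesis t_gt0 : forall n, 0 < t n.
Hypothesis t_cvg0 : t n @[n --> \oo] --> 0.
Hypothesis x_cvgy : x n @[n --> \oo] --> +oo.

(** After division by exp(- t psi(x)) each exponential has the form exp(- s y), with s = t l(x)
    tending to 0 by boundedness of [l] and y tending to ln v by the de Haan property. Linearising at
    0 leaves an error of order s y^2 after division by s. *)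
Lemma exp_psi_difference_cvg (w w' : R) : 0 < w -> 0 < w' ->
  (expR (- (t n * psi (w * x n))) - expR (- (t n * psi (w' * x n)))) /
    (t n * l (x n) * expR (- (t n * psi (x n)))) @[n --> \oo] --> ln w' - ln w.
Proof.
pose s n := t n * l (x n).
have near_a : \forall n \near \oo, a <= x n.
  by move/cvgryPge : x_cvgy => /(_ a).
have s0 : s n @[n --> \oo] --> 0.
  apply: (@squeeze_cvgr _ _ _ _ (cst 0) (fun n => t n * M)).
  - near=> n; have an : a <= x n by near: n.
    have := l_gt0 an; have := l_leM an; have := t_gt0 n.
    move=> h1 h2 h3; rewrite /s; apply/andP; split.
      by rewrite mulr_ge0// ltW.
    by rewrite ler_pM2l.
  - exact: cvg_cst.
  - by rewrite -(mul0r M); apply: cvgM => //; exact: cvg_cst.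
have key (v : R) : 0 < v ->
    (expR (t n * psi (x n) - t n * psi (v * x n)) - 1) / s n @[n --> \oo] --> - ln v.
  move=> v0.
  pose y n := (psi (v * x n) - psi (x n)) / l (x n).
  have yv : y n @[n --> \oo] --> ln v.
    exact: (cvg_comp _ _ x_cvgy (psi_Pi v0)).
  have sy : - (s n * y n) @[n --> \oo] --> 0.
    by rewrite -oppr0 -(mul0r (ln v)); apply: cvgN; apply: cvgM.
  have err : s n * y n ^+ 2 * expR `|- (s n * y n)| @[n --> \oo] --> 0.
    rewrite [X in _ --> X](_ : 0 = 0 * ln v ^+ 2 * expR `|(0 : R)|); last first.
      by rewrite !mul0r.
    apply: cvgM; first by apply: cvgM => //; apply: cvgM.
    by apply: continuous_cvg; [exact: continuous_expR|exact: cvg_norm].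
  apply/cvgrPdist_le => e e0.
  have e20 : 0 < e / 2 by lra.
  near=> n.
  have an : a <= x n by near: n.
  have sn : 0 < s n by rewrite mulr_gt0// l_gt0.
  have h1 : `|0 - s n * y n ^+ 2 * expR `|- (s n * y n)| | <= e / 2.
    by near: n; move: (e / 2) e20; apply/cvgrPdist_le.
  have h2 : `|ln v - y n| <= e / 2.
    by near: n; move: (e / 2) e20; apply/cvgrPdist_le.
  have syE : t n * psi (x n) - t n * psi (v * x n) = - (s n * y n).
    by rewrite /s /y; field; rewrite gt_eqF// l_gt0.
  rewrite syE.
  have h3 := norm_expR_subD (- (s n * y n)).
  have h4 : `|(expR (- (s n * y n)) - 1) / s n + y n| <= e / 2.
    have -> : (expR (- (s n * y n)) - 1) / s n + y n =
       (expR (- (s n * y n)) - 1 - - (s n * y n)) / s n.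
      by field; rewrite gt_eqF.
    rewrite normrM [`|(s n)^-1|]gtr0_norm ?invr_gt0// ler_pdivrMr//.
    apply: (le_trans h3); rewrite sqrrN exprMn.
    move: h1; rewrite sub0r normrN ger0_norm; last first.
      by rewrite mulr_ge0 ?expR_ge0// mulr_ge0 ?sqr_ge0// ltW.
    rewrite -(ler_pM2r sn); apply: le_trans; rewrite le_eqVlt.
    by apply/orP; left; apply/eqP; ring.
  have -> : - ln v - (expR (- (s n * y n)) - 1) / s n =
    - ((ln v - y n) + ((expR (- (s n * y n)) - 1) / s n + y n)) by ring.
  by rewrite normrN; apply: (le_trans (ler_normD _ _)); lra.
move=> w0 w'0.
have -> : ln w' - ln w = - ln w - - ln w' by ring.
apply: cvg_trans (cvgB (key _ w0) (key _ w'0)); apply: near_eq_cvg.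
near=> n => /=.
have an : a <= x n by near: n.
have sn : 0 < s n by rewrite mulr_gt0// l_gt0.
rewrite !fctE /= !expRD -/(s n) !expRN; field.
by rewrite !gt_eqF ?expR_gt0.
Unshelve. all: by end_near. Qed.
End sequences.
End slow_variation.

(** * One-dimensional integrals *)

Lemma measurable_funM_cst (R : realType) (c : R) :
  measurable_fun [set: measurableTypeR R] (fun x : R => (c * x)%R : measurableTypeR R).
Proof. by apply: measurable_funM => //; exact: measurable_id. Qed.

(** By uniqueness of Lebesgue measure it suffices to compare both sides on half-open intervals. *)
Lemma lebesgue_measure_scale (R : realType) (c : R) (A : set R) : 0 < c ->
  measurable A ->
  (c%:E * pushforward (@lebesgue_measure R)
     (fun x : R => (c * x)%R : measurableTypeR R) A = lebesgue_measure A)%E.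
Proof.
move=> c0 mA.
have c0' : 0 <= c by exact: ltW.
have mphi := @measurable_funM_cst R c.
pose nu' : {measure set (measurableTypeR R) -> \bar R} :=
  mscale (NngNum c0') (pushforward (@lebesgue_measure R)
     (fun x : R => (c * x)%R : measurableTypeR R)).
transitivity (nu' mphi A) => //.
apply/esym/lebesgue_measure_unique => //= _ [[a b]] _ <-.
rewrite /nu' /= /mscale/= /pushforward.
rewrite (_ : _ @^-1` _ = `]a / c, b / c]%classic); last first.
  apply/seteqP; split => x /=; rewrite !in_itv/= => /andP[].
    by rewrite ltr_pdivrMr// ler_pdivlMr// mulrC => -> ->.
  by rewrite ltr_pdivrMr// ler_pdivlMr// mulrC => -> ->.
rewrite !lebesgue_measure_itv/= !lte_fin ltr_pM2r ?invr_gt0//.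
case: ifPn => _; last by rewrite mule0.
by rewrite -!EFinB -EFinM -mulrBl mulrC mulfVK ?gt_eqF.
Qed.

Lemma ge0_integral_scale (R : realType) (c : R) (f : R -> \bar R) : 0 < c ->
  measurable_fun setT f -> (forall x, (0 <= f x)%E) ->
  (\int[@lebesgue_measure R]_x f x = c%:E * \int[@lebesgue_measure R]_x f (c * x)%R)%E.
Proof.
move=> c0 mf f0.
have c0' : 0 <= c by exact: ltW.
have mphi := @measurable_funM_cst R c.
rewrite -(@ge0_integral_pushforward _ _ _ _ R _ mphi (@lebesgue_measure R) setT f)//.
pose nu' : {measure set (measurableTypeR R) -> \bar R} :=
  (pushforward (@lebesgue_measure R) (fun x : R => (c * x)%R : measurableTypeR R)).
have := @ge0_integral_mscale _ _ _ (nu' mphi) setT measurableT (NngNum c0') f mf (fun x _ => f0 x).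
move=> /= <-.
by apply: eq_measure_integral => A mA _; exact/esym/(lebesgue_measure_scale c0).
Qed.

Lemma tonelli_in (d1 d2 : measure_display) (T1 : measurableType d1)
    (T2 : measurableType d2) (R : realType)
    (m1 : {sigma_finite_measure set T1 -> \bar R})
    (m2 : {sigma_finite_measure set T2 -> \bar R}) (A : set T1) (B : set T2)
    (f : T1 * T2 -> \bar R) :
  measurable A -> measurable B -> measurable_fun (A `*` B) f ->
  (forall x y, A x -> B y -> (0 <= f (x, y))%E) ->
  (\int[m1]_(x in A) \int[m2]_(y in B) f (x, y) =
   \int[m2]_(y in B) \int[m1]_(x in A) f (x, y))%E.
Proof.
move=> mA mB mf f0.
pose g := f \_ (A `*` B).
have mg : measurable_fun setT g.
  exact: ((measurable_restrictT f (measurableX mA mB)).1 mf).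
have g0 z : (0 <= g z)%E.
  by rewrite /g patchE; case: ifPn => // /set_mem; case: z => x y [] /= *; exact: f0.
have gE x y : A x -> B y -> g (x, y) = f (x, y).
  by move=> Ax By; rewrite /g patchE mem_set.
have gA x y : ~ A x -> g (x, y) = 0%E.
  by move=> nA; rewrite /g patchE memNset//= => -[].
have gB x y : ~ B y -> g (x, y) = 0%E.
  by move=> nA; rewrite /g patchE memNset//= => -[].
transitivity (\int[m1]_x \int[m2]_y g (x, y))%E.
  rewrite [LHS]integral_mkcond; apply: eq_integral => x _.
  rewrite patchE; case: ifPn => [/set_mem Ax|/negP nA].
    rewrite integral_mkcond; apply: eq_integral => y _.
    rewrite patchE; case: ifPn => [/set_mem By|/negP nB]; first by rewrite gE.
    by rewrite gB// => By; apply: nB; exact/mem_set.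
  by rewrite integral0_eq// => y _; rewrite gA// => Ax; apply: nA; exact/mem_set.
rewrite fubini_tonelli//.
rewrite [RHS]integral_mkcond; apply: eq_integral => y _.
rewrite patchE; case: ifPn => [/set_mem By|/negP nB].
  rewrite [RHS]integral_mkcond; apply: eq_integral => x _.
  rewrite patchE; case: ifPn => [/set_mem Ax|/negP nA]; first by rewrite gE.
  by rewrite gA// => By'; apply: nA; exact/mem_set.
by rewrite integral0_eq// => x _; rewrite gB// => Ax; apply: nB; exact/mem_set.
Qed.

Lemma is_derive_expRM (R : realType) (c x : R) :
  is_derive (x : R) (1 : R) (fun x : R => expR (c * x)) (c * expR (c * x)).
Proof.
have h : is_derive (x : R) (1 : R) (fun x : R => c * x) c.
  by have := @is_deriveZ R R^o R^o (fun x : R => x) c x 1 1 (is_derive_id x 1);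
     rewrite /GRing.scale/= mulr1.
have := is_derive1_comp (is_derive_expR (c * x)) h.
by rewrite mulrC.
Qed.

Lemma is_derive_expRZ (R : realType) (k c x : R) :
  is_derive (x : R) (1 : R) (fun x : R => k * expR (c * x)) (k * (c * expR (c * x))).
Proof.
exact: (@is_deriveZ R R^o R^o (fun x : R => expR (c * x)) k x 1 _ (is_derive_expRM c x)).
Qed.

Lemma integral_expRN (R : realType) (s : R) : 0 < s ->
  (\int[@lebesgue_measure R]_(v in `]0%R, +oo[) (expR (- (s * v)))%:E = (s^-1)%:E)%E.
Proof.
move=> s0.
have mf : measurable_fun (`]0, +oo[%classic : set R) (fun v : R => (expR (- (s * v)))%:E).
  apply/measurable_EFinP; apply: measurable_funTS.
  apply: continuous_measurable_fun => v; apply: continuous_comp; last exact: continuous_expR.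
  by apply: cvgN; apply: cvgMl_tmp; exact: cvg_id.
rewrite integral_itv_obnd_cbnd//.
have dF (x : R) : is_derive (x : R) (1 : R) (fun v => - s^-1 * expR (- s * v)) (expR (- s * x)).
  have := is_derive_expRZ (- s^-1) (- s) x.
  rewrite (_ : _ * _ = expR (- s * x))//.
  by rewrite mulrA mulrNN mulVf ?mul1r// gt_eqF.
rewrite (@ge0_continuous_FTC2y R (fun v => expR (- (s * v)))
  (fun v => - s^-1 * expR (- s * v)) 0 0).
- by rewrite mulr0 expR0 mulr1 -EFinB sub0r opprK.
- by move=> x _; exact: expR_ge0.
- apply: continuous_subspaceT => v; apply: continuous_comp; last exact: continuous_expR.
  by apply: cvgN; apply: cvgMl_tmp; exact: cvg_id.
- rewrite [X in _ --> X](_ : 0 = - s^-1 * 0); last by rewrite mulr0.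
  apply: cvgMl_tmp; under eq_fun do rewrite mulNr.
  apply: (cvg_comp (fun v => s * v) (fun v => expR (- v))); last exact: cvgr_expR.
  by apply: gt0_cvgMry => //; exact: cvg_id.
- by move=> x _; have [] := dF x.
- apply: cvg_at_right_filter; apply: cvgMl_tmp.
  apply: continuous_comp; last exact: continuous_expR.
  by apply: cvgMl_tmp; exact: cvg_id.
- move=> x _; rewrite derive1E; have [_ ->] := dF x; by rewrite mulNr.
Qed.

(** The quotient is the integral of exp(- u v) over u in [s, s']. Tonelli reduces the claim to the
    integral of 1 / u. *)
Lemma frullani (R : realType) (s s' : R) : 0 < s -> s < s' ->
  (\int[@lebesgue_measure R]_(v in `]0%R, +oo[)
    ((expR (- (s * v)) - expR (- (s' * v))) / v)%:E = (ln s' - ln s)%:E)%E.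
Proof.
move=> s0 ss'.
transitivity (\int[@lebesgue_measure R]_(v in `]0%R, +oo[)
   \int[@lebesgue_measure R]_(u in `[s, s']) (expR (- (u * v)))%:E)%E.
  apply: eq_integral => v; rewrite inE/= in_itv/= andbT => v0.
  have dF (x : R) : is_derive (x : R) (1 : R) (fun u => - v^-1 * expR (- v * u)) (expR (- v * x)).
    have := is_derive_expRZ (- v^-1) (- v) x.
    rewrite (_ : _ * _ = expR (- v * x))//.
    by rewrite mulrA mulrNN mulVf ?mul1r// gt_eqF.
  rewrite (@continuous_FTC2 R (fun u => expR (- (u * v))) (fun u => - v^-1 * expR (- v * u)))//.
  - rewrite -EFinB; congr EFin; rewrite !mulNr opprK [RHS]addrC -[RHS]mulrBr [RHS]mulrC.
    by rewrite (mulrC v s) (mulrC v s').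
  - apply: continuous_subspaceT => u; apply: continuous_comp; last exact: continuous_expR.
    by apply: cvgN; apply: cvgMr_tmp; exact: cvg_id.
  - have cF : continuous (fun u => - v^-1 * expR (- v * u)).
      move=> u; apply: cvgMl_tmp; apply: continuous_comp; last exact: continuous_expR.
      by apply: cvgMl_tmp; exact: cvg_id.
    split.
    + by move=> x _; have [] := dF x.
    + by apply: cvg_at_right_filter; exact: cF.
    + by apply: cvg_at_left_filter; exact: cF.
  - by move=> x _; rewrite derive1E; have [_ ->] := dF x; rewrite mulNr mulrC.
have mexp : measurable_fun setT (fun z : R * R => (expR (- (z.2 * z.1)))%:E).
  apply/measurable_EFinP; apply: measurableT_comp => //.
  by apply: measurableT_comp => //; apply: measurable_funM.
rewrite (@tonelli_in _ _ _ _ R lebesgue_measure lebesgue_measure _ _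
  (fun z => (expR (- (z.2 * z.1)))%:E))//=; last first.
  exact: measurable_funTS mexp.
transitivity (\int[@lebesgue_measure R]_(u in `[s, s']) (u^-1)%:E)%E.
  apply: eq_integral => u; rewrite inE/= in_itv/= => /andP[su us'].
  by rewrite integral_expRN//; lra.
have dl (x : R) : s <= x -> is_derive (x : R) (1 : R) (@ln R) x^-1.
  by move=> sx; apply: is_derive1_ln; lra.
rewrite (@continuous_FTC2 R (fun u => u^-1) (@ln R))//.
- apply: continuous_in_subspaceT => u; rewrite inE/= in_itv/= => /andP[su us'].
  by apply: cvgV; [rewrite gt_eqF//; lra|exact: cvg_id].
- split.
  + move=> x; rewrite in_itv/= => /andP[sx _]; have [] := dl x (ltW sx) => //.
  + by apply: cvg_at_right_filter; apply: continuous_ln.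
  + by apply: cvg_at_left_filter; apply: continuous_ln; lra.
- by move=> x; rewrite in_itv/= => /andP[sx _]; rewrite derive1E; have [_ ->] := dl x (ltW sx).
Qed.

(** The exponent may be negative, so the integral is improper at 0: the integrals over an exhaustion
    by compact intervals stay below 1 / c. *)
Lemma integral_powR_lty (R : realType) (c : R) : 0 < c ->
  (\int[@lebesgue_measure R]_(v in `]0%R, 1%R]) (v `^ (c - 1))%:E < +oo)%E.
Proof.
move=> c0.
(* The shift by two keeps the left endpoint strictly below 1, as the fundamental theorem of calculus
   requires. *)
pose F n : set R := `[(n.+2%:R)^-1, 1]%classic.
have mpow A : measurable_fun A (fun v : R => (v `^ (c - 1))%:E).
  by apply/measurable_EFinP; apply: measurable_funTS; exact: measurable_powR.
have -> : `]0, 1]%classic = \bigcup_n F n.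
  apply/seteqP; split => v /=; last first.
    move=> [n _]; rewrite /F /= !in_itv/= => /andP[h ->]; rewrite andbT.
    by rewrite (lt_le_trans _ h).
  rewrite in_itv/= => /andP[v0 v1].
  exists (Num.truncn v^-1) => //; rewrite /F /= in_itv/= v1 andbT.
  rewrite -[leRHS]invrK lef_pV2 ?posrE ?invr_gt0//.
  by have := truncnS_gt v^-1; rewrite -[in leRHS]natr1; lra.
have cv : (\int[@lebesgue_measure R]_(v in F n) (v `^ (c - 1))%:E)%E @[n --> \oo] -->
    (\int[@lebesgue_measure R]_(v in \bigcup_n F n) (v `^ (c - 1))%:E)%E.
  apply: ge0_nondecreasing_set_cvg_integral => //.
  - apply/nondecreasing_seqP => n; apply/subsetPset => v; rewrite /F /= !in_itv/=.
    move=> /andP[h ->]; rewrite andbT (le_trans _ h)// lef_pV2 ?posrE//.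
    by rewrite ler_nat.
  - by move=> i; exact: measurable_itv.
  - by move=> i; exact: mpow.
  - by move=> i x _; rewrite lee_fin powR_ge0.
apply: (@le_lt_trans _ _ (c^-1)%:E); last by rewrite ltry.
rewrite -(cvg_lim _ cv)//; apply: lime_le; first by apply/cvg_ex; eexists; exact: cv.
apply: nearW => n.
have n0 : 0 < (n.+2%:R)^-1 :> R by rewrite invr_gt0.
have dF (x : R) : 0 < x -> is_derive (x : R) (1 : R) (fun v : R => c^-1 * v `^ c) (x `^ (c - 1)).
  move=> x0; have := @is_deriveZ R R^o R^o (fun v : R => v `^ c) c^-1 x 1 _ (is_derive1_powR c x0).
  by rewrite /GRing.scale/= mulrA mulVf ?mul1r// gt_eqF.
have cF (e x : R) : 0 < x -> {for x, continuous (fun v : R => v `^ e)}.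
  move=> x0; apply/differentiable_continuous/derivable1_diffP.
  by have [] := is_derive1_powR e x0.
rewrite (@continuous_FTC2 R (fun v => v `^ (c - 1)) (fun v => c^-1 * v `^ c)).
- rewrite powR1 mulr1 -EFinB lee_fin lerBlDr lerDl mulr_ge0 ?powR_ge0//.
  by rewrite invr_ge0 ltW.
- by rewrite invf_lt1// ltr1n.
- apply: continuous_in_subspaceT => u; rewrite inE/= in_itv/= => /andP[su us'].
  by apply: cF; exact: lt_le_trans n0 su.
- split.
  + by move=> x; rewrite in_itv/= => /andP[sx _]; have [] := dF x (lt_trans n0 sx).
  + by apply: cvg_at_right_filter; apply: cvgMl_tmp; exact: cF.
  + by apply: cvg_at_left_filter; apply: cvgMl_tmp; exact: cF.
- by move=> x; rewrite in_itv/= => /andP[sx _]; rewrite derive1E;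
     have [_ ->] := dF x (lt_trans n0 sx).
Qed.

(** * Gaussian integral of a cosine *)

Section gauss_cos.
Variable R : realType.
Notation mu := (@lebesgue_measure R).

Lemma gauss_cos_aux1 (a y z : R) :
  is_derive (y : R) (1 : R) (fun y : R => cos (a + 2 * z * y) * gauss_fun z)
    (- (2 * z * sin (a + 2 * z * y)) * gauss_fun z).
Proof.
have h : is_derive (y : R) (1 : R) (fun y : R => a + 2 * z * y) (2 * z).
  have h1 := is_derive_cst a y (1 : R).
  have := is_deriveD h1 (@is_deriveZ R R^o R^o (fun x : R => x) (2 * z) y 1 1 (is_derive_id y 1)).
  by rewrite /GRing.scale/= mulr1 add0r.
have h2 := @is_derive1_comp R (@cos R) (fun y => a + 2 * z * y) y _ _ (is_derive_cos _) h.
have := @is_deriveZ R R^o R^o (fun y : R => cos (a + 2 * z * y)) (gauss_fun z) y 1 _ h2.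
rewrite /GRing.scale/= (_ : gauss_fun z * _ = - (2 * z * sin (a + 2 * z * y)) * gauss_fun z).
  rewrite (_ : (_ \*: _) = (fun y : R => cos (a + 2 * z * y) * gauss_fun z))//.
  by apply/funext => u /=; rewrite /GRing.scale/= mulrC.
by ring.
Qed.

(** The second summand is exactly the derivative in [y] computed in [gauss_cos_aux1]. Integrating
    this total derivative in [z] therefore yields a differential equation in [y]. *)
Lemma gauss_cos_aux2 (a y z : R) :
  is_derive (z : R) (1 : R) (fun z : R => sin (a + 2 * z * y) * gauss_fun z)
    (2 * y * (cos (a + 2 * z * y) * gauss_fun z) +
     - (2 * z * sin (a + 2 * z * y)) * gauss_fun z).
Proof.
have h : is_derive (z : R) (1 : R) (fun z : R => a + 2 * z * y) (2 * y).
  have h1 := is_derive_cst a z (1 : R).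
  have := is_deriveD h1 (@is_deriveZ R R^o R^o (fun x : R => x) (2 * y) z 1 1 (is_derive_id z 1)).
  rewrite /GRing.scale/= mulr1 add0r.
  rewrite (_ : (cst a + _) = (fun z : R => a + 2 * z * y))//.
  by apply/funext => u; rewrite fctE /= /GRing.scale/=; ring.
have h2 := @is_derive1_comp R (@sin R) (fun z => a + 2 * z * y) z _ _ (is_derive_sin _) h.
have h3 : is_derive (z : R) (1 : R) (fun z : R => - z ^+ 2) (- (2 * z)).
  have := is_deriveN (@is_deriveX R R^o (fun x : R => x) 2 z 1 1 (is_derive_id z 1)).
  by rewrite /GRing.scale/= expr1 mulr1.
have h4 := @is_derive1_comp R (@expR R) (fun z => - z ^+ 2) z _ _ (is_derive_expR _) h3.
have := is_deriveM h2 h4.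
rewrite /GRing.scale/= (_ : _ + _ = 2 * y * (cos (a + 2 * z * y) * gauss_fun z) +
     - (2 * z * sin (a + 2 * z * y)) * gauss_fun z)//.
by rewrite /gauss_fun; ring.
Qed.

Lemma continuous_gauss_cos (f : R -> R) (a y : R) : continuous f ->
  continuous (fun z : R => f (a + 2 * z * y)).
Proof.
move=> cf z; apply: continuous_comp; last exact: cf.
apply: cvgD; first exact: cvg_cst.
by apply: cvgMr_tmp; apply: cvgMl_tmp; exact: cvg_id.
Qed.

Lemma integrable_gauss_scale (c : R) : 0 < c ->
  mu.-integrable setT (fun z => (gauss_fun (c * z))%:E).
Proof.
move=> c0; have mg : measurable_fun setT (fun z : R => (gauss_fun (c * z))%:E).
  apply/measurable_EFinP; apply: measurableT_comp; first exact: measurable_gauss_fun.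
  exact: measurable_funM.
apply/integrableP; split => //.
under eq_integral do rewrite gee0_abs ?lee_fin ?gauss_fun_ge0//.
have := @ge0_integral_scale R c (fun z => (gauss_fun z)%:E) c0.
rewrite integralT_gauss => h; rewrite ltey; apply/eqP => hy; move: h; rewrite hy.
rewrite gt0_muley ?lte_fin// => h; suff : (+oo = (Num.sqrt pi)%:E :> \bar R)%E by [].
rewrite -h//; last by move=> x; rewrite lee_fin gauss_fun_ge0.
by apply/measurable_EFinP; exact: measurable_gauss_fun.
Qed.

(** This function dominates the [y]-derivative of the integrand uniformly in [y]. It is integrable
    since |z| <= exp(z^2 / 2), which leaves a Gaussian with argument z / sqrt 2. *)
Lemma integrable_norm_gauss : mu.-integrable setT (fun z => (2 * `|z| * gauss_fun z)%:E).
Proof.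
have c0 : 0 < (Num.sqrt 2)^-1 :> R by rewrite invr_gt0 sqrtr_gt0.
have ig := integrable_gauss_scale c0.
apply: (@le_integrable _ _ _ mu setT measurableT _
  (fun z => 2%:E * (gauss_fun ((Num.sqrt 2)^-1 * z))%:E)%E).
- apply/measurable_EFinP; apply: measurable_funM; last exact: measurable_gauss_fun.
  by apply: measurable_funM => //; exact: measurableT_comp.
- move=> z _; rewrite -EFinM !abse_EFin lee_fin.
  rewrite [leLHS]ger0_norm ?mulr_ge0 ?gauss_fun_ge0//.
  rewrite [leRHS]ger0_norm ?mulr_ge0 ?gauss_fun_ge0//.
  rewrite -mulrA ler_pM2l// /gauss_fun exprMn exprVn sqr_sqrtr//.
  have h : `|z| <= expR (2^-1 * z ^+ 2).
    apply: le_trans (expR_ge1Dx _); rewrite -[z ^+ 2]real_normK ?num_real//.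
    by set w := `|z|; nra.
  apply: (@le_trans _ _ (expR (2^-1 * z ^+ 2) * expR (- z ^+ 2))).
    by rewrite ler_pM2r ?expR_gt0.
  by rewrite -expRD ler_expR; lra.
- exact: (@integrableZl _ _ _ mu setT measurableT 2 _ ig).
Qed.

Variable a : R.
Let f (y z : R) := cos (a + 2 * z * y) * gauss_fun z.
Let g (y z : R) := - (2 * z * sin (a + 2 * z * y)) * gauss_fun z.

Let cf y : continuous (f y).
Proof.
move=> z; apply: cvgM; last exact: continuous_gauss_fun.
by apply: continuous_gauss_cos; exact: continuous_cos.
Qed.

Let cg y : continuous (g y).
Proof.
move=> z; apply: cvgM; last exact: continuous_gauss_fun.
apply: cvgN; apply: cvgM; first by apply: cvgMl_tmp; exact: cvg_id.
by apply: continuous_gauss_cos; exact: continuous_sin.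
Qed.

Let g_le y z : `|g y z| <= 2 * `|z| * gauss_fun z.
Proof.
rewrite /g normrM (ger0_norm (gauss_fun_ge0 _)) ler_wpM2r ?gauss_fun_ge0//.
rewrite normrN !normrM (ger0_norm (_ : 0 <= 2))// -[leRHS]mulr1.
by rewrite ler_wpM2l ?mulr_ge0//; exact: sin_max.
Qed.

Let intf y : mu.-integrable setT (EFin \o f y).
Proof.
apply: (le_integrable measurableT _ _ integrableT_gauss).
  by apply/measurable_EFinP; apply: continuous_measurable_fun; exact: cf.
move=> z _ /=; rewrite lee_fin normrM ler_piMl//; exact: cos_max.
Qed.

Let intg y : mu.-integrable setT (EFin \o g y).
Proof.
apply: (le_integrable measurableT _ _ integrable_norm_gauss).
  by apply/measurable_EFinP; apply: continuous_measurable_fun; exact: cg.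
move=> z _ /=; rewrite lee_fin [leRHS]ger0_norm ?mulr_ge0 ?gauss_fun_ge0//.
Qed.

Let H y := (\int[mu]_z f y z)%R.

Let dH (y : R) : is_derive (y : R) (1 : R) H (\int[mu]_z g y z)%R.
Proof.
have ya : `]y - 1, y + 1[%classic y.
  by rewrite /= in_itv/=; apply/andP; split; lra.
have d1 (x z : R) : partial1of2 f x z = g x z.
  by rewrite partial1of2E; have [_ ->] := gauss_cos_aux1 a x z.
have dv x z : derivable (f^~ z) x 1 by have [] := gauss_cos_aux1 a x z.
have h := @cvg_differentiation_under_integral R _ _ mu f setT measurableT y _ _ ya
   (fun x _ => intf x) (fun x z _ _ => dv x z)
   (fun z => 2 * `|z| * gauss_fun z) _ integrable_norm_gauss _.
have {}h : h^-1 *: (H (h + y) - H y) @[h --> 0^'] --> (\int[mu]_z g y z)%R.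
  rewrite (_ : (\int[mu]_z g y z)%R = (\int[mu]_z partial1of2 f y z)%R); last first.
    by apply: eq_Rintegral => z _; rewrite d1.
  apply: h.
    by move=> z; rewrite !mulr_ge0 ?gauss_fun_ge0.
  by move=> x z _ _; rewrite d1.
have dH : derivable H y 1.
  by apply/cvg_ex; eexists => /=; under eq_fun do rewrite scaler1; exact: h.
apply: DeriveDef => //; apply/cvg_lim => //=.
by under eq_fun do rewrite scaler1.
Qed.

(** The integrand is the total derivative of sin(a + 2 z y) exp(- z^2), which vanishes at both ends;
    the integrals over growing intervals converge by domination. *)
Let ibp (y : R) : (\int[mu]_z (2 * y * f y z + g y z))%R = 0.
Proof.
pose F (z : R) := sin (a + 2 * z * y) * gauss_fun z.
pose F' (z : R) := 2 * y * f y z + g y z.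
have cF' : continuous F'.
  by move=> z; apply: cvgD; [apply: cvgMl_tmp; exact: cf|exact: cg].
have cF : continuous F.
  move=> z; apply: cvgM; last exact: continuous_gauss_fun.
  by apply: continuous_gauss_cos; exact: continuous_sin.
have iF' : mu.-integrable setT (EFin \o F').
  apply: (@integrableD _ _ _ mu setT measurableT
    (fun z => (2 * y)%:E * (f y z)%:E)%E (EFin \o g y)) => //.
  exact: (@integrableZl _ _ _ mu setT measurableT (2 * y) _ (intf y)).
pose I n : set R := `[- n.+1%:R, n.+1%:R]%classic.
have lim1 : (\int[mu]_z ((F' \_ (I n)) z)%:E)%E @[n --> \oo] --> (\int[mu]_z (F' z)%:E)%E.
  apply: (@dominated_cvg _ _ _ mu setT measurableT _ _ (fun z => `|F' z|%:E)) => //.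
  - move=> n; apply/measurable_EFinP; apply/(measurable_restrictT _ _).1;
      first exact: measurable_itv.
    by apply: measurable_funTS; exact: continuous_measurable_fun.
  - move=> z _; apply: cvg_near_cst.
    have [m hm] : exists m, `|z| <= m%:R.
      by exists (Num.truncn `|z|).+1; apply/ltW; exact: truncnS_gt.
    exists m => // n /= mn; rewrite patchE mem_set//= /I /= in_itv/= -ler_norml.
    by apply: (le_trans hm); rewrite ler_nat (leq_trans mn).
  - exact: (@integrable_abse _ _ _ mu setT _ iF').
  - by move=> n z _; rewrite lee_fin patchE; case: ifP; rewrite ?normr0.
have lim2 : (\int[mu]_z ((F' \_ (I n)) z)%:E)%E @[n --> \oo] --> 0%E.
  have E n : (\int[mu]_z ((F' \_ (I n)) z)%:E)%E = (F n.+1%:R - F (- n.+1%:R))%:E.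
    rewrite (_ : (\int[mu]_z _)%E = (\int[mu]_(z in I n) (F' z)%:E)%E); last first.
      rewrite [RHS]integral_mkcond; apply: eq_integral => z _.
      by rewrite !patchE; case: ifP.
    rewrite (@continuous_FTC2 R F' F) ?EFinB//.
    - by rewrite -subr_gt0 opprK addr_gt0.
    - exact: continuous_subspaceT.
    - split.
      + by move=> z _; have [] := gauss_cos_aux2 a y z.
      + by apply: cvg_at_right_filter; exact: cF.
      + by apply: cvg_at_left_filter; exact: cF.
    - by move=> z _; rewrite derive1E; have [_ ->] := gauss_cos_aux2 a y z.
  under eq_fun do rewrite E.
  apply: cvg_EFin; first exact: nearW.
  have gn : gauss_fun n.+1%:R @[n --> \oo] --> (0 : R).
    rewrite (cvg_shiftS (fun n => gauss_fun (n%:R : R))).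
    exact: (cvg_comp _ _ (@cvgr_idn R) (@cvg_gauss_fun R)).
  apply: (@squeeze_cvgr _ _ _ _ (fun n => - (2 * gauss_fun n.+1%:R))
    (fun n => 2 * gauss_fun n.+1%:R)).
  - apply: nearW => n /=; rewrite -ler_norml.
    apply: (le_trans (ler_normB _ _)).
    rewrite /F !normrM !(ger0_norm (gauss_fun_ge0 _)).
    have -> : gauss_fun (- n.+1%:R) = gauss_fun n.+1%:R :> R by rewrite /gauss_fun sqrrN.
    have := gauss_fun_ge0 (n.+1%:R : R).
    have := sin_max (a + 2 * n.+1%:R * y); have := sin_max (a + 2 * - n.+1%:R * y).
    by nra.
  - rewrite -oppr0 -(mulr0 2); apply: cvgN; apply: cvgMl_tmp; exact: gn.
  - rewrite -(mulr0 2); apply: cvgMl_tmp; exact: gn.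
by rewrite /Rintegral (cvg_unique _ lim1 lim2).
Qed.

(** The integral [H] satisfies H' = - 2 y H, so H(y) exp(y^2) is constant and its value is read at y
    = 0. The phase [a] is kept free so that further coordinates can be absorbed into it. *)
Lemma integral_gauss_cos (y : R) :
  (\int[mu]_z (cos (a + 2 * z * y) * gauss_fun z)%:E =
   (cos a * Num.sqrt pi * gauss_fun y)%:E)%E.
Proof.
have ode (x : R) : is_derive (x : R) (1 : R) H (- (2 * x) * H x).
  have := dH x; rewrite (_ : (\int[mu]_z g x z)%R = - (2 * x) * H x)//.
  have := ibp x; rewrite RintegralD//; last
    exact: (@integrableZl _ _ _ mu setT measurableT (2 * x) _ (intf x)).
  by rewrite RintegralZl// -/(H x) => /eqP; rewrite addr_eq0 => /eqP h; rewrite mulNr h opprK.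
pose K (x : R) := H x * expR (x ^+ 2).
have dK (x : R) : is_derive (x : R) (1 : R) K 0.
  have h3 : is_derive (x : R) (1 : R) (fun z : R => z ^+ 2) (2 * x).
    have := @is_deriveX R R^o (fun x : R => x) 2 x 1 1 (is_derive_id x 1).
    by rewrite /GRing.scale/= expr1 mulr1.
  have h4 := @is_derive1_comp R (@expR R) (fun z => z ^+ 2) x _ _ (is_derive_expR _) h3.
  have := is_deriveM (ode x) h4.
  rewrite /GRing.scale/= (_ : _ + _ = 0)//; ring.
have KE := is_derive_0_is_cst y 0 dK.
have H0 : H 0 = cos a * Num.sqrt pi.
  rewrite /H /f; under eq_Rintegral do rewrite mulr0 addr0.
  by rewrite RintegralZl//; [rewrite /Rintegral integralT_gauss|exact: integrableT_gauss].
have Hy : H y = cos a * Num.sqrt pi * gauss_fun y.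
  move: KE; rewrite /K H0 expr0n/= expR0 mulr1 => <-.
  by rewrite -mulrA /gauss_fun -expRD subrr expR0 mulr1.
rewrite -Hy /H /Rintegral fineK//.
exact: (integrable_fin_num measurableT (intf y)).
Qed.
End gauss_cos.

(** * Tuples, Lebesgue measure on them, and Gaussian integrals *)

Lemma measurable_tdot (R : realType) (d : measure_display) (T : measurableType d)
    (n : nat) (f g : T -> n.-tuple R) :
  measurable_fun setT f -> measurable_fun setT g ->
  measurable_fun setT (fun z => tdot (f z) (g z)).
Proof.
move=> mf mg; apply: measurable_sum => i; apply: measurable_funM.
  exact: (measurableT_comp (measurable_tnth i) mf).
exact: (measurableT_comp (measurable_tnth i) mg).
Qed.

Lemma tdot_cons (R : realType) (n : nat) (x y : R) (t u : n.-tuple R) :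
  tdot (cons_tuple x t) (cons_tuple y u) = x * y + tdot t u.
Proof.
rewrite /tdot big_ord_recl !tnth0; congr (_ + _).
by apply: eq_bigr => i _; rewrite !tnthS.
Qed.

Definition tscale (R : realType) (n : nat) (c : R) (t : n.-tuple R) : n.-tuple R :=
  [tuple c * tnth t i | i < n].

Lemma tscale_cons (R : realType) (n : nat) (c x : R) (t : n.-tuple R) :
  tscale c (cons_tuple x t) = cons_tuple (c * x) (tscale c t).
Proof.
apply: eq_from_tnth => i; rewrite tnth_mktuple.
by case: (unliftP ord0 i) => [j ->|->]; rewrite ?tnth0 ?tnthS ?tnth_mktuple.
Qed.

Lemma tdot_scale (R : realType) (n : nat) (c : R) (t u : n.-tuple R) :
  tdot (tscale c t) u = c * tdot t u.
Proof.
by rewrite /tdot mulr_sumr; apply: eq_bigr => i _; rewrite tnth_mktuple mulrA.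
Qed.

Lemma tdotC (R : realType) (n : nat) (t u : n.-tuple R) : tdot t u = tdot u t.
Proof. by apply: eq_bigr => i _; rewrite mulrC. Qed.

Lemma tdot_ge0 (R : realType) (n : nat) (t : n.-tuple R) : 0 <= tdot t t.
Proof. by apply: sumr_ge0 => i _; rewrite -expr2 sqr_ge0. Qed.

Lemma measurable_tscale (R : realType) (n : nat) (c : R) :
  measurable_fun setT (@tscale R n c).
Proof.
apply/measurable_fun_tnthP => i.
rewrite (_ : _ \o _ = (fun t : n.-tuple R => c * tnth t i)); last first.
  by apply/funext => t /=; rewrite tnth_mktuple.
by apply: measurable_funM => //; exact: measurable_tnth.
Qed.

(** [intRd] is an iterated integral; Tonelli and convergence theorems need a measure. The measure is
    built by induction as the image of a product under [cons_tuple], starting from the Dirac mass at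
    the empty tuple. *)
Lemma exists_tuple_lebesgue (R : realType) (n : nat) :
  exists mu : {sigma_finite_measure set (n.-tuple R) -> \bar R},
    forall f : n.-tuple R -> \bar R, measurable_fun setT f ->
      (forall x, (0 <= f x)%E) -> intRd f = (\int[mu]_x f x)%E.
Proof.
elim: n => [|n [mu muE]].
  exists \d_([tuple] : 0.-tuple R) => f mf f0 /=.
  by rewrite integral_dirac// diracT mul1e.
pose phi (z : measurableTypeR R * n.-tuple R) : n.+1.-tuple R := cons_tuple z.1 z.2.
have mphi : measurable_fun setT phi.
  apply: (@measurable_cons _ _ _ R (fun z : R * n.-tuple R => z.1) n (fun z => z.2)).
    exact: measurable_fst.
  exact: measurable_snd.
pose m0 : {measure set (n.+1.-tuple R) -> \bar R} :=
  pushforward (@lebesgue_measure R \x mu)%E phi.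
pose m := m0 mphi.
have sf : sigma_finite setT m.
  have [F FT hF] : sigma_finite setT (@lebesgue_measure R \x mu)%E.
    have /sigma_finiteP[F [TF ndF Foo]] := sigma_finiteT (@lebesgue_measure R).
    have /sigma_finiteP[G [TG ndG Goo]] := sigma_finiteT mu.
    exists (fun n => F n `*` G n).
      apply/seteqP; split => // -[x t] _.
      have [i _ Fi] : (\bigcup_i F i) x by rewrite -TF.
      have [j _ Gj] : (\bigcup_i G i) t by rewrite -TG.
      exists (maxn i j) => //; split => /=.
        by move: x Fi; apply/subsetPset/ndF; rewrite leq_maxl.
      by move: t Gj; apply/subsetPset/ndG; rewrite leq_maxr.
    move=> k; have [mF F_oo] := Foo k; have [mG G_oo] := Goo k.
    split; first exact: measurableX.
    by rewrite product_measure1E// lte_mul_pinfty// ge0_fin_numE.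
  (* Sigma-finiteness need not pass to image measures; here the map has a measurable inverse, which
     transports the cover of the product. *)
  pose inv (t : n.+1.-tuple R) : measurableTypeR R * n.-tuple R := (thead t, behead_tuple t).
  have minv : measurable_fun setT inv.
    apply/measurable_fun_pairP; split.
      exact: (measurable_tnth ord0).
    exact: (@measurable_behead _ R n).
  exists (fun k => inv @^-1` (F k)).
    by rewrite -preimage_bigcup -FT preimage_setT.
  move=> k; have [mF Foo] := hF k; split.
    by rewrite -[X in measurable X]setTI; exact: minv.
  rewrite /m /m0 /= /pushforward.
  have invphi z : inv (phi z) = z.
    by case: z => x t; rewrite /inv /phi /= theadE; congr pair; apply: val_inj.
  by rewrite (_ : _ @^-1` _ = F k)//; apply/funext => z; rewrite /preimage/= invphi.
pose H1 := isSFinite.Build _ _ _ _ (sfinite_measure_sigma_finite sf).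
pose H2 := isSigmaFinite.Build _ _ _ _ sf.
pose m' := HB.pack_for (SigmaFiniteMeasure.type (n.+1.-tuple R) R) (Measure.sort m) H1 H2.
exists m' => f mf f0.
rewrite (_ : (\int[m']_x f x)%E = (\int[m]_x f x)%E)//.
rewrite (ge0_integral_pushforward mphi)//.
rewrite fubini_tonelli1//=; last exact: measurableT_comp.
apply: eq_integral => x _; rewrite muE//.
apply: (measurableT_comp mf).
exact: (@measurable_cons _ _ _ R (fun z : n.-tuple R => x) n (fun z => z)).
Qed.

Section tuple_lebesgue.
Variables (R : realType) (n : nat).

Definition tuple_lebesgue : {sigma_finite_measure set (n.-tuple R) -> \bar R} :=
  projT1 (cid (exists_tuple_lebesgue R n)).

Lemma intRdE (f : n.-tuple R -> \bar R) : measurable_fun setT f ->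
  (forall x, (0 <= f x)%E) -> intRd f = (\int[tuple_lebesgue]_x f x)%E.
Proof. exact: (projT2 (cid (exists_tuple_lebesgue R n))). Qed.
End tuple_lebesgue.

Lemma intRd_ge0 (R : realType) (n : nat) (f : n.-tuple R -> \bar R) :
  (forall x, (0 <= f x)%E) -> (0 <= intRd f)%E.
Proof.
elim: n f => [|n IH] f f0 /=; first exact: f0.
by apply: integral_ge0 => x _; exact: IH.
Qed.

Lemma eq_intRd (R : realType) (n : nat) (f g : n.-tuple R -> \bar R) :
  f =1 g -> intRd f = intRd g.
Proof. by move=> /funext ->. Qed.

Lemma measurable_intRd (R : realType) (n : nat) (f : R * n.-tuple R -> \bar R) :
  measurable_fun setT f -> (forall z, (0 <= f z)%E) ->
  measurable_fun setT (fun x : R => intRd (fun t => f (x, t))).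
Proof.
move=> mf f0.
rewrite (_ : (fun x => _) = (fun x => \int[tuple_lebesgue R n]_t f (x, t))%E).
  exact: (@measurable_fun_fubini_tonelli_F _ _ R _ R (tuple_lebesgue R n) f).
apply/funext => x; rewrite intRdE//.
exact: (measurableT_comp mf (measurable_pair1 x)).
Qed.

Lemma measurable_cons_comp (R : realType) (n : nat) (f : n.+1.-tuple R -> \bar R)
    (g : n.-tuple R -> n.-tuple R) (h : R -> R) :
  measurable_fun setT f -> measurable_fun setT g -> measurable_fun setT h ->
  measurable_fun setT (fun z : R * n.-tuple R => f (cons_tuple (h z.1) (g z.2))).
Proof.
move=> mf mg mh; apply: (measurableT_comp mf).
apply: (@measurable_cons _ _ _ R (fun z : R * n.-tuple R => h z.1) n (fun z => g z.2)).
  exact: measurableT_comp.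
exact: measurableT_comp.
Qed.

Lemma measurable_cons_tuple (R : realType) (n : nat) (f : n.+1.-tuple R -> \bar R) (x : R) :
  measurable_fun setT f -> measurable_fun setT (fun t : n.-tuple R => f (cons_tuple x t)).
Proof.
move=> mf; apply: (measurableT_comp mf).
exact: (@measurable_cons _ _ _ R (fun z : n.-tuple R => x) n (fun z => z)).
Qed.

Lemma intRd_scale (R : realType) (n : nat) (c : R) (f : n.-tuple R -> \bar R) : 0 < c ->
  measurable_fun setT f -> (forall x, (0 <= f x)%E) ->
  (intRd f = (c ^+ n)%:E * intRd (fun t => f (tscale c t)))%E.
Proof.
move=> c0; elim: n f => [|n IH] f mf f0 /=.
  by rewrite expr0 mul1e; congr f; apply: eq_from_tnth; case.
transitivity (\int[lebesgue_measure]_x ((c ^+ n)%:E *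
    intRd (fun t => f (cons_tuple x (tscale c t)))))%E.
  apply: eq_integral => x _; rewrite IH//; exact: measurable_cons_tuple.
have mF : measurable_fun setT (fun x : R => intRd (fun t => f (cons_tuple x (tscale c t)))).
  apply: (@measurable_intRd R n (fun z => f (cons_tuple z.1 (tscale c z.2)))) => //.
  by apply: (@measurable_cons_comp R n f _ id) => //; exact: measurable_tscale.
have F0 x : (0 <= intRd (fun t => f (cons_tuple x (tscale c t))))%E.
  by apply: intRd_ge0.
transitivity ((c ^+ n)%:E * \int[lebesgue_measure]_x
    intRd (fun t => f (cons_tuple x (tscale c t))))%E.
  by apply: ge0_integralZl_EFin => //; rewrite exprn_ge0// ltW.
rewrite (ge0_integral_scale c0 mF F0) muleA -EFinM -exprSr; congr (_ * _)%E.
by apply: eq_integral => x _; apply: eq_intRd => t; rewrite tscale_cons.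
Qed.

Lemma integral_gauss_cosD (R : realType) (c a B y : R) :
  (\int[@lebesgue_measure R]_x (c * gauss_fun x * (1 + B * cos (a + 2 * x * y)))%:E =
   (c * Num.sqrt pi * (1 + B * (cos a * gauss_fun y)))%:E)%E.
Proof.
have ig : (@lebesgue_measure R).-integrable setT (fun x => (gauss_fun x)%:E).
  exact: integrableT_gauss.
have ic : (@lebesgue_measure R).-integrable setT (fun x => (cos (a + 2 * x * y) * gauss_fun x)%:E).
  apply: (le_integrable measurableT _ _ ig).
    apply/measurable_EFinP; apply: continuous_measurable_fun => z.
    apply: cvgM; last exact: continuous_gauss_fun.
    by apply: continuous_gauss_cos; exact: continuous_cos.
  move=> z _ /=; rewrite lee_fin normrM ler_piMl//; exact: cos_max.
transitivity (\int[@lebesgue_measure R]_x (c%:E * (gauss_fun x)%:E +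
   (c * B)%:E * (cos (a + 2 * x * y) * gauss_fun x)%:E))%E.
  by apply: eq_integral => x _; rewrite -!EFinM -EFinD; congr EFin; ring.
rewrite integralD//=; [|exact: integrableZl|exact: integrableZl].
rewrite !integralZl// integralT_gauss integral_gauss_cos -!EFinM -EFinD; congr EFin; ring.
Qed.

(** The constant [c] and the phase [a] are general because the induction needs it: fixing the first
    coordinate x multiplies [c] by a Gaussian in x and shifts [a] by 2 x y1. *)
Lemma intRd_gauss_cos (R : realType) (n : nat) (c a : R) (y : n.-tuple R) :
  intRd (fun z : n.-tuple R =>
    (c * expR (- tdot z z) * (1 + cos (a + 2 * tdot z y)))%:E) =
  (c * Num.sqrt pi ^+ n * (1 + cos a * expR (- tdot y y)))%:E.
Proof.
elim: n c a y => [|n IH] c a y /=.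
  by rewrite /tdot !big_ord0 mulr0 addr0 oppr0 expR0 expr0 !mulr1.
case/tupleP: y => y1 y.
transitivity (\int[@lebesgue_measure R]_x (c * Num.sqrt pi ^+ n * gauss_fun x *
    (1 + expR (- tdot y y) * cos (a + 2 * x * y1)))%:E)%E.
  apply: eq_integral => x _.
  transitivity (intRd (fun z : n.-tuple R => ((c * gauss_fun x) * expR (- tdot z z) *
      (1 + cos ((a + 2 * x * y1) + 2 * tdot z y)))%:E)).
    apply: eq_intRd => z; rewrite !tdot_cons /gauss_fun opprD expRD -expr2.
    rewrite (_ : a + 2 * (x * y1 + tdot z y) = a + 2 * x * y1 + 2 * tdot z y).
      by rewrite [c * (_ * _)]mulrA.
    by rewrite mulrDr mulrA addrA.
  rewrite IH; move: (gauss_fun _) (cos _) => u w; congr EFin; ring.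
rewrite integral_gauss_cosD tdot_cons opprD expRD -expr2 /gauss_fun [Num.sqrt pi ^+ n.+1]exprS.
congr EFin; ring.
Qed.

Lemma measurable_expR_tdot (R : realType) n :
  measurable_fun setT (fun z : n.-tuple R => (expR (- tdot z z))%:E).
Proof.
apply/measurable_EFinP; apply: measurableT_comp => //; apply: measurableT_comp => //.
exact: measurable_tdot.
Qed.

Lemma integral_gauss_tuple (R : realType) (n : nat) :
  (\int[tuple_lebesgue R n]_z (expR (- tdot z z))%:E = (Num.sqrt pi ^+ n)%:E)%E.
Proof.
(* At y = 0 the factor 1 + cos equals 2, which the constant 1/2 cancels. *)
have := @intRd_gauss_cos R n 2^-1 0 (tzero R n).
have z0 (z : n.-tuple R) : tdot z (tzero R n) = 0.
  by apply: big1 => i _; rewrite tnth_mktuple mulr0.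
rewrite z0 oppr0 expR0 cos0 !mulr1 => h.
rewrite -intRdE; last 2 first.
- exact: measurable_expR_tdot.
- by move=> x; rewrite lee_fin expR_ge0.
transitivity (intRd (fun z : n.-tuple R =>
    (2^-1 * expR (- tdot z z) * (1 + cos (0 + 2 * tdot z (tzero R n))))%:E)).
  by apply: eq_intRd => z; rewrite z0 mulr0 addr0 cos0; congr EFin; field.
by rewrite h; congr EFin; field.
Qed.

Lemma measurable_inv_fun (R : realType) : measurable_fun setT (fun v : R => v^-1).
Proof.
rewrite (_ : setT = [set 0] `|` ~` [set 0 : R]); last by rewrite setUv.
apply/measurable_funU => //; first exact: measurableC.
split; first exact: measurable_fun_set1.
apply: open_continuous_measurable_fun; first exact: closed_openC.
move=> v; rewrite inE /= => v0; apply: cvgV; last exact: cvg_id.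
exact/eqP.
Qed.

(** * Radial integration and its constant *)

Section polar.
Variables (R : realType) (n : nat).
Notation mu := (tuple_lebesgue R n).
Notation q := (fun x : n.-tuple R => tdot x x).

Let mq : measurable_fun setT q. Proof. exact: measurable_tdot. Qed.

(* Polar coordinates without spheres: Tonelli and scaling give the radial formula up to
   the constant [polar_cst], which the Gaussian integral then identifies. *)
Let k (v : R) := v^-1 * v^-1 `^ (n%:R / 2) * expR (- v^-1).

Definition polar_cst : \bar R := (\int[mu]_x (k (q x))%:E)%E.

Let mk : measurable_fun setT k.
Proof.
have mV : measurable_fun setT (fun v : R => v^-1) by exact: measurable_inv_fun.
apply: measurable_funM; last first.
  by apply: measurableT_comp => //; exact: measurableT_comp.
by apply: measurable_funM => //; exact: (measurableT_comp (measurable_powR _) mV).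
Qed.

Let k_ge0 v : 0 <= v -> 0 <= k v.
Proof. by move=> v0; rewrite /k !mulr_ge0 ?invr_ge0 ?powR_ge0 ?expR_ge0. Qed.

Lemma polar_cst_ge0 : (0 <= polar_cst)%E.
Proof. by apply: integral_ge0 => x _; rewrite lee_fin k_ge0// tdot_ge0. Qed.

(** With v = |x|^2, the factor 1 is written as the integral over s > 0 of exp(- s / v) / v. Tonelli,
    the scaling of x by sqrt s, Tonelli again and the substitution s = u / v separate the variables.
    At the origin the inverse takes the value 0 and the inserted factor is not 1, whence the
    condition [f 0 = 0]. *)
Lemma integral_polar (f : R -> R) : measurable_fun setT f -> (forall v, 0 <= f v) ->
  f 0 = 0 ->
  (\int[mu]_x (f (q x))%:E = polar_cst *
    \int[@lebesgue_measure R]_(u in `]0%R, +oo[) (f u * u `^ (n%:R / 2 - 1))%:E)%E.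
Proof.
move=> mf f0 f00.
have mV : measurable_fun setT (fun v : R => v^-1) by exact: measurable_inv_fun.
pose D : set R := `]0, +oo[%classic.
have mD : measurable D by exact: measurable_itv.
have mq2 (A : set (n.-tuple R * R)) : measurable_fun A (fun z => q z.1).
  by apply: measurable_funTS; exact: (measurableT_comp mq measurable_fst).
have ms2 (A : set (n.-tuple R * R)) : measurable_fun A (fun z : n.-tuple R * R => z.2).
  by apply: measurable_funTS; exact: measurable_snd.
pose g (v s : R) := f v * (v^-1 * expR (- (v^-1 * s))).
have mg2 : measurable_fun (setT `*` D) (fun z : n.-tuple R * R => (g (q z.1) z.2)%:E).
  apply/measurable_EFinP; apply: measurable_funM; first exact: measurableT_comp.
  apply: measurable_funM; first exact: measurableT_comp.
  apply: measurableT_comp => //; apply: measurableT_comp => //.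
  by apply: measurable_funM => //; exact: measurableT_comp.
have g0 v s : 0 <= v -> 0 <= g v s.
  by move=> v0; rewrite /g !mulr_ge0 ?invr_ge0 ?expR_ge0.
transitivity (\int[mu]_x \int[@lebesgue_measure R]_(s in D) (g (q x) s)%:E)%E.
  apply: eq_integral => x _.
  have := tdot_ge0 x; rewrite le_eqVlt => /predU1P[q0|q0].
    rewrite -q0 f00 [RHS]integral0_eq// => s _; by rewrite /g f00 mul0r.
  have v0 : 0 < (tdot x x)^-1 by rewrite invr_gt0.
  transitivity ((f (q x) * (q x)^-1)%:E *
      \int[@lebesgue_measure R]_(s in D) (expR (- ((q x)^-1 * s)))%:E)%E.
    by rewrite integral_expRN// -EFinM invrK mulfVK// gt_eqF.
    rewrite -ge0_integralZl_EFin//.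
    - by apply: eq_integral => s _; rewrite -EFinM /g mulrA.
    - apply/measurable_EFinP; apply: measurableT_comp => //; apply: measurableT_comp => //.
    - by rewrite mulr_ge0// invr_ge0 tdot_ge0.
rewrite (@tonelli_in _ _ _ _ R mu lebesgue_measure setT D
  (fun z => (g (q z.1) z.2)%:E))//; last first.
  by move=> x s _ _; rewrite lee_fin g0// tdot_ge0.
(* The integrand after x has been replaced by sqrt s times x; the first factor is the Jacobian. *)
pose h (v s : R) := Num.sqrt s ^+ n * (f (s * v) * ((s * v)^-1 * expR (- v^-1))).
have h0 v s : 0 <= v -> 0 <= s -> 0 <= h v s.
  by move=> v0 s0; rewrite /h !mulr_ge0 ?exprn_ge0 ?sqrtr_ge0 ?invr_ge0 ?expR_ge0// mulr_ge0.
have mh2 : measurable_fun (D `*` setT) (fun z : R * n.-tuple R => (h (q z.2) z.1)%:E).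
  apply: measurable_funTS; apply/measurable_EFinP.
  have m1 : measurable_fun setT (fun z : R * n.-tuple R => z.1 * q z.2).
    apply: measurable_funM; first exact: measurable_fst.
    exact: (measurableT_comp mq measurable_snd).
  apply: measurable_funM.
    apply: (@measurableT_comp _ _ _ _ _ _ (fun s : R => Num.sqrt s ^+ n)) => //.
      by apply: measurable_funX; apply: continuous_measurable_fun; exact: sqrt_continuous.
  apply: measurable_funM; first exact: measurableT_comp.
  apply: measurable_funM; first exact: measurableT_comp.
  apply: measurableT_comp => //; apply: measurableT_comp => //.
  by apply: measurableT_comp => //; exact: (measurableT_comp mq measurable_snd).
transitivity (\int[@lebesgue_measure R]_(s in D) \int[mu]_x (h (q x) s)%:E)%E.
  apply: eq_integral => s /set_mem; rewrite /D /= in_itv/= andbT => s0.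
  have mgs : measurable_fun setT (fun x : n.-tuple R => (g (q x) s)%:E).
    apply/measurable_EFinP; apply: measurable_funM; first exact: measurableT_comp.
    apply: measurable_funM; first exact: measurableT_comp.
    apply: measurableT_comp => //; apply: measurableT_comp => //.
    by apply: measurable_funM => //; exact: measurableT_comp.
  have gs0 x : (0 <= (g (q x) s)%:E)%E by rewrite lee_fin g0// tdot_ge0.
  have rs0 : 0 < Num.sqrt s by rewrite sqrtr_gt0.
  rewrite -intRdE// (intRd_scale rs0)// intRdE; last 2 first.
  - exact: (measurableT_comp mgs (@measurable_tscale R n (Num.sqrt s))).
  - by move=> x; exact: gs0.
  rewrite -ge0_integralZl_EFin//; last first.
    exact: (measurableT_comp mgs (@measurable_tscale R n (Num.sqrt s))).
  apply: eq_integral => x _; rewrite -EFinM /h /g; congr (_ * _)%:E.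
  rewrite tdot_scale tdotC tdot_scale mulrA -expr2 sqr_sqrtr ?(ltW s0)//.
  congr (_ * (_ * expR (- _))).
  have := tdot_ge0 x; rewrite le_eqVlt => /predU1P[<-|q0].
    by rewrite mulr0 invr0 mul0r.
  by rewrite invfM mulrAC mulVf ?mul1r// gt_eqF.
rewrite (@tonelli_in _ _ _ _ R lebesgue_measure mu D setT
  (fun z => (h (q z.2) z.1)%:E))//; last first.
  move=> s x; rewrite /D /= in_itv/= andbT => s0 _.
  by rewrite lee_fin h0 ?tdot_ge0// ltW.
rewrite /polar_cst -ge0_integralZr//; last 3 first.
- by apply/measurable_EFinP; exact: measurableT_comp.
- by move=> x _; rewrite lee_fin k_ge0// tdot_ge0.
- by apply: integral_ge0 => u _; rewrite lee_fin mulr_ge0// powR_ge0.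
apply: eq_integral => x _ /=.
have := tdot_ge0 x; rewrite le_eqVlt => /predU1P[q0|q0].
  rewrite -q0 /k invr0 !mul0r mul0e integral0_eq// => s _.
  by rewrite /h mulr0 f00 mul0r mulr0.
set v := tdot x x in q0 *.
have v0 : 0 < v^-1 by rewrite invr_gt0.
have msq : measurable_fun setT (fun s : R => Num.sqrt s ^+ n).
  by apply: measurable_funX; apply: continuous_measurable_fun; exact: sqrt_continuous.
have mh : measurable_fun setT (h v).
  apply: measurable_funM => //; apply: measurable_funM.
    by apply: (measurableT_comp mf); exact: measurable_funM.
  apply: measurable_funM => //; apply: (measurableT_comp mV); exact: measurable_funM.
rewrite integral_mkcond.
rewrite (@ge0_integral_scale R v^-1 ((fun s => (h v s)%:E) \_ D) v0); last 2 first.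
- apply/(measurable_restrictT _ _).1 => //; apply: measurable_funTS; exact/measurable_EFinP.
- move=> s; rewrite patchE; case: ifPn => // /set_mem; rewrite /D /= in_itv/= andbT => s0.
  by rewrite lee_fin h0 ?(ltW q0) ?(ltW s0).
rewrite [in RHS]integral_mkcond -!ge0_integralZl_EFin//.
- apply: eq_integral => u _; rewrite !patchE.
  have -> : (v^-1 * u \in D) = (u \in D).
    by apply/idP/idP => /set_mem; rewrite /D /= in_itv/= andbT => h';
      apply/mem_set; rewrite /= in_itv/= andbT; move: h'; rewrite pmulr_rgt0.
  case: ifPn => [/set_mem|]; last by rewrite !mule0.
  rewrite /D /= in_itv/= andbT => u0; rewrite -!EFinM; congr EFin.
  rewrite /h /k.
  have -> : v^-1 * u * v = u by rewrite mulrAC mulVf ?mul1r// gt_eqF.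
  rewrite -!powR12_sqrt ?mulr_ge0 ?(ltW u0) ?(ltW v0)//.
  rewrite -powR_mulrn ?powR_ge0// -powRrM powRM ?(ltW u0) ?(ltW v0)//.
  rewrite [2^-1 * _]mulrC powRB ?(gt_eqF u0) ?implybT// powRr1 ?(ltW u0)//.
  by field; rewrite !gt_eqF.
- by move=> u _; rewrite patchE; case: ifPn => //; rewrite lee_fin mulr_ge0// powR_ge0.
- apply/(measurable_restrictT _ _).1 => //; apply: measurable_funTS; apply/measurable_EFinP.
  by apply: measurable_funM => //; exact: measurable_powR.
- by rewrite k_ge0// ltW.
- move=> u _; rewrite patchE; case: ifPn => // /set_mem; rewrite /D /= in_itv/= andbT => s0.
  by rewrite lee_fin h0 ?(ltW q0) ?(ltW s0).
- apply: (@measurableT_comp _ _ _ _ _ _ ((fun s => (h v s)%:E) \_ D)); last exact: measurable_funM.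
  by apply/(measurable_restrictT _ _).1 => //; apply: measurable_funTS; exact/measurable_EFinP.
- exact: ltW.
Qed.
End polar.

Section polar_pos.
Variables (R : realType) (n : nat).
Hypothesis n_gt0 : (0 < n)%N.
Notation mu := (tuple_lebesgue R n).
Notation q := (fun x : n.-tuple R => tdot x x).

(** The mass of the origin is finite, being dominated by a Gaussian integral, and scaling by 2
    multiplies it by 2^n with n > 0; hence it vanishes. *)
Lemma integral_indic_tdot0 : (\int[mu]_x (\1_[set 0 : R] (q x) : R)%:E = 0)%E.
Proof.
have mi : measurable_fun setT (fun x : n.-tuple R => (\1_[set 0 : R] (q x) : R)%:E).
  apply/measurable_EFinP; apply: (@measurableT_comp _ _ _ _ _ _ (\1_[set 0 : R] : R -> R)).
    exact: measurable_indic.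
  exact: measurable_tdot.
have i0 x : (0 <= (\1_[set 0 : R] (q x) : R)%:E)%E by rewrite lee_fin.
set m := (\int[mu]_x _)%E.
have m0 : (0 <= m)%E by apply: integral_ge0 => x _; exact: i0.
have mfin : m \is a fin_num.
  rewrite ge0_fin_numE//; apply: (@le_lt_trans _ _ (Num.sqrt pi ^+ n)%:E); last exact: ltry.
  rewrite -integral_gauss_tuple; apply: ge0_le_integral => //.
    exact: measurable_expR_tdot.
  move=> x _; rewrite lee_fin indicE; case: (boolP (_ \in _)) => [/set_mem /= ->|_].
    by rewrite oppr0 expR0.
  by rewrite expR_ge0.
have two0 : 0 < 2 :> R by [].
have mE : m = ((2 ^+ n)%:E * m)%E.
  rewrite {1}/m -intRdE// (intRd_scale two0)// intRdE; last 2 first.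
  - exact: (measurableT_comp mi (@measurable_tscale R n 2)).
  - by move=> x.
  congr (_ * _)%E; apply: eq_integral => x _.
  rewrite tdot_scale tdotC tdot_scale !indicE; congr (nat_of_bool _)%:R%:E.
  apply/idP/idP => /set_mem /= h; apply/mem_set => /=; last by rewrite h !mulr0.
  by move/eqP: h; rewrite !mulf_eq0 pnatr_eq0/= => /eqP.
move: mE; rewrite -(fineK mfin) -EFinM => -[/eqP].
rewrite eq_sym -subr_eq0 -{2}(mul1r (fine m)) -mulrBl mulf_eq0 => /orP[|/eqP ->//].
have n1 : (1 < 2 ^ n)%N by rewrite -{1}(expn0 2) ltn_exp2l.
by rewrite subr_eq0 -natrX (eqr_nat _ _ 1) (gtn_eqF n1).
Qed.

Lemma integral_polar_pos (f : R -> R) : measurable_fun setT f -> (forall v, 0 <= f v) ->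
  (\int[mu]_x (f (q x))%:E = polar_cst R n *
    \int[@lebesgue_measure R]_(u in `]0%R, +oo[) (f u * u `^ (n%:R / 2 - 1))%:E)%E.
Proof.
move=> mf f0.
pose g (v : R) : R := f v * \1_(~` [set 0 : R]) v.
have mC : measurable (~` [set 0 : R]) by exact: measurableC.
have mg : measurable_fun setT g.
  by apply: measurable_funM => //; exact: measurable_indic.
have g0 v : 0 <= g v by rewrite mulr_ge0.
have g00 : g 0 = 0 by rewrite /g indicE memNset ?mulr0//=; apply.
have gE v : v != 0 -> g v = f v.
  by move=> v0; rewrite /g indicE mem_set ?mulr1//=; exact/eqP.
have mi : measurable_fun setT (fun x : n.-tuple R => (\1_[set 0 : R] (q x) : R)%:E).
  apply/measurable_EFinP; apply: (@measurableT_comp _ _ _ _ _ _ (\1_[set 0 : R] : R -> R)).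
    exact: measurable_indic.
  exact: measurable_tdot.
transitivity (\int[mu]_x ((g (q x))%:E + (f 0)%:E * (\1_[set 0 : R] (q x) : R)%:E))%E.
  apply: eq_integral => x _; have [->|q0] := eqVneq (tdot x x) 0.
    by rewrite g00 add0e indicE mem_set// mule1.
  by rewrite gE// indicE memNset ?mule0 ?adde0//=; exact/eqP.
rewrite ge0_integralD//; last 4 first.
- by move=> x _; rewrite lee_fin.
- by apply/measurable_EFinP; apply: (measurableT_comp mg); exact: measurable_tdot.
- by move=> x _; rewrite mule_ge0// lee_fin.
- exact: measurable_funeM.
rewrite ge0_integralZl_EFin//.
rewrite integral_indic_tdot0 mule0 adde0 integral_polar//; congr (_ * _)%E.
apply: eq_integral => u; rewrite inE/= in_itv/= andbT => u0.
by rewrite gE// gt_eqF.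
Qed.

(** The radial formula for exp(- |x|^2) has the finite positive value pi^(n/2) on the left, so
    neither nonnegative factor on the right can be 0 or infinite. In particular the [fine] in
    [Gamma] hides no infinite integral. *)
Lemma polar_cst_Gamma : exists C : R, [/\ 0 < C, polar_cst R n = C%:E,
  0 < Gamma (n%:R / 2 : R),
  (\int[@lebesgue_measure R]_(u in `]0%R, +oo[) (expR (- u) * u `^ (n%:R / 2 - 1))%:E =
    (Gamma (n%:R / 2 : R))%:E)%E &
  C * Gamma (n%:R / 2) = pi `^ (n%:R / 2)].
Proof.
set I := integral _ _ _.
have GE : Gamma (n%:R / 2 : R) = fine I.
  rewrite /Gamma /I; congr fine.
  rewrite (_ : [set u : R | 0 < u] = `]0, +oo[%classic); last first.
    by apply/seteqP; split => u /=; rewrite in_itv/= andbT.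
  by apply: eq_integral => u _; rewrite mulrC.
have me : measurable_fun setT (fun v : R => expR (- v)).
  by apply: measurableT_comp.
have := @integral_polar_pos (fun v => expR (- v)) me (fun v => expR_ge0 _).
rewrite integral_gauss_tuple -/I.
have pi0 : 0 < Num.sqrt pi ^+ n :> R by rewrite exprn_gt0// sqrtr_gt0 pi_gt0.
have -> : pi `^ (n%:R / 2) = Num.sqrt pi ^+ n :> R.
  by rewrite -powR12_sqrt ?pi_ge0// -powR_mulrn ?powR_ge0// -powRrM mulrC.
have I0 : (0 <= I)%E.
  by apply: integral_ge0 => u _; rewrite lee_fin mulr_ge0 ?expR_ge0 ?powR_ge0.
have := polar_cst_ge0 R n.
move: (polar_cst R n) => [c| |] //.
- rewrite lee_fin => c0; case: I GE I0 => [i| |] // -> .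
  + rewrite lee_fin => i0; rewrite -EFinM => -[E].
    have c0' : 0 < c.
      by rewrite lt_neqAle c0 andbT; apply/eqP => c00; move: pi0; rewrite E -c00 mul0r ltxx.
    have i0' : 0 < i.
      by rewrite lt_neqAle i0 andbT; apply/eqP => c00; move: pi0; rewrite E -c00 mulr0 ltxx.
    by exists c.
  + move=> _; have [->|cn] := eqVneq c 0.
      by rewrite mul0e => -[E]; move: pi0; rewrite E ltxx.
    by rewrite gt0_muley// lte_fin lt_neqAle eq_sym cn.
- move=> _; case: I GE I0 => [i| |] // _.
  + rewrite lee_fin => i0; have [->|cn] := eqVneq i 0.
      by rewrite mule0 => -[E]; move: pi0; rewrite E ltxx.
    by rewrite gt0_mulye// lte_fin lt_neqAle eq_sym cn.
Qed.
End polar_pos.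

Lemma ge0_le_measure_integral_in (d : measure_display) (T : measurableType d)
    (R : realType) (m1 m2 : {measure set T -> \bar R}) (D : set T) (f : T -> \bar R) :
  measurable D -> (forall A, measurable A -> A `<=` D -> (m1 A <= m2 A)%E) ->
  measurable_fun setT f -> (forall x, (0 <= f x)%E) ->
  (\int[m1]_(x in D) f x <= \int[m2]_(x in D) f x)%E.
Proof.
move=> mD m12 mf f0.
have restrE (m : {measure set T -> \bar R}) :
    (\int[m]_(x in D) f x = \int[mrestr m mD]_(x in D) f x)%E.
  by apply: eq_measure_integral => A mA AD; rewrite /= /mrestr setIidl.
rewrite (restrE m1) (restrE m2); apply: ge0_le_measure_integral => // A mA.
by rewrite /= /mrestr m12//; exact: measurableI.
Qed.

Lemma tnorm_scale (R : realType) (n : nat) (c : R) (z : n.-tuple R) : 0 <= c ->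
  tnorm (tscale c z) = c * tnorm z.
Proof.
move=> c0; rewrite /tnorm tdot_scale tdotC tdot_scale mulrA sqrtrM ?mulr_ge0//.
by rewrite -expr2 sqrtr_sqr ger0_norm.
Qed.

Lemma tnorm_sqr (R : realType) (n : nat) (z : n.-tuple R) : tnorm z ^+ 2 = tdot z z.
Proof. by rewrite sqr_sqrtr// tdot_ge0. Qed.

(** * Laplace transform of the squared norm from the characteristic function *)

Section laplace.
Variables (R : realType) (dO : measure_display) (O : measurableType dO).
Variables (P : probability O R) (d : nat) (X : O -> d.-tuple R) (phi : R -> R) (s : R).
Hypothesis d_gt0 : (0 < d)%N.
Hypothesis mX : measurable_fun setT X.
Hypothesis mphi : measurable_fun setT phi.
Hypothesis phi_ge0 : forall u, 0 <= phi u.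
Hypothesis cfX : forall xi : d.-tuple R,
  (\int[P]_w (cos (tdot xi (X w)))%:E = (phi (tnorm xi))%:E)%E.
Hypothesis s_gt0 : 0 < s.

Lemma integrable_bounded (f : O -> R) (M : R) : measurable_fun setT f ->
  (forall w, `|f w| <= M) -> P.-integrable setT (fun w => (f w)%:E).
Proof.
move=> mf fM; apply: (@le_integrable _ _ _ P setT measurableT _ (cst M%:E)).
- exact/measurable_EFinP.
- by move=> w _ /=; rewrite lee_fin (le_trans (fM w))// ler_norm.
- exact: finite_measure_integrable_cst.
Qed.

Let J := (\int[@lebesgue_measure R]_(v in `]0%R, +oo[)
   (phi (2 * Num.sqrt (s * v)) * (expR (- v) * v `^ (d%:R / 2 - 1)))%:E)%E.

(* A Gaussian average over [xi] turns the characteristic function into a Laplace transform;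
   adding 1 to the cosine makes the integrand nonnegative, so that Tonelli applies. *)
Lemma laplace_norm :
  ((Gamma (d%:R / 2 : R))%:E * \int[P]_w (expR (- (s * tdot (X w) (X w))))%:E = J)%E.
Proof.
have [C [C0 CE G0 GE CG]] := polar_cst_Gamma R d_gt0.
have rs0 : 0 < Num.sqrt s by rewrite sqrtr_gt0.
have mqX : measurable_fun setT (fun w => tdot (X w) (X w)) by exact: measurable_tdot.
have meX : measurable_fun setT (fun w => expR (- (s * tdot (X w) (X w)))).
  by apply: measurableT_comp => //; apply: measurableT_comp => //; exact: measurable_funM.
have iL : P.-integrable setT (fun w => (expR (- (s * tdot (X w) (X w))))%:E).
  apply: (@integrable_bounded _ 1) => // w; rewrite ger0_norm ?expR_ge0//.
  by rewrite -expR0 ler_expR oppr_le0 mulr_ge0 ?tdot_ge0// ltW.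
set L := (\int[P]_w _)%E.
have Lfin : L \is a fin_num by exact: integrable_fin_num iL.
pose F (z : O * d.-tuple R) := (1 * expR (- tdot z.2 z.2) *
   (1 + cos (0 + 2 * tdot z.2 (tscale (Num.sqrt s) (X z.1)))))%:E.
have F0 z : (0 <= F z)%E.
  have := cos_geN1 (0 + 2 * tdot z.2 (tscale (Num.sqrt s) (X z.1))) => h.
  by rewrite lee_fin mul1r mulr_ge0 ?expR_ge0//; lra.
have mF : measurable_fun setT F.
  apply/measurable_EFinP; apply: measurable_funM.
    apply: measurable_funM => //; apply: measurableT_comp => //.
    apply: measurableT_comp => //; apply: measurable_tdot; exact: measurable_snd.
  apply: measurable_funD => //.
  apply: measurableT_comp; first exact: (continuous_measurable_fun (@continuous_cos R)).
  apply: measurable_funD => //; apply: measurable_funM => //.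
  apply: measurable_tdot; first exact: measurable_snd.
  apply: (measurableT_comp (@measurable_tscale R d (Num.sqrt s))).
  exact: (measurableT_comp mX measurable_fst).
have P1 : (\int[P]_w 1 = 1 :> \bar R)%E.
  by rewrite integral_cst// mul1e; exact: probability_setT.
have step1 : (\int[P]_w \int[tuple_lebesgue R d]_z F (w, z) =
    (Num.sqrt pi ^+ d)%:E * (1 + L))%E.
  transitivity (\int[P]_w ((Num.sqrt pi ^+ d)%:E *
      (1 + (expR (- (s * tdot (X w) (X w))))%:E)))%E.
    apply: eq_integral => w _; rewrite -intRdE//; last first.
      exact: (@measurable_fun_pair2 _ _ _ _ _ _ F w mF).
    apply: etrans (@intRd_gauss_cos R d 1 0 (tscale (Num.sqrt s) (X w))) _.
    rewrite cos0 !mul1r -EFinD -EFinM; congr (_ * (1 + expR (- _)))%:E.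
    by rewrite tdot_scale tdotC tdot_scale mulrA -expr2 sqr_sqrtr// ltW.
  rewrite integralZl//; last first.
    by apply: integrableD => //; exact: finite_measure_integrable_cst.
  rewrite integralD//; last exact: finite_measure_integrable_cst.
  by rewrite P1.
have fubini : (\int[P]_w \int[tuple_lebesgue R d]_z F (w, z) =
   \int[tuple_lebesgue R d]_z \int[P]_w F (w, z))%E.
  apply: (@tonelli_in _ _ _ _ R P (tuple_lebesgue R d) setT setT F) => //.
  by apply: measurable_funTS.
have step2 : (\int[tuple_lebesgue R d]_z \int[P]_w F (w, z) =
  \int[tuple_lebesgue R d]_z (expR (- tdot z z) *
     (1 + phi (2 * Num.sqrt (s * tdot z z))))%:E)%E.
  apply: eq_integral => z _.
  (* The norm of this frequency depends on [z] only through |z|^2, so that the averaged integrand is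
     radial. *)
  pose xi := tscale (2 * Num.sqrt s) z.
  have xiE : tnorm xi = 2 * Num.sqrt (s * tdot z z).
    rewrite /xi tnorm_scale; last by rewrite mulr_ge0// ltW.
    by rewrite /tnorm -mulrA -sqrtrM// ltW.
  transitivity (\int[P]_w ((expR (- tdot z z))%:E * (1 + (cos (tdot xi (X w)))%:E)))%E.
    apply: eq_integral => w _; rewrite /F /= -EFinD -EFinM mul1r add0r.
    congr (_ * (1 + cos _))%:E.
    by rewrite /xi tdot_scale -mulrA tdotC tdot_scale tdotC.
  have ic : P.-integrable setT (fun w => (cos (tdot xi (X w)))%:E).
    apply: (@integrable_bounded _ 1); last by move=> w; exact: cos_max.
    apply: measurableT_comp; first exact: (continuous_measurable_fun (@continuous_cos R)).
    exact: measurable_tdot.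
  rewrite integralZl//; last first.
    by apply: integrableD => //; exact: finite_measure_integrable_cst.
  rewrite integralD//; last exact: finite_measure_integrable_cst.
  by rewrite P1 cfX xiE -EFinD -EFinM.
have msq : measurable_fun setT (fun v : R => phi (2 * Num.sqrt (s * v))).
  apply: measurableT_comp => //; apply: measurable_funM => //.
  apply: measurableT_comp; last exact: measurable_funM.
  exact: (continuous_measurable_fun (@sqrt_continuous R)).
have mexp : measurable_fun setT (fun v : R => expR (- v)) by exact: measurableT_comp.
have step3 : (\int[tuple_lebesgue R d]_z (expR (- tdot z z) *
     (1 + phi (2 * Num.sqrt (s * tdot z z))))%:E = C%:E * ((Gamma (d%:R / 2 : R))%:E + J))%E.
  rewrite (@integral_polar_pos R d d_gt0 (fun v => expR (- v) * (1 + phi (2 * Num.sqrt (s * v))))).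
  - rewrite CE; congr (_ * _)%E; rewrite -GE /J -ge0_integralD//.
    + by apply: eq_integral => v _; rewrite -EFinD; congr EFin; ring.
    + by move=> v _; rewrite lee_fin mulr_ge0 ?expR_ge0 ?powR_ge0.
    + by apply: measurable_funTS; apply/measurable_EFinP; apply: measurable_funM.
    + by move=> v _; rewrite lee_fin !mulr_ge0 ?expR_ge0 ?powR_ge0.
    + apply: measurable_funTS; apply/measurable_EFinP; apply: measurable_funM => //.
      by apply: measurable_funM => //; exact: measurable_powR.
  - by apply: measurable_funM => //; exact: measurable_funD.
  - by move=> v; rewrite mulr_ge0 ?expR_ge0// addr_ge0.
have piE : Num.sqrt pi ^+ d = C * Gamma (d%:R / 2) :> R.
  by rewrite CG -powR12_sqrt ?pi_ge0// -powR_mulrn ?powR_ge0// -powRrM mulrC.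
have J0 : (0 <= J)%E.
  by apply: integral_ge0 => v _; rewrite lee_fin !mulr_ge0 ?expR_ge0 ?powR_ge0.
have : ((Num.sqrt pi ^+ d)%:E * (1 + L) = C%:E * ((Gamma (d%:R / 2 : R))%:E + J))%E.
  by rewrite -step1 fubini step2 step3.
rewrite piE -(fineK Lfin); move: (fine L) => lL.
(* Both sides contain the same Gaussian term, which cancels with [C]; an infinite [J] is impossible
   because the left side is finite. *)
case: J J0 => [j| |]// j0.
- rewrite -!EFinD -!EFinM => -[E]; congr EFin.
  have Cn0 : C != 0 by rewrite gt_eqF.
  by apply: (mulfI Cn0); lra.
- by rewrite -EFinD -EFinM addey// gt0_muley// lte_fin.
Qed.
End laplace.

(** * Convergence of moment functionals *)

Section weierstrass.
Variable R : realType.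

(* The iteration [u_{k+1} = u_k + (u^2 - u_k^2) / 2] converges to [|u|]. *)
Fixpoint abs_poly (u : {poly R}) (k : nat) : {poly R} :=
  if k is k'.+1 then abs_poly u k' + 2^-1 *: (u ^+ 2 - abs_poly u k' ^+ 2) else 0.

(** The rate 2 / k has to be uniform down to |u| = 0, where the contraction factor 1 - |u| / 2
    degenerates. The invariant proved by induction, (|u| - P)(1 + k |u| / 2) <= |u|, absorbs this,
    and dividing by |u| / 2 gives the rate. *)
Lemma abs_polyP (u : {poly R}) (k : nat) (w : R) : `|u.[w]| <= 1 ->
  [/\ 0 <= (abs_poly u k).[w], (abs_poly u k).[w] <= `|u.[w]| &
   (`|u.[w]| - (abs_poly u k).[w]) * k%:R <= 2].
Proof.
move=> u1.
suff [h0 h1 h2] : [/\ 0 <= (abs_poly u k).[w], (abs_poly u k).[w] <= `|u.[w]| &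
   (`|u.[w]| - (abs_poly u k).[w]) * (1 + k%:R * (`|u.[w]| / 2)) <= `|u.[w]|].
  split => //; have := normr_ge0 u.[w]; rewrite le_eqVlt => /predU1P[u0|u0].
    by have -> : (abs_poly u k).[w] = 0; [lra|rewrite -u0 subr0 mul0r].
  have h3 : (`|u.[w]| - (abs_poly u k).[w]) * (k%:R * (`|u.[w]| / 2)) <= `|u.[w]|.
    by apply: le_trans h2; rewrite ler_wpM2l ?subr_ge0//; lra.
  rewrite -(ler_pM2r (_ : 0 < `|u.[w]| / 2)); last by rewrite divr_gt0.
  rewrite -mulrA; lra.
have y0 := normr_ge0 u.[w].
have uE : u.[w] ^+ 2 = `|u.[w]| ^+ 2 by rewrite real_normK ?num_real.
elim: k => [|k [h0 h1 h2]].
  by rewrite /= horner0 mul0r subr0 addr0 mulr1; split.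
rewrite /= hornerD hornerZ hornerD hornerN !horner_exp uE.
move: (abs_poly u k).[w] h0 h1 h2 y0 u1 => P h0 h1 h2.
move: `|u.[w]| h1 h2 => y h1 h2 y0 y1; split; [by nra|by nra|].
have k0 : 0 <= k%:R :> R by [].
rewrite -[k.+1%:R]natr1.
have -> : y - (P + 2^-1 * (y ^+ 2 - P ^+ 2)) = (y - P) * (1 - (y + P) / 2) by field.
apply: le_trans h2; rewrite -mulrA ler_wpM2l ?subr_ge0//.
have : (1 - (y + P) / 2) * (1 + (k%:R + 1) * (y / 2)) <=
       (1 - y / 2) * (1 + (k%:R + 1) * (y / 2)).
  by rewrite ler_wpM2r//; nra.
move=> h3; apply: (le_trans h3).
have : 0 <= (k%:R + 1) * y ^+ 2 by rewrite mulr_ge0 ?sqr_ge0// addr_ge0.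
move=> h4; lra.
Qed.

(** The positive part of a quadratic is half the sum of a polynomial and its absolute value, so
    approximating absolute values of polynomials is all the Weierstrass theorem needed. *)
Definition bump (a b w : R) : R := Num.max 0 ((w - a) * (b - w)).

Lemma bump_ge0 a b w : 0 <= bump a b w. Proof. by rewrite le_max lexx. Qed.

Lemma bumpE a b w : bump a b w = ((w - a) * (b - w) + `|(w - a) * (b - w)|) / 2.
Proof.
rewrite /bump; case: (leP 0 ((w - a) * (b - w))) => h.
  by rewrite ger0_norm//; field.
by rewrite ltr0_norm// subrr mul0r.
Qed.

Lemma continuous_bump a b : continuous (bump a b).
Proof.
move=> w; rewrite (_ : bump a b = (fun w => ((w - a) * (b - w) + `|(w - a) * (b - w)|) / 2)).
  apply: cvgMr_tmp.
  have c : (w - a) * (b - w) @[w --> w] --> (w - a) * (b - w).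
    apply: cvgM; first by apply: cvgB; [exact: cvg_id|exact: cvg_cst].
    by apply: cvgB; [exact: cvg_cst|exact: cvg_id].
  by apply: cvgD => //; exact: cvg_norm.
by apply/funext => v; exact: bumpE.
Qed.

Lemma bump_approx (a b e : R) : 0 <= a <= 1 -> 0 <= b <= 1 -> 0 < e ->
  exists Q : {poly R}, forall w, 0 <= w <= 1 -> `|bump a b w - Q.[w]| <= e.
Proof.
move=> /andP[a0 a1] /andP[b0 b1] e0.
pose u : {poly R} := ('X - a%:P) * (b%:P - 'X).
have [k ek] : exists k, e^-1 <= k%:R.
  by exists (Num.truncn e^-1).+1; apply/ltW; exact: truncnS_gt.
have k0 : 0 < k%:R :> R by apply: lt_le_trans ek; rewrite invr_gt0.
exists (2^-1 *: (u + abs_poly u k)) => w /andP[w0 w1].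
have uE : u.[w] = (w - a) * (b - w) by rewrite /u !hornerE.
have u1 : `|u.[w]| <= 1 by rewrite uE ler_norml; apply/andP; split; nra.
have [h0 h1 h2] := abs_polyP k u1.
rewrite bumpE !hornerE -uE.
have -> : (u.[w] + `|u.[w]|) / 2 - 2^-1 * (u.[w] + (abs_poly u k).[w]) =
   (`|u.[w]| - (abs_poly u k).[w]) / 2 by field.
rewrite ger0_norm ?divr_ge0 ?subr_ge0//.
rewrite ler_pdivrMr//; rewrite -(ler_pM2r k0); apply: (le_trans h2).
have : 1 <= e * k%:R by rewrite -ler_pdivrMl// mulr1.
lra.
Qed.

(** Convergence of the moment k = 0 bounds the masses for large n, so a uniform approximation by
    polynomials transfers the limit. The masses appear in absolute value because the functionals
    will be divided by a normalisation known to be positive only for large n. *)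
Lemma functional_cvg (L_ : nat -> (R -> R) -> R) (L : (R -> R) -> R) (g : R -> R) :
  (forall n c (f h : R -> R), continuous f -> continuous h ->
    L_ n (fun w => c * f w + h w) = c * L_ n f + L_ n h) ->
  (forall c (f h : R -> R), continuous f -> continuous h ->
    L (fun w => c * f w + h w) = c * L f + L h) ->
  (forall n e (f : R -> R), continuous f -> (forall w, 0 <= w <= 1 -> `|f w| <= e) ->
    `|L_ n f| <= e * `|L_ n (fun=> 1)|) ->
  (forall e (f : R -> R), continuous f -> (forall w, 0 <= w <= 1 -> `|f w| <= e) ->
    `|L f| <= e * `|L (fun=> 1)|) ->
  (forall k, L_ n (fun w => w ^+ k) @[n --> \oo] --> L (fun w => w ^+ k)) ->
  continuous g ->
  (forall e, 0 < e -> exists Q : {poly R}, forall w, 0 <= w <= 1 -> `|g w - Q.[w]| <= e) ->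
  L_ n g @[n --> \oo] --> L g.
Proof.
move=> lin_ lin bnd_ bnd mono cg approx.
have ccst (c : R) : continuous (fun _ : R => c) by move=> w; exact: cvg_cst.
have cX k : continuous (fun w : R => w ^+ k) by exact: exprn_continuous.
have csum m (c : nat -> R) : continuous (fun w : R => \sum_(i < m) c i * w ^+ i).
  elim: m => [|m IH].
    by under eq_fun do rewrite big_ord0; exact: ccst.
  under eq_fun do rewrite big_ord_recr/=.
  by move=> w; apply: cvgD; [exact: IH|apply: cvgMl_tmp; exact: cX].
have sumcvg m (c : nat -> R) : L_ n (fun w => \sum_(i < m) c i * w ^+ i) @[n --> \oo] -->
    L (fun w => \sum_(i < m) c i * w ^+ i).
  elim: m => [|m IH].
    have -> : (fun w : R => \sum_(i < 0) c i * w ^+ i) = (fun=> 0).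
      by apply/funext => w; rewrite big_ord0.
    have -> : L (fun=> 0) = 0.
      apply/eqP; rewrite -normr_le0; have := bnd 0 (fun=> 0) (ccst 0).
      by rewrite mul0r; apply => w _; rewrite normr0.
    have L0 n : L_ n (fun=> 0) = 0.
      apply/eqP; rewrite -normr_le0; have := bnd_ n 0 (fun=> 0) (ccst 0).
      by rewrite mul0r; apply => w _; rewrite normr0.
    by under eq_fun do rewrite L0; exact: cvg_cst.
  have E : (fun w : R => \sum_(i < m.+1) c i * w ^+ i) =
      (fun w => c m * w ^+ m + \sum_(i < m) c i * w ^+ i).
    by apply/funext => w; rewrite big_ord_recr/= addrC.
  rewrite E lin//; under eq_fun do rewrite lin_//.
  by apply: cvgD => //; apply: cvgMl_tmp; exact: mono.
have polycvg (Q : {poly R}) : L_ n (fun w => Q.[w]) @[n --> \oo] --> L (fun w => Q.[w]).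
  have -> : (fun w => Q.[w]) = (fun w => \sum_(i < size Q) Q`_i * w ^+ i).
    by apply/funext => w; rewrite horner_coef.
  exact: sumcvg.
have cQ (Q : {poly R}) : continuous (fun w => Q.[w]).
  have -> : (fun w => Q.[w]) = (fun w => \sum_(i < size Q) Q`_i * w ^+ i).
    by apply/funext => w; rewrite horner_coef.
  exact: csum.
have L1 := mono 0%N.
have expr0E : (fun w : R => w ^+ 0) = (fun=> 1) by apply/funext => w; rewrite expr0.
rewrite expr0E in L1.
have {}L1 : \forall n \near \oo, `|L (fun=> 1) - L_ n (fun=> 1)| <= 1.
  by move/cvgrPdist_le : L1 => /(_ 1 ltr01).
apply/cvgrPdist_le => e e0.
pose B := `|L (fun=> 1)| + 1.
have B0 : 0 < B by rewrite /B ltr_wpDl.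
have [Q hQ] := approx (e / (3 * B)) (divr_gt0 e0 (mulr_gt0 (ltr0n R 3) B0)).
have e30 : 0 < e / 3 by lra.
near=> n.
have LB : `|L_ n (fun=> 1)| <= B.
  have : `|L (fun=> 1) - L_ n (fun=> 1)| <= 1.
    by near: n.
  move=> h; have := ler_normB (L (fun=> 1)) (L (fun=> 1) - L_ n (fun=> 1)).
  by rewrite opprB addrC subrK /B => h'; lra.
have h1 : `|L (fun w => Q.[w]) - L_ n (fun w => Q.[w])| <= e / 3.
  by near: n; move: (e / 3) e30; apply/cvgrPdist_le; exact: polycvg.
have cD : continuous (fun w => g w - Q.[w]).
  by move=> w; apply: cvgB; [exact: cg|exact: cQ].
have decomp (Lam : (R -> R) -> R) : (forall c (f h : R -> R), continuous f -> continuous h ->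
    Lam (fun w => c * f w + h w) = c * Lam f + Lam h) ->
    Lam g - Lam (fun w => Q.[w]) = Lam (fun w => g w - Q.[w]).
  move=> linL; have -> : (fun w => g w - Q.[w]) = (fun w => -1 * Q.[w] + g w).
    by apply/funext => w; rewrite mulN1r addrC.
  by rewrite linL// mulN1r addrC.
have eB : e / (3 * B) * B = e / 3 by field; rewrite gt_eqF.
have h2 : `|L g - L (fun w => Q.[w])| <= e / 3.
  rewrite (decomp _ lin); apply: (le_trans (bnd _ _ cD hQ)).
  rewrite -eB ler_pM2l ?divr_gt0 ?mulr_gt0// /B; lra.
have h3 : `|L_ n g - L_ n (fun w => Q.[w])| <= e / 3.
  rewrite (decomp _ (lin_ n)); apply: (le_trans (bnd_ n _ _ cD hQ)).
  by rewrite -eB ler_pM2l ?divr_gt0 ?mulr_gt0.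
have -> : L g - L_ n g = (L g - L (fun w => Q.[w])) +
   ((L (fun w => Q.[w]) - L_ n (fun w => Q.[w])) - (L_ n g - L_ n (fun w => Q.[w]))) by ring.
apply: (le_trans (ler_normD _ _)).
have := ler_normB (L (fun w => Q.[w]) - L_ n (fun w => Q.[w])) (L_ n g - L_ n (fun w => Q.[w])).
lra.
Unshelve. all: by end_near. Qed.
End weierstrass.

(** On ]0, 1] the power is at most v^(1/4 - 1), because d/2 - 1/4 >= 1/4 for d >= 1. Beyond 1 it is
    at most the Gamma integrand for dimension d + 2. *)
Lemma integrable_gamma_weight (R : realType) (d : nat) : (0 < d)%N ->
  (@lebesgue_measure R).-integrable `]0%R, +oo[
   (fun v => ((v `^ 4^-1 + v^-1 `^ 4^-1) * (expR (- v) * v `^ (d%:R / 2 - 1)))%:E).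
Proof.
move=> d0.
pose D : set R := `]0, +oo[%classic.
have mD : measurable D by exact: measurable_itv.
have mpow (c : R) : measurable_fun setT (fun v : R => v `^ c) by exact: measurable_powR.
have mexp : measurable_fun setT (fun v : R => expR (- v)) by exact: measurableT_comp.
have mE : measurable (`]0, 1]%classic : set R) by exact: measurable_itv.
pose f1 (v : R) : R := v `^ (4^-1 - 1) * \1_(`]0, 1]%classic : set R) v.
pose f2 (v : R) : R := expR (- v) * v `^ ((d.+2)%:R / 2 - 1).
have i1 : (@lebesgue_measure R).-integrable D (fun v => (f1 v)%:E).
  apply/integrableP; split.
    by apply: measurable_funTS; apply/measurable_EFinP; apply: measurable_funM.
  suff -> : (\int[@lebesgue_measure R]_(x in D) `|(f1 x)%:E| =
    \int[@lebesgue_measure R]_(v in `]0%R, 1%R]) (v `^ (4^-1 - 1))%:E)%E.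
    by apply: integral_powR_lty; rewrite invr_gt0.
  rewrite integral_mkcond [RHS]integral_mkcond; apply: eq_integral => v _.
  rewrite !patchE /f1 indicE; case: ifPn => [|/negP vD].
    move=> _; case: ifPn => _; last by rewrite mulr0 abse0.
    by rewrite mulr1 gee0_abs// lee_fin powR_ge0.
  case: ifPn => // /set_mem; rewrite /= in_itv/= => /andP[v0 _].
  by exfalso; apply: vD; apply/mem_set; rewrite /D /= in_itv/= andbT.
have i2 : (@lebesgue_measure R).-integrable D (fun v => (f2 v)%:E).
  have [_ [_ _ _ GE _]] := @polar_cst_Gamma R d.+2 isT.
  apply/integrableP; split.
    by apply: measurable_funTS; apply/measurable_EFinP; apply: measurable_funM.
  under eq_integral do rewrite gee0_abs ?lee_fin ?mulr_ge0 ?expR_ge0 ?powR_ge0//.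
  by rewrite GE ltry.
have dom (v : R) : 0 < v ->
    `|(v `^ 4^-1 + v^-1 `^ 4^-1) * (expR (- v) * v `^ (d%:R / 2 - 1))| <= `|2 * (f1 v + f2 v)|.
  move=> v0.
  have f10 : 0 <= f1 v by rewrite /f1 mulr_ge0// powR_ge0.
  have f20 : 0 <= f2 v by rewrite /f2 mulr_ge0 ?expR_ge0 ?powR_ge0.
  rewrite [leLHS]ger0_norm ?mulr_ge0 ?addr_ge0 ?expR_ge0 ?powR_ge0//.
  rewrite [leRHS]ger0_norm ?mulr_ge0 ?addr_ge0//.
  have vn0 : v != 0 by rewrite gt_eqF.
  have d1 : 1 <= d%:R :> R by rewrite ler1n.
  have vV : v^-1 `^ 4^-1 = v `^ (- 4^-1)
    by rewrite powRN -powR_inv1 ?(ltW v0)// -powRrM mulN1r powRN.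
  rewrite vV.
  have e0 := expR_gt0 (- v); have p0 := powR_gt0 (d%:R / 2 - 1) v0.
  have [v1|v1] := leP v 1.
    have e1 : expR (- v) <= 1 by rewrite -expR0 ler_expR; lra.
    have v01 : 0 < v <= 1 by rewrite v0.
    have q1 : v `^ 4^-1 <= v `^ (- 4^-1) by apply: ger_powR => //; lra.
    have f1E : f1 v = v `^ (4^-1 - 1).
      by rewrite /f1 indicE mem_set ?mulr1//= in_itv/= v0.
    have q2 : v `^ (- 4^-1) * v `^ (d%:R / 2 - 1) <= f1 v.
      rewrite f1E -powRD; last by rewrite vn0 implybT.
      by apply: ger_powR => //; lra.
    apply: (@le_trans _ _ (2 * v `^ (- 4^-1) * (1 * v `^ (d%:R / 2 - 1)))).
      apply: ler_pM; rewrite ?addr_ge0 ?mulr_ge0 ?powR_ge0 ?expR_ge0//; first lra.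
      by rewrite ler_pM2r.
    rewrite mul1r -mulrA; lra.
  have q1 : v `^ (- 4^-1) <= v `^ 4^-1 by apply: ler_powR; lra.
  have q2 : v `^ 4^-1 * v `^ (d%:R / 2 - 1) <= v `^ ((d.+2)%:R / 2 - 1).
    rewrite -powRD; last by rewrite vn0 implybT.
    have dE : (d.+2)%:R = d%:R + 2 :> R by rewrite -addn2 natrD.
    by apply: ler_powR; [lra|rewrite dE; lra].
  apply: (@le_trans _ _ (2 * v `^ 4^-1 * (expR (- v) * v `^ (d%:R / 2 - 1)))).
    by rewrite ler_pM2r ?mulr_gt0//; lra.
  have -> : 2 * v `^ 4^-1 * (expR (- v) * v `^ (d%:R / 2 - 1)) =
     2 * (expR (- v) * (v `^ 4^-1 * v `^ (d%:R / 2 - 1))) by ring.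
  rewrite ler_pM2l//; apply: (@le_trans _ _ (f2 v)); last by rewrite lerDr.
  by rewrite /f2 ler_pM2l.
apply: (@le_integrable _ _ R (@lebesgue_measure R) D mD _
  (fun v : R => (2%:E * ((f1 v)%:E + (f2 v)%:E))%E)).
- apply: measurable_funTS; apply/measurable_EFinP; apply: measurable_funM.
    apply: measurable_funD => //; apply: (measurableT_comp (mpow _)).
    exact: measurable_inv_fun.
  exact: measurable_funM.
- by move=> v; rewrite /D /= in_itv/= andbT => v0; rewrite lee_fin; exact: dom.
- by apply: integrableZl => //; exact: integrableD.
Qed.

(** * Real functionals given by weighted integrals *)

Section weighted_functional.
Variables (R : realType) (dT : measure_display) (T : measurableType dT).
Variables (m : {measure set T -> \bar R}) (D : set T) (om W : T -> R).
Hypothesis mD : measurable D.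
Hypothesis om_ge0 : forall z, D z -> 0 <= om z.
Hypothesis iom : m.-integrable D (fun z => (om z)%:E).
Hypothesis mW : measurable_fun D W.
Hypothesis W01 : forall z, D z -> 0 <= W z <= 1.

Definition wint (g : R -> R) : R := fine (\int[m]_(z in D) (om z * g (W z))%:E)%E.

(** [W] takes values in [0, 1], where a continuous [g] is bounded; hence the [fine] in [wint] loses
    nothing. *)
Lemma integrable_wint (g : R -> R) : continuous g ->
  m.-integrable D (fun z => (om z * g (W z))%:E).
Proof.
move=> cg.
have [B hB] : exists B, forall w, 0 <= w <= 1 -> `|g w| <= B.
  have [||c _ hc] := @EVT_max R (fun w => `|g w|) 0 1 => //.
    by apply: continuous_subspaceT => w; apply: cvg_norm; exact: cg.
  by exists `|g c| => w w01; apply: hc; rewrite in_itv.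
have mom : measurable_fun D om by apply/measurable_EFinP; exact: measurable_int iom.
apply: (@le_integrable _ _ _ m D mD _ (fun z => (B%:E * (om z)%:E)%E)).
- apply/measurable_EFinP; apply: measurable_funM => //.
  by apply: (measurableT_comp (continuous_measurable_fun cg)).
- move=> z Dz; rewrite -EFinM !abse_EFin lee_fin !normrM mulrC.
  by rewrite ler_wpM2r// (le_trans (hB _ (W01 Dz)))// ler_norm.
- exact: integrableZl.
Qed.

Lemma wint_linear c (f h : R -> R) : continuous f -> continuous h ->
  wint (fun w => c * f w + h w) = c * wint f + wint h.
Proof.
move=> cf ch; have i1 := integrable_wint cf; have i2 := integrable_wint ch.
rewrite /wint.
rewrite (_ : (\int[m]_(z in D) _)%E = (c%:E * \int[m]_(z in D) (om z * f (W z))%:E +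
    \int[m]_(z in D) (om z * h (W z))%:E)%E).
  rewrite fineD ?fineM//; try exact: integrable_fin_num.
  by rewrite fin_numM//; exact: integrable_fin_num.
rewrite -integralZl// -integralD//; last exact: integrableZl.
by apply: eq_integral => z _; rewrite -EFinM -EFinD; congr EFin; ring.
Qed.

Lemma wint_bound e (f : R -> R) : continuous f ->
  (forall w, 0 <= w <= 1 -> `|f w| <= e) -> `|wint f| <= e * `|wint (fun=> 1)|.
Proof.
move=> cf fe.
have c1 : continuous (fun _ : R => 1 : R) by move=> w; exact: cvg_cst.
have i1 := integrable_wint cf; have i2 := integrable_wint c1.
have f1 : (\int[m]_(z in D) (om z * 1)%:E)%E \is a fin_num by exact: integrable_fin_num.
have f2 : (\int[m]_(z in D) (om z * f (W z))%:E)%E \is a fin_num by exact: integrable_fin_num.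
have p1 : (0 <= \int[m]_(z in D) (om z * 1)%:E)%E.
  by apply: integral_ge0 => z Dz; rewrite mulr1 lee_fin om_ge0.
rewrite (ger0_norm (fine_ge0 p1)) -lee_fin -abse_EFin /wint fineK// EFinM fineK//.
apply: (le_trans (le_abse_integral m mD (measurable_int m i1))).
rewrite -integralZl//; apply: ge0_le_integral => //.
- by apply: measurableT_comp => //; exact: measurable_int i1.
- by apply: measurable_funeM; exact: measurable_int i2.
- move=> z Dz; rewrite -EFinM abse_EFin lee_fin normrM (ger0_norm (om_ge0 Dz)) mulr1 mulrC.
  by rewrite ler_wpM2r ?om_ge0// fe// W01.
Qed.
End weighted_functional.

(** * Limit of normalised Laplace differences *)

Section dct.
Variables (R : realType) (psi l : R -> R) (a M : R) (d : nat).
Hypothesis cpsi : continuous psi.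
Hypothesis psi_ge0 : forall x, 0 <= psi x.
Hypothesis l_gt0 : forall x, a <= x -> 0 < l x.
Hypothesis l_sv : forall lam : R, 0 < lam -> (fun x => l (lam * x) / l x) @ +oo --> (1 : R).
Hypothesis l_leM : forall x, a <= x -> l x <= M.
Hypothesis psi_Pi : forall lam : R, 0 < lam ->
  (fun x => (psi (lam * x) - psi x) / l x) @ +oo --> ln lam.
Hypothesis d_gt0 : (0 < d)%N.
Variables (t x : nat -> R).
Hypothesis t_gt0 : forall n, 0 < t n.
Hypothesis t_cvg0 : t n @[n --> \oo] --> 0.
Hypothesis x_cvgy : x n @[n --> \oo] --> +oo.

Let c n := t n * l (x n) * expR (- (t n * psi (x n))).
Let K (s s' : R) n (v : R) :=
  (expR (- (t n * psi (2 * Num.sqrt (s * v) * x n))) -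
   expR (- (t n * psi (2 * Num.sqrt (s' * v) * x n)))) / c n.

Lemma laplace_difference_cvg (s s' : R) : 0 < s -> s <= s' <= 4 * s ->
  (\int[@lebesgue_measure R]_(v in `]0%R, +oo[)
    (K s s' n v * (expR (- v) * v `^ (d%:R / 2 - 1)))%:E)%E @[n --> \oo] -->
  (2^-1 * (ln s' - ln s) * Gamma (d%:R / 2))%:E.
Proof.
move=> s0 /andP[ss' s'4].
have s'0 : 0 < s' by lra.
(* With del = 1/4 the dominating powers are w^(1/2) and w^(-1/2). As w is a multiple of sqrt v, they
   become v^(1/4) and v^(-1/4), integrable against the Gamma weight in every dimension d >= 1. *)
have del0 : 0 < 4^-1 :> R by rewrite invr_gt0.
have [C [T [B [C0 T0 B0 hC]]]] := exp_psi_difference_ub cpsi psi_ge0 l_gt0 l_sv l_leM psi_Pi del0.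
have [_ [_ _ G0 GE _]] := polar_cst_Gamma R d_gt0.
have [N hN] : exists N, forall n, (N <= n)%N -> t n <= T /\ B <= x n.
  have h1 : \forall n \near \oo, t n <= T.
    move/cvgrPdist_le : t_cvg0 => /(_ _ T0); apply: filterS => n.
    by rewrite sub0r normrN gtr0_norm.
  have h2 : \forall n \near \oo, B <= x n by move/cvgryPge : x_cvgy => /(_ B).
  by have [N _ h] := filterI h1 h2; exists N => n Nn; exact: h.
have mexp : measurable_fun setT (fun v : R => expR (- v)) by exact: measurableT_comp.
have mpow (e : R) : measurable_fun setT (fun v : R => v `^ e) by exact: measurable_powR.
have msq (r : R) : measurable_fun setT (fun v : R => 2 * Num.sqrt (r * v)).
  apply: measurable_funM => //; apply: measurableT_comp; last exact: measurable_funM.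
  exact: (continuous_measurable_fun (@sqrt_continuous R)).
have mpsi := continuous_measurable_fun cpsi.
have me n (r : R) : measurable_fun setT
    (fun v : R => expR (- (t n * psi (2 * Num.sqrt (r * v) * x n)))).
  apply: measurableT_comp => //; apply: measurableT_comp => //; apply: measurable_funM => //.
  by apply: (measurableT_comp mpsi); apply: measurable_funM.
have mK n : measurable_fun setT (K s s' n).
  by apply: measurable_funM => //; exact: measurable_funB.
pose k1 := (2 * Num.sqrt s) `^ 2^-1.
have rs0 : 0 < 2 * Num.sqrt s by rewrite mulr_gt0// sqrtr_gt0.
have k10 : 0 < k1 by rewrite powR_gt0.
pose E := C * (k1 + k1^-1).
have E0 : 0 < E by rewrite mulr_gt0// addr_gt0// invr_gt0.
have dom n (v : R) : (N <= n)%N -> 0 < v ->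
    `|K s s' n v| <= E * (v `^ 4^-1 + v^-1 `^ 4^-1).
  move=> /hN[tT Bx] v0.
  pose w := 2 * Num.sqrt (s * v).
  have w0 : 0 < w by rewrite mulr_gt0// sqrtr_gt0 mulr_gt0.
  (* The two frequencies differ by this factor; s <= s' <= 4 s puts it in [1, 2], the range of the
     domination bound. *)
  pose rho := Num.sqrt (s' / s).
  have rho12 : 1 <= rho <= 2.
    rewrite /rho -{1}(sqrtr1 R) ler_sqrt ?divr_ge0 ?(ltW s'0) ?(ltW s0)//.
    rewrite ler_pdivlMr// mul1r ss'/=.
    have -> : 2 = Num.sqrt 4 :> R.
      by rewrite (_ : 4 = 2 ^+ 2) ?sqrtr_sqr ?ger0_norm//; ring.
    by rewrite ler_sqrt// ler_pdivrMr.
  have rhoE : 2 * Num.sqrt (s' * v) * x n = rho * (w * x n).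
    rewrite /rho /w mulrA; congr (_ * _); rewrite mulrCA; congr (_ * _).
    rewrite -sqrtrM ?divr_ge0 ?(ltW s'0) ?(ltW s0)//; congr Num.sqrt.
    by field; rewrite gt_eqF.
  have tT' : 0 < t n <= T by rewrite t_gt0.
  have [lx] := hC (t n) (x n) w rho tT' Bx w0 rho12.
  have cn0 : 0 < c n by rewrite /c !mulr_gt0// expR_gt0.
  rewrite /K rhoE -/w normrM [`|(c n)^-1|]gtr0_norm ?invr_gt0// ler_pdivrMr//.
  move=> h; apply: (le_trans h); rewrite -/(c n) ler_pM2r// /E -mulrA ler_pM2l//.
  have h24 : 2 * 4^-1 = 2^-1 :> R by field.
  rewrite h24.
  have wE : w `^ 2^-1 = k1 * v `^ 4^-1.
    rewrite /w sqrtrM ?(ltW s0)// mulrA powRM ?(ltW rs0) ?sqrtr_ge0//; congr (_ * _).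
    rewrite -powR12_sqrt ?(ltW v0)// -powRrM; congr (_ `^ _); by field.
  have wE' : w^-1 `^ 2^-1 = k1^-1 * v^-1 `^ 4^-1.
    have -> : w^-1 `^ 2^-1 = (w `^ 2^-1)^-1.
      by rewrite -(powR_inv1 (ltW w0)) -powRrM mulN1r powRN.
    rewrite wE invfM; congr (_ * _).
    by rewrite -(powR_inv1 (ltW v0)) -powRrM mulN1r powRN.
  rewrite wE wE'.
  have p1 : 0 < v `^ 4^-1 by rewrite powR_gt0.
  have p2 : 0 < v^-1 `^ 4^-1 by rewrite powR_gt0 ?invr_gt0.
  have k1V : 0 < k1^-1 by rewrite invr_gt0.
  move: (v `^ 4^-1) (v^-1 `^ 4^-1) p1 p2 => p1 p2 p10 p20.
  have : 0 < k1 * p2 by rewrite mulr_gt0.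
  have : 0 < k1^-1 * p1 by rewrite mulr_gt0.
  by rewrite mulrDl !mulrDr; lra.
have -> : (2^-1 * (ln s' - ln s) * Gamma (d%:R / 2))%:E =
    (\int[@lebesgue_measure R]_(v in `]0%R, +oo[)
     (2^-1 * (ln s' - ln s) * (expR (- v) * v `^ (d%:R / 2 - 1)))%:E)%E.
  rewrite EFinM -GE -ge0_integralZl_EFin//.
  - by move=> v _; rewrite lee_fin mulr_ge0 ?expR_ge0 ?powR_ge0.
  - by apply: measurable_funTS; apply/measurable_EFinP; apply: measurable_funM.
  - by rewrite mulr_ge0 ?invr_ge0// subr_ge0 ler_ln ?posrE.
(* Domination holds only once [t n] is small and [x n] large, so the first N terms are dropped. *)
rewrite -(cvg_shiftn N).
apply: (@dominated_cvg _ _ R (@lebesgue_measure R) _ _ _ _ (fun v : R => (E%:E *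
  ((v `^ 4^-1 + v^-1 `^ 4^-1) * (expR (- v) * v `^ (d%:R / 2 - 1)))%:E)%E)) => //.
- move=> n; apply: measurable_funTS; apply/measurable_EFinP; apply: measurable_funM.
    exact: mK.
  exact: measurable_funM.
- move=> v; rewrite /= in_itv/= andbT => v0.
  apply: cvg_EFin; first exact: nearW.
  apply: cvgMr_tmp.
  rewrite (cvg_shiftn N (fun n => K s s' n v)).
  have sv0 : 0 < Num.sqrt (s * v) by rewrite sqrtr_gt0 mulr_gt0.
  have sv0' : 0 < Num.sqrt (s' * v) by rewrite sqrtr_gt0 mulr_gt0.
  have w0 : 0 < 2 * Num.sqrt (s * v) by rewrite mulr_gt0.
  have w0' : 0 < 2 * Num.sqrt (s' * v) by rewrite mulr_gt0.
  have := exp_psi_difference_cvg l_gt0 l_leM psi_Pi t_gt0 t_cvg0 x_cvgy w0 w0'.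
  (* The factor 1/2 comes from the square roots in the frequencies; the logarithms of v and of 2
     cancel. *)
  rewrite (_ : ln _ - ln _ = 2^-1 * (ln s' - ln s))//.
  rewrite !lnM ?posrE// -!powR12_sqrt ?mulr_ge0 ?(ltW s0) ?(ltW s'0) ?(ltW v0)//.
  rewrite !ln_powR !lnM ?posrE//; lra.
- apply: (@integrableZl _ _ R (@lebesgue_measure R)) => //.
  exact: integrable_gamma_weight.
- move=> n v; rewrite /= in_itv/= andbT => v0.
  rewrite -EFinM lee_fin normrM [E * (_ * _)]mulrA; apply: ler_pM => //.
    exact: dom (leq_addl n N) v0.
  by rewrite ger0_norm// mulr_ge0 ?expR_ge0 ?powR_ge0.
Qed.
End dct.

(** * Comparison with the density *)

Lemma measurable_tnorm (R : realType) (n : nat) : measurable_fun setT (@tnorm R n).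
Proof.
apply: measurableT_comp; last exact: measurable_tdot.
exact: (continuous_measurable_fun (@sqrt_continuous R)).
Qed.

Lemma tnorm_ge0 (R : realType) (n : nat) (x : n.-tuple R) : 0 <= tnorm x.
Proof. exact: sqrtr_ge0. Qed.

Lemma tnorm_gt0 (R : realType) (n : nat) (x : n.-tuple R) :
  x <> tzero R n -> 0 < tnorm x.
Proof.
move=> x0; rewrite sqrtr_gt0 lt_neqAle tdot_ge0 andbT; apply/eqP => q0; apply: x0.
apply: eq_from_tnth => i; rewrite tnth_mktuple.
have /psumr_eq0P : \sum_(i < n) tnth x i * tnth x i = 0 by rewrite -[LHS]/(tdot x x) -q0.
have nn (j : 'I_n) : true -> 0 <= tnth x j * tnth x j by rewrite -expr2 sqr_ge0.
by move=> /(_ (fun j => nn j) i isT)/eqP; rewrite mulf_eq0 orbb => /eqP.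
Qed.

Lemma tnorm_tzero (R : realType) (n : nat) : tnorm (tzero R n) = 0.
Proof.
rewrite /tnorm (_ : tdot _ _ = 0) ?sqrtr0//.
by apply: big1 => i _; rewrite tnth_mktuple mulr0.
Qed.

(** Monotonicity is known for positive arguments only. Freezing [p] below 1 / (n + 1) gives
    functions monotone on the whole line, which equal [p] at any given r > 0 for large n. *)
Lemma nonincreasing_pos_measurable (R : realType) (p : R -> R) :
  (forall r s, 0 < r -> r <= s -> p s <= p r) ->
  measurable_fun (`]0, +oo[%classic : set R) p.
Proof.
move=> ni.
pose h (n : nat) (r : R) := p (Num.max (n.+1%:R)^-1 r).
have mh n : measurable_fun setT (h n).
  apply: nonincreasing_measurable => // r s rs; rewrite /h; apply: ni.
    by rewrite lt_max invr_gt0 ltr0n.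
  by rewrite ge_max !le_max lexx rs orbT.
apply: (@measurable_fun_cvg _ _ _ _ h) => //.
- by move=> n; exact: measurable_funTS.
- move=> r; rewrite /= in_itv/= andbT => r0.
  apply: cvg_near_cst; exists (Num.truncn r^-1) => // n /= rn.
  rewrite /h; congr p; apply/max_idPr.
  rewrite -[leRHS]invrK lef_pV2 ?posrE ?invr_gt0//.
  by apply: (le_trans (ltW (truncnS_gt _))); rewrite ler_nat.
Qed.

Section comparison.
Variables (R : realType) (dO : measure_display) (O : measurableType dO).
Variables (P : probability O R) (d : nat) (X : O -> d.-tuple R) (p : R -> R).
Hypothesis mX : measurable_fun setT X.
Hypothesis p_ge0 : forall r, 0 < r -> 0 <= p r.
Hypothesis p_ni : forall r s, 0 < r -> r <= s -> p s <= p r.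
Hypothesis density : forall A : set (d.-tuple R), measurable A ->
  P [set w | A (X w) /\ X w <> tzero R d]
  = intRd (fun x : d.-tuple R => (p (tnorm x) * \1_A x)%:E).
Notation mu := (tuple_lebesgue R d).

(** The law may have an atom at the origin, and [p] is unconstrained at 0; restricting to sets that
    avoid the origin removes both problems. *)
Lemma law_density (A : set (d.-tuple R)) : measurable A ->
  (forall x, A x -> 0 < tnorm x) ->
  measurable_fun setT (fun x : d.-tuple R => (p (tnorm x) * \1_A x)%:E) /\
  P (X @^-1` A) = (\int[mu]_x (p (tnorm x) * \1_A x)%:E)%E.
Proof.
move=> mA A0.
have mpA : measurable_fun setT (fun x : d.-tuple R => p (tnorm x) * \1_A x).
  pose p' := p \_ (`]0, +oo[%classic : set R).
  have mp' : measurable_fun setT p'.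
    apply/(measurable_restrictT _ _).1; first exact: measurable_itv.
    exact: nonincreasing_pos_measurable.
  rewrite (_ : (fun x => _) = (fun x : d.-tuple R => p' (tnorm x) * \1_A x)).
    apply: measurable_funM; last exact: measurable_indic.
    exact: (measurableT_comp mp' (@measurable_tnorm R d)).
  apply/funext => x; rewrite indicE; case: (boolP (x \in A)) => [/set_mem Ax|_].
    by rewrite !mulr1 /p' patchE mem_set//= in_itv/= andbT A0.
  by rewrite !mulr0.
split; first exact/measurable_EFinP.
rewrite -intRdE; last 2 first.
- exact/measurable_EFinP.
- move=> x; rewrite lee_fin indicE; case: (boolP (x \in A)) => [/set_mem Ax|_].
    by rewrite mulr1 p_ge0// A0.
  by rewrite mulr0.
rewrite -density//; congr (P _); apply/seteqP; split => w /=; last by case.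
move=> Aw; split => // X0; have := A0 _ Aw.
by rewrite X0 tnorm_tzero ltxx.
Qed.

Variable (r : R).
Hypothesis r_gt0 : 0 < r.
Variable f : R -> R.
Hypothesis mf : measurable_fun setT f.
Hypothesis f_ge0 : forall v, 0 <= f v.

Let q (x : d.-tuple R) := f (tdot (tscale r^-1 x) (tscale r^-1 x)).

Let mq : measurable_fun setT q.
Proof.
apply: (measurableT_comp mf); apply: measurable_tdot; exact: measurable_tscale.
Qed.

Let integral_q : (\int[mu]_x (q x)%:E = (r ^+ d)%:E * \int[mu]_x (f (tdot x x))%:E)%E.
Proof.
have mfq : measurable_fun setT (fun x : d.-tuple R => (f (tdot x x))%:E).
  by apply/measurable_EFinP; apply: (measurableT_comp mf); exact: measurable_tdot.
rewrite -!intRdE//; last 3 first.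
- by move=> x; rewrite lee_fin; exact: f_ge0.
- exact/measurable_EFinP.
- by move=> x; rewrite lee_fin; exact: f_ge0.
rewrite (intRd_scale r_gt0); last 2 first.
- exact/measurable_EFinP.
- by move=> x; rewrite lee_fin; exact: f_ge0.
congr (_ * _)%E; apply: eq_intRd => x; rewrite /q; congr (f _)%:E.
rewrite !tdot_scale tdotC !tdot_scale.
have rn0 : r != 0 by rewrite gt_eqF.
by rewrite !mulKf.
Qed.

Let tdot_scaleV (x : d.-tuple R) :
  tdot (tscale r^-1 x) (tscale r^-1 x) = (tnorm x / r) ^+ 2.
Proof.
by rewrite -tnorm_sqr tnorm_scale ?invr_ge0 ?(ltW r_gt0)// mulrC.
Qed.

Let law : {measure set (d.-tuple R) -> \bar R}.
Proof. by pose m : {measure set (d.-tuple R) -> \bar R} := pushforward P X; exact: (m mX). Defined.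

Let lawE (S : set (d.-tuple R)) : measurable S -> (forall x, ~ S x -> q x = 0) ->
  (\int[P]_w (q (X w))%:E = \int[law]_(x in S) (q x)%:E)%E.
Proof.
move=> mS qS.
transitivity (\int[law]_x (q x)%:E)%E.
  rewrite (ge0_integral_pushforward mX)//; first exact/measurable_EFinP.
  by move=> y _; rewrite lee_fin; exact: f_ge0.
rewrite [RHS]integral_mkcond; apply: eq_integral => x _; rewrite patchE.
by case: ifPn => // /negP nS; rewrite qS// => Sx; apply: nS; exact/mem_set.
Qed.

Let pr_ge0 : 0 <= p r. Proof. exact: p_ge0. Qed.

Let scaledE (S : set (d.-tuple R)) : measurable S -> (forall x, ~ S x -> q x = 0) ->
  (\int[mscale (NngNum pr_ge0) mu]_(x in S) (q x)%:E =
   (p r * r ^+ d)%:E * \int[mu]_x (f (tdot x x))%:E)%E.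
Proof.
move=> mS qS; rewrite ge0_integral_mscale//; last 2 first.
- by apply: measurable_funTS; exact/measurable_EFinP.
- by move=> x _; rewrite lee_fin; exact: f_ge0.
rewrite EFinM -muleA -integral_q; congr (_ * _)%E.
rewrite [LHS]integral_mkcond; apply: eq_integral => x _; rewrite patchE.
by case: ifPn => // /negP nS; rewrite qS// => Sx; apply: nS; exact/mem_set.
Qed.

Let integral_cst_indic (A : set (d.-tuple R)) : measurable A ->
  (\int[mu]_x (p r * \1_A x)%:E = (p r)%:E * mu A)%E.
Proof.
move=> mA; under eq_integral do rewrite EFinM.
rewrite ge0_integralZl_EFin//; last first.
  by apply/measurable_EFinP; exact: measurable_indic.
by rewrite integral_indic// setIT.
Qed.

(** On the support of the rescaled function |x| >= r, so p(|x|) <= p(r) and the law is below p(r)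
    times Lebesgue measure there. Undoing the scaling produces r^d. *)
Lemma comparison_outer : (forall v, v < 1 -> f v = 0) ->
  (\int[P]_w (f (tdot (tscale r^-1 (X w)) (tscale r^-1 (X w))))%:E <=
   (p r * r ^+ d)%:E * \int[mu]_x (f (tdot x x))%:E)%E.
Proof.
move=> f1; pose S := [set x : d.-tuple R | r <= tnorm x].
have mS : measurable S.
  rewrite (_ : S = (@tnorm R d) @^-1` `[r, +oo[%classic); last first.
    by apply/seteqP; split => x /=; rewrite in_itv/= andbT.
  rewrite -[X in measurable X]setTI; apply: measurable_tnorm => //; exact: measurable_itv.
have qS x : ~ S x -> q x = 0.
  move=> /negP; rewrite -ltNge => xr; rewrite /q tdot_scaleV f1//.
  by rewrite expr_lt1// ?ltr_pdivrMr ?mul1r// divr_ge0 ?tnorm_ge0// ltW.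
rewrite -[leLHS]/(\int[P]_w (q (X w))%:E)%E (lawE mS qS) -(scaledE mS qS).
apply: ge0_le_measure_integral_in => //; last 2 first.
- exact/measurable_EFinP.
- by move=> x; rewrite lee_fin; exact: f_ge0.
move=> A mA AS.
have A0 x : A x -> 0 < tnorm x by move=> /AS; apply: lt_le_trans.
have [mpA lawA] := law_density mA A0.
rewrite -[leLHS]/(P (X @^-1` A)) lawA /= /mscale/= -integral_cst_indic//.
apply: ge0_le_integral => //.
- move=> x _; rewrite lee_fin indicE; case: (boolP (x \in A)) => [/set_mem Ax|_].
    by rewrite mulr1 p_ge0// A0.
  by rewrite mulr0.
- by apply/measurable_EFinP; apply: measurable_funM => //; exact: measurable_indic.
- move=> x _; rewrite lee_fin indicE; case: (boolP (x \in A)) => [/set_mem Ax|_].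
    by rewrite !mulr1 p_ni//; exact: AS.
  by rewrite !mulr0.
Qed.

(** Inside the ball monotonicity goes the other way. The condition [f 0 = 0] excludes the origin,
    where the law need not be described by [p]. *)
Lemma comparison_inner : f 0 = 0 -> (forall v, 1 < v -> f v = 0) ->
  ((p r * r ^+ d)%:E * \int[mu]_x (f (tdot x x))%:E <=
   \int[P]_w (f (tdot (tscale r^-1 (X w)) (tscale r^-1 (X w))))%:E)%E.
Proof.
move=> f0 f1; pose S := [set x : d.-tuple R | 0 < tnorm x <= r].
have mS : measurable S.
  rewrite (_ : S = (@tnorm R d) @^-1` `]0, r]%classic); last first.
    by apply/seteqP; split => x /=; rewrite in_itv/=.
  rewrite -[X in measurable X]setTI; apply: measurable_tnorm => //; exact: measurable_itv.
have qS x : ~ S x -> q x = 0.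
  move=> /negP; rewrite negb_and -!leNgt -ltNge => /orP[x0|xr].
    have -> : q x = f ((tnorm x / r) ^+ 2) by rewrite /q tdot_scaleV.
    have -> : tnorm x = 0 by apply/eqP; rewrite eq_le x0 tnorm_ge0.
    by rewrite mul0r expr0n.
  rewrite /q tdot_scaleV f1//.
  by rewrite expr_gt1// ?ltr_pdivlMr ?mul1r// divr_ge0 ?tnorm_ge0// ltW.
rewrite -[leRHS]/(\int[P]_w (q (X w))%:E)%E (lawE mS qS) -(scaledE mS qS).
apply: ge0_le_measure_integral_in => //; last 2 first.
- exact/measurable_EFinP.
- by move=> x; rewrite lee_fin; exact: f_ge0.
move=> A mA AS.
have A0 x : A x -> 0 < tnorm x by move=> /AS /andP[].
have [mpA lawA] := law_density mA A0.
rewrite -[leRHS]/(P (X @^-1` A)) lawA /= /mscale/= -integral_cst_indic//.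
apply: ge0_le_integral => //.
- by move=> x _; rewrite lee_fin mulr_ge0.
- by apply/measurable_EFinP; apply: measurable_funM => //; exact: measurable_indic.
- move=> x _; rewrite lee_fin indicE; case: (boolP (x \in A)) => [/set_mem Ax|_].
    by rewrite !mulr1 p_ni ?A0//; have /andP[] := AS _ Ax.
  by rewrite !mulr0.
Qed.
End comparison.

Lemma continuous_cf (R : realType) (dO : measure_display) (O : measurableType dO)
    (P : probability O R) (Z : O -> R) (phi : R -> R) :
  measurable_fun setT Z ->
  (forall u, (\int[P]_w (cos (u * Z w))%:E = (phi u)%:E)%E) -> continuous phi.
Proof.
move=> mZ phiE u; apply/(@cvg_nbhsP _ R^o) => v vu.
have -> : (fun n => phi (v n)) = fine \o (fun n => \int[P]_w (cos (v n * Z w))%:E)%E.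
  by apply/funext => n /=; rewrite phiE.
apply: fine_cvg; rewrite -phiE.
have mc (y : R) : measurable_fun setT (fun w => (cos (y * Z w))%:E).
  apply/measurable_EFinP; apply: measurableT_comp; last exact: measurable_funM.
  exact: (continuous_measurable_fun (@continuous_cos R)).
apply: (@dominated_cvg _ _ R P setT measurableT _ _ (cst 1%E)) => //.
- move=> w _; apply: cvg_EFin; first exact: nearW.
  apply: (@continuous_cvg _ _ _ _ _ _ (@cos R)); first exact: continuous_cos.
  exact: cvgMr_tmp.
- exact: finite_measure_integrable_cst.
- by move=> n w _; rewrite lee_fin; exact: cos_max.
Qed.

(** * Test functions and the limit functional *)

Section test_function.
Variable R : realType.
Implicit Types al be v : R.

Let measurable_inv2 : measurable_fun setT (fun v : R => (2 * v)^-1).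
Proof. by apply: (measurableT_comp (@measurable_inv_fun R)); exact: measurable_funM. Qed.

(* Under [w = exp (- v)], this is the density of [dv / (2 v)] with the weight [w (1 - w)]
   that makes it finite. *)
Definition limit_weight v : R := expR (- v) * (1 - expR (- v)) / (2 * v).

Lemma limit_weight_ge0 v : v \in `]0, +oo[ -> 0 <= limit_weight v.
Proof.
rewrite in_itv/= andbT => v0.
rewrite divr_ge0 ?mulr_ge0 ?expR_ge0 ?(ltW v0)// subr_ge0 -expR0 ler_expR; lra.
Qed.

Lemma measurable_limit_weight : measurable_fun setT limit_weight.
Proof.
have mexp : measurable_fun setT (fun v : R => expR (- v)) by exact: measurableT_comp.
apply: measurable_funM; first by apply: measurable_funM => //; exact: measurable_funB.
exact: measurable_inv2.
Qed.

(** With w = exp(- v), w (1 - w) w^k = exp(- (k + 1) v) - exp(- (k + 2) v), so this is half a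
    Frullani integral. *)
Lemma integral_limit_weight_expn (k : nat) :
  (\int[@lebesgue_measure R]_(v in `]0%R, +oo[) (limit_weight v * expR (- v) ^+ k)%:E =
   (2^-1 * (ln k.+2%:R - ln k.+1%:R))%:E)%E.
Proof.
have kE (v : R) : limit_weight v * expR (- v) ^+ k =
    2^-1 * ((expR (- (k.+1%:R * v)) - expR (- (k.+2%:R * v))) / v).
  rewrite -[- (k.+1%:R * v)]mulrN -[- (k.+2%:R * v)]mulrN !expRM_natl [_ ^+ k.+2]exprS.
  rewrite [_ ^+ k.+1]exprS /limit_weight invfM; ring.
under eq_integral do rewrite kE EFinM.
rewrite ge0_integralZl_EFin//; last 2 first.
- move=> v; rewrite /= in_itv/= andbT => v0; rewrite lee_fin divr_ge0 ?(ltW v0)//.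
  rewrite subr_ge0 ler_expR lerN2 ler_pM2r//; by rewrite ler_nat.
- apply: measurable_funTS; apply/measurable_EFinP; apply: measurable_funM; last first.
    exact: measurable_inv_fun.
  by apply: measurable_funB; apply: measurableT_comp => //; apply: measurableT_comp.
by rewrite frullani ?ltr0n// ltr_nat.
Qed.

Lemma integrable_limit_weight :
  (@lebesgue_measure R).-integrable `]0%R, +oo[ (fun v => (limit_weight v)%:E).
Proof.
apply/integrableP; split.
  by apply: measurable_funTS; apply/measurable_EFinP; exact: measurable_limit_weight.
under eq_integral => v vD.
  rewrite gee0_abs; last by rewrite lee_fin; apply: limit_weight_ge0; move: vD; rewrite inE.
  rewrite -[limit_weight v]mulr1 -(expr0 (expR (- v))); over.
by rewrite integral_limit_weight_expn ltry.
Qed.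

Definition limit_functional (g : R -> R) : R :=
  wint (@lebesgue_measure R) `]0%R, +oo[%classic limit_weight (fun v => expR (- v)) g.

(** The map v to exp(- v) reverses order, so this lives on the shell between [al] and [be]. The
    leading factor is the weight built into the functionals, so that integrating [test_fun]
    evaluates them at [bump]. *)
Definition test_fun al be v : R :=
  expR (- v) * (1 - expR (- v)) * bump (expR (- be)) (expR (- al)) (expR (- v)).

Lemma measurable_test_fun al be : measurable_fun setT (test_fun al be).
Proof.
have mexp : measurable_fun setT (fun v : R => expR (- v)) by exact: measurableT_comp.
apply: measurable_funM; first by apply: measurable_funM => //; exact: measurable_funB.
exact: (measurableT_comp (continuous_measurable_fun (@continuous_bump R _ _))).
Qed.

Lemma test_fun_out al be v : al <= be -> v <= al \/ be <= v -> test_fun al be v = 0.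
Proof.
move=> albe h; rewrite /test_fun /bump.
suff /max_idPl -> : (expR (- v) - expR (- be)) * (expR (- al) - expR (- v)) <= 0.
  by rewrite mulr0.
have ab : expR (- be) <= expR (- al) by rewrite ler_expR; lra.
case: h => h.
  have : expR (- al) <= expR (- v) by rewrite ler_expR; lra.
  by move=> h1; apply: mulr_ge0_le0; lra.
have : expR (- v) <= expR (- be) by rewrite ler_expR; lra.
by move=> h1; apply: mulr_le0_ge0; lra.
Qed.

Lemma test_fun_ge0 al be v : 0 <= al -> al <= be -> 0 <= test_fun al be v.
Proof.
move=> al0 albe; have [v0|v0] := leP v al; first by rewrite test_fun_out//; left.
rewrite /test_fun !mulr_ge0 ?expR_ge0 ?bump_ge0// subr_ge0 -expR0 ler_expR; lra.
Qed.

Lemma limit_functional_bump al be : 0 <= al -> al <= be ->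
  (\int[@lebesgue_measure R]_(v in `]0%R, +oo[) (test_fun al be v / (2 * v))%:E)%E =
  (limit_functional (bump (expR (- be)) (expR (- al))))%:E.
Proof.
move=> al0 albe; rewrite /limit_functional /wint fineK.
  apply: eq_integral => v _; congr EFin; rewrite /test_fun /limit_weight; ring.
apply: integrable_fin_num => //; apply: integrable_wint => //.
- exact: integrable_limit_weight.
- by apply: measurable_funTS; exact: measurableT_comp.
- move=> v; rewrite /= in_itv/= andbT => v0.
  rewrite expR_ge0/= -expR0 ler_expR; lra.
- exact: continuous_bump.
Qed.

(** Strict positivity allows this number to be cancelled at the end. On the middle third of the
    shell every factor is bounded below, and [k] is the product of those bounds. *)
Lemma limit_functional_bump_gt0 al be : 0 < al -> al < be ->
  0 < limit_functional (bump (expR (- be)) (expR (- al))).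
Proof.
move=> al0 albe; rewrite -lte_fin -limit_functional_bump ?(ltW al0) ?(ltW albe)//.
pose m1 := al + (be - al) / 3; pose m2 := al + (be - al) * 2 / 3.
have m12 : m1 < m2 by rewrite /m1 /m2; lra.
have alm1 : al < m1 by rewrite /m1; lra.
have m2be : m2 < be by rewrite /m2; lra.
pose k := expR (- be) * (1 - expR (- m1)) *
  ((expR (- m2) - expR (- be)) * (expR (- al) - expR (- m1))) / (2 * be).
have e1 : 0 < 1 - expR (- m1) by rewrite subr_gt0 -expR0 ltr_expR; lra.
have e2 : 0 < expR (- m2) - expR (- be) by rewrite subr_gt0 ltr_expR; lra.
have e3 : 0 < expR (- al) - expR (- m1) by rewrite subr_gt0 ltr_expR; lra.
have k0 : 0 < k.
  by rewrite divr_gt0 ?mulr_gt0 ?expR_gt0//; lra.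
pose E : set R := `[m1, m2]%classic.
have mE : measurable E by exact: measurable_itv.
have lowE (v : R) : m1 <= v -> v <= m2 -> k <= test_fun al be v / (2 * v).
  move=> v1 v2; have v0 : 0 < v by lra.
  have h1 : expR (- m2) <= expR (- v) by rewrite ler_expR; lra.
  have h2 : expR (- v) <= expR (- m1) by rewrite ler_expR; lra.
  apply: ler_pM.
  - by rewrite !mulr_ge0 ?expR_ge0//; lra.
  - by rewrite invr_ge0; lra.
  - apply: ler_pM; rewrite ?mulr_ge0 ?expR_ge0//; try lra.
      by apply: ler_pM; rewrite ?expR_ge0//; lra.
    rewrite le_max; apply/orP; right; apply: ler_pM; lra.
  - by rewrite lef_pV2 ?posrE; lra.
apply: (@lt_le_trans _ _ (\int[@lebesgue_measure R]_(v in `]0%R, +oo[) (k * \1_E v)%:E)%E).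
  under eq_integral do rewrite EFinM.
  rewrite ge0_integralZl_EFin ?(ltW k0)//; last first.
    by apply: measurable_funTS; apply/measurable_EFinP; exact: measurable_indic.
  rewrite integral_indic ?measurable_itv// (_ : E `&` _ = E); last first.
    apply/setIidPl => v; rewrite /E /= !in_itv/= andbT => /andP[v1 _]; lra.
  rewrite /E; have := lebesgue_measure_itv `[m1, m2].
  rewrite /= lte_fin m12 => ->; rewrite -EFinB -EFinM lte_fin mulr_gt0//; lra.
apply: ge0_le_integral => //.
- by move=> v _; rewrite lee_fin mulr_ge0// ltW.
- by apply: measurable_funTS; apply/measurable_EFinP; exact: measurable_funM.
- apply: measurable_funTS; apply/measurable_EFinP; apply: measurable_funM.
    exact: measurable_test_fun.
  exact: measurable_inv2.
- move=> v; rewrite /= in_itv/= andbT => v0; rewrite lee_fin indicE.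
  case: (boolP (v \in E)) => [/set_mem|_].
    by rewrite /E /= in_itv/= mulr1 => /andP[]; exact: lowE.
  by rewrite mulr0 divr_ge0 ?test_fun_ge0 ?mulr_ge0 ?(ltW v0) ?(ltW al0) ?(ltW albe).
Qed.

(** The radial density u^(d/2 - 1) is 2 u^(d/2) times the density 1 / (2 u) of the limit measure,
    and u^(d/2) varies only between its values at [al] and [be] on the shell. *)
Lemma integral_test_fun (d : nat) (C : R) al be : (0 < d)%N -> 0 < C ->
  polar_cst R d = C%:E -> 0 <= al -> al < be ->
  let I := limit_functional (bump (expR (- be)) (expR (- al))) in
  let J := (\int[tuple_lebesgue R d]_x (test_fun al be (tdot x x))%:E)%E in
  ((2 * C * al `^ (d%:R / 2) * I)%:E <= J)%E /\
  (J <= (2 * C * be `^ (d%:R / 2) * I)%:E)%E.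
Proof.
move=> d0 C0 CE al0 albe I J.
have f0 v : 0 <= test_fun al be v by apply: test_fun_ge0 => //; exact: ltW.
have mT := @measurable_test_fun al be.
have JE : J = (C%:E * \int[@lebesgue_measure R]_(u in `]0%R, +oo[)
    (test_fun al be u * u `^ (d%:R / 2 - 1))%:E)%E.
  by rewrite -CE -integral_polar_pos.
pose F u := test_fun al be u / (2 * u).
have mF : measurable_fun setT F.
  by apply: measurable_funM => //; exact: measurable_inv2.
have F0 (u : R) : 0 < u -> 0 <= F u.
  by move=> u0; rewrite divr_ge0 ?f0 ?mulr_ge0 ?(ltW u0).
have cI c : 0 <= c -> (2 * C * c * I)%:E =
    (C%:E * \int[@lebesgue_measure R]_(u in `]0%R, +oo[) (2 * c * F u)%:E)%E.
  move=> c0; rewrite (_ : (\int[_]_(u in _) _)%E = ((2 * c)%:E * I%:E)%E).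
    by rewrite -!EFinM; congr EFin; ring.
  rewrite /I -limit_functional_bump ?(ltW albe)//.
  under eq_integral do rewrite EFinM.
  rewrite ge0_integralZl_EFin ?mulr_ge0//.
  - by move=> u; rewrite /= in_itv/= andbT => u0; rewrite lee_fin; exact: F0.
  - by apply: measurable_funTS; exact/measurable_EFinP.
have FE (u : R) : 0 < u -> test_fun al be u * u `^ (d%:R / 2 - 1) = 2 * u `^ (d%:R / 2) * F u.
  move=> u0; rewrite /F; have u0' : u != 0 by rewrite gt_eqF.
  have -> : u `^ (d%:R / 2 - 1) = u `^ (d%:R / 2) / u.
    by rewrite powRD ?u0' ?implybT// powR_inv1// ltW.
  by field.
have F_out (u : R) : u <= al \/ be <= u -> F u = 0.
  by move=> h; rewrite /F test_fun_out ?mul0r// ltW.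
have mpow : measurable_fun setT (fun u : R => u `^ (d%:R / 2 - 1)) by exact: measurable_powR.
rewrite JE !cI ?powR_ge0//; split; apply: lee_wpmul2l; rewrite ?lee_fin ?(ltW C0)//;
  apply: ge0_le_integral => //.
- by move=> u; rewrite /= in_itv/= andbT => u0; rewrite lee_fin;
  apply: mulr_ge0; [by rewrite mulr_ge0 ?powR_ge0|exact: F0].
- by apply: measurable_funTS; apply/measurable_EFinP; exact: measurable_funM.
- by apply: measurable_funTS; apply/measurable_EFinP; exact: measurable_funM.
- move=> u; rewrite /= in_itv/= andbT => u0; rewrite lee_fin (FE u)//.
  have [ual|ual] := leP u al; first by rewrite (F_out u) ?mulr0//; left.
  rewrite ler_wpM2r ?F0// ler_pM2l// ge0_ler_powR// ?nnegrE ?divr_ge0//; exact: ltW.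
- by move=> u _; rewrite lee_fin mulr_ge0 ?powR_ge0// f0.
- by apply: measurable_funTS; apply/measurable_EFinP; exact: measurable_funM.
- by apply: measurable_funTS; apply/measurable_EFinP; exact: measurable_funM.
- move=> u; rewrite /= in_itv/= andbT => u0; rewrite lee_fin (FE u)//.
  have [ual|ual] := leP be u; first by rewrite (F_out u) ?mulr0//; right.
  rewrite ler_wpM2r ?F0// ler_pM2l// ge0_ler_powR// ?nnegrE ?divr_ge0//; lra.
Qed.
End test_function.

(** * The functional attached to a random vector *)

Section laplace_functional.
Variables (R : realType) (dO : measure_display) (O : measurableType dO).
Variables (P : probability O R) (d : nat) (Y : O -> d.-tuple R) (phi : R -> R).
Hypothesis d_gt0 : (0 < d)%N.
Hypothesis mY : measurable_fun setT Y.

Definition laplace_functional (g : R -> R) : R :=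
  wint P setT (fun w => expR (- tdot (Y w) (Y w)) * (1 - expR (- tdot (Y w) (Y w))))
    (fun w => expR (- tdot (Y w) (Y w))) g.

Let W w := expR (- tdot (Y w) (Y w)).

Let W01 w : 0 <= W w <= 1.
Proof. by rewrite expR_ge0/= -expR0 ler_expR oppr_le0 tdot_ge0. Qed.

Let om_ge0 w : 0 <= W w * (1 - W w).
Proof. by have /andP[? ?] := W01 w; rewrite mulr_ge0// subr_ge0. Qed.

Let mW : measurable_fun setT W.
Proof. by apply: measurableT_comp => //; apply: measurableT_comp => //; exact: measurable_tdot. Qed.

Let iom : P.-integrable setT (fun w => (W w * (1 - W w))%:E).
Proof.
apply: (@integrable_bounded _ _ _ P _ 1).
  by apply: measurable_funM => //; exact: measurable_funB.
move=> w; rewrite ger0_norm ?om_ge0//; have /andP[h1 h2] := W01 w.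
by rewrite mulr_ile1// ?subr_ge0// gerBl.
Qed.

Lemma laplace_functional_linear c (f h : R -> R) : continuous f -> continuous h ->
  laplace_functional (fun w => c * f w + h w) = c * laplace_functional f + laplace_functional h.
Proof. by apply: wint_linear => // w _; exact: W01. Qed.

Lemma laplace_functional_bound e (f : R -> R) : continuous f ->
  (forall w, 0 <= w <= 1 -> `|f w| <= e) ->
  `|laplace_functional f| <= e * `|laplace_functional (fun=> 1)|.
Proof. by apply: wint_bound => // w _; [exact: om_ge0|exact: W01]. Qed.

Lemma laplace_functional_bump al be :
  (\int[P]_w (test_fun al be (tdot (Y w) (Y w)))%:E)%E =
  (laplace_functional (bump (expR (- be)) (expR (- al))))%:E.
Proof.
rewrite /laplace_functional /wint fineK; first exact: eq_integral.
apply: integrable_fin_num => //; apply: integrable_wint => //.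
by move=> w _; exact: W01.
exact: continuous_bump.
Qed.

Hypothesis mphi : measurable_fun setT phi.
Hypothesis phi_ge0 : forall u, 0 <= phi u.
Hypothesis cfY : forall xi : d.-tuple R,
  (\int[P]_w (cos (tdot xi (Y w)))%:E = (phi (tnorm xi))%:E)%E.

(** The weighted k-th moment is the difference of the Laplace transforms at k + 1 and k + 2, and
    [laplace_norm] turns each into a Gamma average of the characteristic function. *)
Lemma laplace_functional_expn (c : R) (k : nat) :
  (\int[@lebesgue_measure R]_(v in `]0%R, +oo[)
    ((phi (2 * Num.sqrt (k.+1%:R * v)) - phi (2 * Num.sqrt (k.+2%:R * v))) / c *
     (expR (- v) * v `^ (d%:R / 2 - 1)))%:E =
  (laplace_functional (fun w => w ^+ k) / c * Gamma (d%:R / 2))%:E)%E.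
Proof.
have [C [C0 CE G0 GE CG]] := polar_cst_Gamma R d_gt0.
pose L s := (\int[P]_w (expR (- (s * tdot (Y w) (Y w))))%:E)%E.
pose h s (v : R) := phi (2 * Num.sqrt (s * v)) * (expR (- v) * v `^ (d%:R / 2 - 1)).
have iL s : 0 < s -> P.-integrable setT (fun w => (expR (- (s * tdot (Y w) (Y w))))%:E).
  move=> s0; apply: (@integrable_bounded _ _ _ P _ 1).
    apply: measurableT_comp => //; apply: measurableT_comp => //.
    by apply: measurable_funM => //; exact: measurable_tdot.
  move=> w; rewrite ger0_norm ?expR_ge0//.
  by rewrite -expR0 ler_expR oppr_le0 mulr_ge0 ?tdot_ge0// ltW.
have Lfin s : 0 < s -> L s = (fine (L s))%:E.
  by move=> s0; rewrite fineK//; exact: integrable_fin_num (iL s s0).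
have hE s : 0 < s -> (\int[@lebesgue_measure R]_(v in `]0%R, +oo[) (h s v)%:E =
    (Gamma (d%:R / 2) * fine (L s))%:E)%E.
  by move=> s0; rewrite -(laplace_norm d_gt0 mY mphi phi_ge0 cfY s0) -/(L s) (Lfin s s0)/= -EFinM.
have mh s : measurable_fun setT (h s).
  apply: measurable_funM; last first.
    apply: measurable_funM; last exact: measurable_powR.
    exact: measurableT_comp.
  apply: measurableT_comp => //; apply: measurable_funM => //.
  apply: measurableT_comp; last exact: measurable_funM.
  exact: (continuous_measurable_fun (@sqrt_continuous R)).
have h0 s v : 0 <= h s v by rewrite !mulr_ge0 ?expR_ge0 ?powR_ge0.
have ih s : 0 < s -> (@lebesgue_measure R).-integrable `]0%R, +oo[ (fun v => (h s v)%:E).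
  move=> s0; apply/integrableP; split.
    by apply: measurable_funTS; apply/measurable_EFinP; exact: mh.
  under eq_integral do rewrite gee0_abs ?lee_fin ?h0//.
  by rewrite (hE s s0) ltry.
have k1 : 0 < k.+1%:R :> R by rewrite ltr0n.
have k2 : 0 < k.+2%:R :> R by rewrite ltr0n.
have -> : laplace_functional (fun w => w ^+ k) = fine (L k.+1%:R) - fine (L k.+2%:R).
  rewrite /laplace_functional /wint.
  rewrite (_ : (\int[P]_(z in setT) _)%E = (L k.+1%:R - L k.+2%:R)%E).
    by rewrite (Lfin _ k1) (Lfin _ k2).
  rewrite /L -integralB//; [|exact: iL..].
  apply: eq_integral => w _; rewrite -EFinB; congr EFin.
  rewrite -[- (k.+1%:R * _)]mulrN -[- (k.+2%:R * _)]mulrN !expRM_natl.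
  by rewrite [_ ^+ k.+2]exprS [_ ^+ k.+1]exprS; ring.
transitivity (c^-1%:E * (\int[@lebesgue_measure R]_(v in `]0%R, +oo[) (h k.+1%:R v)%:E -
   \int[@lebesgue_measure R]_(v in `]0%R, +oo[) (h k.+2%:R v)%:E))%E.
  rewrite -integralB//; [|exact: ih..].
  rewrite -integralZl//; last by apply: integrableB => //; exact: ih.
  apply: eq_integral => v _; rewrite -EFinB -EFinM; congr EFin; rewrite /h; ring.
rewrite (hE _ k1) (hE _ k2) -EFinB -EFinM; congr EFin; ring.
Qed.
End laplace_functional.

(** * Convergence of the normalised functionals *)

Section laplace_functional_cvg.
Variables (R : realType) (psi l : R -> R) (a M : R) (d : nat).
Hypothesis cpsi : continuous psi.
Hypothesis psi_ge0 : forall x, 0 <= psi x.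
Hypothesis l_gt0 : forall x, a <= x -> 0 < l x.
Hypothesis l_sv : forall lam : R, 0 < lam -> (fun x => l (lam * x) / l x) @ +oo --> (1 : R).
Hypothesis l_leM : forall x, a <= x -> l x <= M.
Hypothesis psi_Pi : forall lam : R, 0 < lam ->
  (fun x => (psi (lam * x) - psi x) / l x) @ +oo --> ln lam.
Hypothesis d_gt0 : (0 < d)%N.
Variables (t x : nat -> R).
Hypothesis t_gt0 : forall n, 0 < t n.
Hypothesis t_cvg0 : t n @[n --> \oo] --> 0.
Hypothesis x_cvgy : x n @[n --> \oo] --> +oo.
Variables (dO : measure_display) (O : measurableType dO) (P : probability O R).
Variable Y : nat -> O -> d.-tuple R.
Hypothesis mY : forall n, measurable_fun setT (Y n).
Hypothesis cfY : forall n (xi : d.-tuple R),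
  (\int[P]_w (cos (tdot xi (Y n w)))%:E = (expR (- (t n * psi (tnorm xi * x n))))%:E)%E.

Let c n := t n * l (x n) * expR (- (t n * psi (x n))).

Lemma laplace_functional_cvg (al be : R) : 0 <= al -> 0 <= be ->
  laplace_functional P (Y n) (bump (expR (- be)) (expR (- al))) / c n @[n --> \oo] -->
  limit_functional (bump (expR (- be)) (expR (- al))).
Proof.
move=> al0 be0.
have G0 : 0 < Gamma (d%:R / 2 : R) by have [? []] := polar_cst_Gamma R d_gt0.
apply: (@functional_cvg R (fun n g => laplace_functional P (Y n) g / c n) (@limit_functional R)).
- by move=> n k f h cf ch; rewrite laplace_functional_linear// mulrDl mulrA.
- move=> k f h cf ch; apply: wint_linear => //.
  + exact: integrable_limit_weight.
  + by apply: measurable_funTS; exact: measurableT_comp.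
  + move=> v; rewrite /= in_itv/= andbT => v0.
    by rewrite expR_ge0/= -expR0 ler_expR; lra.
- move=> n e f cf fe; rewrite !normrM mulrA ler_wpM2r//.
  exact: laplace_functional_bound.
- move=> e f cf fe; apply: wint_bound => //.
  + by move=> v; exact: limit_weight_ge0.
  + exact: integrable_limit_weight.
  + by apply: measurable_funTS; exact: measurableT_comp.
  + move=> v; rewrite /= in_itv/= andbT => v0.
    by rewrite expR_ge0/= -expR0 ler_expR; lra.
- move=> k.
  rewrite /limit_functional /wint integral_limit_weight_expn/=.
  have k0 : 0 <= k%:R :> R by [].
  have k1 : 0 < k.+1%:R :> R by rewrite ltr0n.
  (* The restriction s' <= 4 s holds for all consecutive pairs k + 1, k + 2, so every moment is
     covered. *)
  have k4 : k.+1%:R <= (k.+2%:R : R) <= 4 * k.+1%:R.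
    have E1 : k.+1%:R = k%:R + 1 :> R by rewrite natr1.
    have E2 : k.+2%:R = k%:R + 1 + 1 :> R by rewrite !natr1.
    by rewrite E1 E2; apply/andP; split; lra.
  have := laplace_difference_cvg cpsi psi_ge0 l_gt0 l_sv l_leM psi_Pi d_gt0 t_gt0
    t_cvg0 x_cvgy k1 k4.
  have mphi n : measurable_fun setT (fun u : R => expR (- (t n * psi (u * x n)))).
    apply: measurableT_comp => //; apply: measurableT_comp => //; apply: measurable_funM => //.
    by apply: (measurableT_comp (continuous_measurable_fun cpsi)); exact: measurable_funM.
  have phi0 n u : 0 <= expR (- (t n * psi (u * x n))) by exact: expR_ge0.
  under eq_fun do rewrite (laplace_functional_expn d_gt0 (mY _) (mphi _) (phi0 _) (cfY _)).
  move=> /fine_cvg /= h.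
  have Gn0 : Gamma (d%:R / 2 : R) != 0 by rewrite gt_eqF.
  have := cvgMr_tmp (b := (Gamma (d%:R / 2 : R))^-1) h; rewrite mulfK//.
  move=> /(_ _); apply: cvg_trans; apply: near_eq_cvg; apply: nearW => n /=.
  by rewrite mulfK.
- exact: continuous_bump.
- move=> e e0; apply: bump_approx => //.
  + by rewrite expR_ge0/= -expR0 ler_expR oppr_le0.
  + by rewrite expR_ge0/= -expR0 ler_expR oppr_le0.
Qed.
End laplace_functional_cvg.

(** * The exponent read off the characteristic function *)

Lemma tnorm_unit (R : realType) (n : nat) (u : R) :
  tnorm (tscale u (cons_tuple 1 (tzero R n))) = `|u|.
Proof.
have tE : tdot (cons_tuple 1 (tzero R n)) (cons_tuple 1 (tzero R n)) = 1.
  by rewrite tdot_cons mulr1 -tnorm_sqr tnorm_tzero expr0n addr0.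
by rewrite /tnorm tdot_scale tdotC tdot_scale tE mulr1 -expr2 sqrtr_sqr.
Qed.

Section exponent.
Variables (R : realType) (dO : measure_display) (O : measurableType dO).
Variables (P : probability O R) (d : nat) (X : O -> d.+1.-tuple R) (psi0 : R -> R).
Hypothesis mX : measurable_fun setT X.
Hypothesis cfX : forall xi : d.+1.-tuple R,
  (\int[P]_w (cos (tdot xi (X w)))%:E = (expR (- psi0 (tnorm xi)))%:E)%E.

Let cfXu (u : R) : (\int[P]_w (cos (u * tdot (cons_tuple 1 (tzero R d)) (X w)))%:E =
  (expR (- psi0 `|u|))%:E)%E.
Proof.
by rewrite -(tnorm_unit d u) -cfX; apply: eq_integral => w _; rewrite tdot_scale.
Qed.

Let mZ : measurable_fun setT (fun w => tdot (cons_tuple 1 (tzero R d)) (X w)).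
Proof. by apply: measurable_tdot => //; exact: measurable_cst. Qed.

(** Along a coordinate axis the exponent is minus the logarithm of a one-dimensional characteristic
    function, which is continuous and, being an exponential, positive. *)
Lemma exponent_continuous : continuous (fun u : R => psi0 `|u|).
Proof.
have cphi := continuous_cf mZ cfXu.
rewrite (_ : (fun u => _) = (fun u => - ln (expR (- psi0 `|u|)))); last first.
  by apply/funext => u; rewrite expRK opprK.
move=> u; apply: cvgN; apply: (@continuous_cvg _ _ _ _ _ _ (@ln R)); last exact: cphi.
by apply: continuous_ln; exact: expR_gt0.
Qed.

Lemma exponent_ge0 (u : R) : 0 <= psi0 `|u|.
Proof.
rewrite -oppr_le0 -ler_expR expR0 -lee_fin -cfXu.
have P1 : (\int[P]_w cst 1 w = 1)%E.
  by rewrite integral_cst// mul1e; exact: probability_setT.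
rewrite -[leRHS]P1; apply: le_integral => //.
- apply: (@integrable_bounded _ _ _ P _ 1); last by move=> w; exact: cos_max.
  apply: measurableT_comp; first exact: (continuous_measurable_fun (@continuous_cos R)).
  exact: measurable_funM.
- exact: finite_measure_integrable_cst.
- by move=> w _; rewrite lee_fin cos_le1.
Qed.
End exponent.

(** The square accounts for two losses of a factor m each: one from the convergence of the
    functionals, one from the width of the shell. *)
Lemma cvg_of_sandwich (R : realType) (u : nat -> R) (K : R) : 0 < K ->
  (forall m, 1 < m -> \forall n \near \oo, K / m ^+ 2 <= u n <= K * m ^+ 2) ->
  u n @[n --> \oo] --> K.
Proof.
move=> K0 h; apply/cvgrPdist_le => e e0.
pose m := Num.sqrt (1 + e / K).
have eK : 0 < e / K by rewrite divr_gt0.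
have m2 : m ^+ 2 = 1 + e / K by rewrite sqr_sqrtr//; lra.
have m1 : 1 < m by rewrite /m -{1}(sqrtr1 R) ltr_sqrt; lra.
have Km : K * m ^+ 2 = K + e by rewrite m2; field; rewrite gt_eqF.
have Km' : K - e <= K / m ^+ 2.
  rewrite ler_pdivlMr; last by rewrite m2; lra.
  have : 0 <= e * (e / K) by rewrite mulr_ge0// ltW.
  have : K * (e / K) = e by field; rewrite gt_eqF.
  rewrite m2; lra.
apply: filterS (h m m1) => n /andP[h1 h2]; rewrite ler_norml; lra.
Qed.

Lemma powR_root (R : realType) (d : nat) (m : R) : (0 < d)%N -> 1 < m ->
  exists lam : R, [/\ 1 < lam, lam `^ (d%:R / 2) = m & lam^-1 `^ (d%:R / 2) = m^-1].
Proof.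
move=> d0 m1; have m0 : 0 < m by lra.
have d1 : 0 < d%:R :> R by rewrite ltr0n.
exists (m `^ (2 / d%:R)).
have E : (m `^ (2 / d%:R)) `^ (d%:R / 2) = m.
  rewrite -powRrM (_ : 2 / d%:R * (d%:R / 2) = 1) ?powRr1 ?(ltW m0)//.
  by field; rewrite gt_eqF.
split => //.
- by rewrite /powR gt_eqF// expR_gt1 mulr_gt0 ?divr_gt0// ln_gt0.
- by rewrite -powR_inv1 ?powR_ge0// -powRrM mulN1r powRN E.
Qed.

(** * Assembly of the limit *)

Theorem mainTheorem4 (R : realType) (d : nat) (dO : measure_display)
    (O : measurableType dO) (P : probability O R)
    (X : R -> O -> d.-tuple R) (nu : R -> R) (psi0 : R -> R)
    (p : R -> R -> R) (l : R -> R) (a M : R) :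
  (0 < d)%N ->
  pure_jump_isotropic_unimodal_exponent nu (fun xi : d.-tuple R => psi0 (tnorm xi)) ->
  levy_process P X (fun xi : d.-tuple R => psi0 (tnorm xi)) ->
  radial_unimodal_density P X p ->
  slowly_varying l a ->
  (forall x, a <= x -> l x <= M) ->
  in_Pi l psi0 a ->
  forall (t : nat -> R) (x : nat -> d.-tuple R),
    (forall n, 0 < t n) -> t n @[n --> \oo] --> 0 ->
    (forall n, x n <> tzero R d) ->
    t n * psi0 ((tnorm (x n))^-1) @[n --> \oo] --> +oo ->
    p (t n) (tnorm (x n)) /
      (t n * tnorm (x n) ^- d * l ((tnorm (x n))^-1)
       * expR (- (t n * psi0 ((tnorm (x n))^-1))))
    @[n --> \oo] --> Gamma (d%:R / 2) / (2 * pi `^ (d%:R / 2)).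
Proof.
move=> d_gt0 _ [_ mX _ _ cfX] dens [l_gt0 l_sv] l_leM [_ psi0_Pi] t x t_gt0 t_cvg0 x_neq0 tpsi.
(* Nothing is known about [psi0] at negative arguments; the even extension is continuous and
   nonnegative on the whole line, as the lemmas on slow variation require. *)
pose psi (u : R) := psi0 `|u|.
have [cpsi psi_ge0] : continuous psi /\ (forall u, 0 <= psi u).
  case: d d_gt0 X mX cfX {dens x x_neq0 tpsi} => // d _ X mX cfX.
  have cf1 (xi : d.+1.-tuple R) :
      (\int[P]_w (cos (tdot xi (X 1 w)))%:E = (expR (- psi0 (tnorm xi)))%:E)%E.
    by have [-> _] := cfX 1 xi ler01; rewrite mul1r.
  split; first exact: exponent_continuous (mX 1 ler01) cf1.
  exact: exponent_ge0 (mX 1 ler01) cf1.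
have psi_Pi (lam : R) : 0 < lam -> (fun x => (psi (lam * x) - psi x) / l x) @ +oo --> ln lam.
  move=> lam0; have := psi0_Pi lam lam0; apply: cvg_trans; apply: near_eq_cvg.
  near=> y; have y0 : 0 < y by near: y; exact: nbhs_pinfty_gt.
  by rewrite /psi !gtr0_norm// mulr_gt0.
pose r n := tnorm (x n); pose xx n := (r n)^-1.
have r_gt0 n : 0 < r n by exact: tnorm_gt0.
have xx_gt0 n : 0 < xx n by rewrite invr_gt0.
have psiE n : psi (xx n) = psi0 (xx n) by rewrite /psi gtr0_norm.
(* Were [xx n] to stay below some B, [psi] would be bounded by its maximum on [0, |B|], and with t
   <= 1 the product t psi could not tend to infinity. *)
have x_cvgy : xx n @[n --> \oo] --> +oo.
  apply/cvgryPge => B.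
  have [||c _ hc] := @EVT_max R psi 0 `|B| => //.
    exact: continuous_subspaceT.
  have h1 : \forall n \near \oo, t n <= 1.
    move/cvgrPdist_le : t_cvg0 => /(_ 1 ltr01); apply: filterS => n.
    by rewrite sub0r normrN gtr0_norm.
  have h2 : \forall n \near \oo, psi c + 1 <= t n * psi0 (xx n).
    by move/cvgryPge : tpsi => /(_ (psi c + 1)).
  near=> n; have [//|xB] := leP B (xx n); exfalso.
  have t1 : t n <= 1 by near: n.
  have t2 : psi c + 1 <= t n * psi (xx n) by rewrite psiE; near: n.
  have t3 : psi (xx n) <= psi c.
    by apply: hc; rewrite in_itv/= (ltW (xx_gt0 n))/= (le_trans (ltW xB))// ler_norm.
  have : t n * psi (xx n) <= 1 * psi (xx n) by rewrite ler_wpM2r.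
  lra.
pose Y n w := tscale (xx n) (X (t n) w).
have mY n : measurable_fun setT (Y n).
  by apply: (measurableT_comp (measurable_tscale _)); apply: mX; exact: ltW.
have cfY n (xi : d.-tuple R) : (\int[P]_w (cos (tdot xi (Y n w)))%:E =
    (expR (- (t n * psi (tnorm xi * xx n))))%:E)%E.
  rewrite /psi ger0_norm ?mulr_ge0 ?tnorm_ge0 ?(ltW (xx_gt0 n))// [tnorm xi * _]mulrC.
  rewrite -tnorm_scale ?(ltW (xx_gt0 n))//.
  have [<- _] := cfX (t n) (tscale (xx n) xi) (ltW (t_gt0 n)).
  by apply: eq_integral => w _; rewrite /Y tdotC !tdot_scale tdotC.
pose c n := t n * l (xx n) * expR (- (t n * psi (xx n))).
have Lcvg al be : 0 <= al -> 0 <= be ->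
    laplace_functional P (Y n) (bump (expR (- be)) (expR (- al))) / c n @[n --> \oo] -->
    limit_functional (bump (expR (- be)) (expR (- al))).
  exact: (laplace_functional_cvg cpsi psi_ge0 l_gt0 l_sv l_leM psi_Pi d_gt0 t_gt0 t_cvg0
    x_cvgy mY cfY).
have [C [C0 CE G0 _ CG]] := polar_cst_Gamma R d_gt0.
have -> : Gamma (d%:R / 2) / (2 * pi `^ (d%:R / 2)) = (2 * C)^-1.
  by rewrite -CG; field; rewrite !gt_eqF.
have c_gt0 : \forall n \near \oo, 0 < c n.
  have : \forall n \near \oo, a <= xx n by move/cvgryPge : x_cvgy => /(_ a).
  by apply: filterS => n /l_gt0 ln; rewrite /c !mulr_gt0// expR_gt0.
pose u n := p (t n) (r n) * r n ^+ d / c n.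
suff : u n @[n --> \oo] --> (2 * C)^-1.
  apply: cvg_trans; apply: near_eq_cvg; near=> n.
  rewrite /u /c psiE -/(r n) -/(xx n) !invfM invrK; ring.
apply: cvg_of_sandwich => [|m m1]; first by rewrite invr_gt0 mulr_gt0.
have m0 : 0 < m by lra.
(* The ratio [lam] is chosen so that u^(d/2) varies by exactly the factor m across each of the
   shells [1, lam] and [1 / lam, 1]. *)
have [lam [lam1 lamE lamVE]] := powR_root d_gt0 m1.
have lam0 : 0 < lam by lra.
have lamV : lam^-1 < 1 by rewrite invf_lt1.
have lamV0 : 0 < lam^-1 by rewrite invr_gt0.
pose I1 := limit_functional (bump (expR (- lam)) (expR (- 1))).
pose I2 := limit_functional (bump (expR (- 1)) (expR (- lam^-1))).
have I1_gt0 : 0 < I1 by exact: limit_functional_bump_gt0.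
have I2_gt0 : 0 < I2 by exact: limit_functional_bump_gt0.
(* Outside the unit sphere the density bounds the functional from above, so a lower bound on the
   functional yields the lower bound on [u n]; [near2] plays the opposite part for the inner
   shell. *)
have near1 : \forall n \near \oo,
    I1 / m <= laplace_functional P (Y n) (bump (expR (- lam)) (expR (- 1))) / c n.
  have I1m : 0 < I1 - I1 / m by rewrite subr_gt0 ltr_pdivrMr// ltr_pMr.
  move/cvgrPdist_le : (Lcvg 1 lam ler01 (ltW lam0)) => /(_ _ I1m); apply: filterS => n.
  by rewrite -/I1 ler_norml => /andP[_]; lra.
have near2 : \forall n \near \oo,
    laplace_functional P (Y n) (bump (expR (- 1)) (expR (- lam^-1))) / c n <= I2 * m.
  have I2m : 0 < I2 * m - I2 by rewrite subr_gt0 ltr_pMr.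
  move/cvgrPdist_le : (Lcvg lam^-1 1 (ltW lamV0) ler01) => /(_ _ I2m); apply: filterS => n.
  by rewrite -/I2 ler_norml => /andP[h _]; lra.
have [_ up1] := integral_test_fun d_gt0 C0 CE ler01 lam1.
have [low2 _] := integral_test_fun d_gt0 C0 CE (ltW lamV0) lamV.
rewrite -/I1 lamE in up1; rewrite -/I2 lamVE in low2.
near=> n.
have cn0 : 0 < c n by near: n.
have [p_ge0 p_ni pdens] := dens (t n) (t_gt0 n).
have pr0 : 0 <= p (t n) (r n) * r n ^+ d.
  by rewrite mulr_ge0 ?p_ge0// exprn_ge0// ltW.
have mXn : measurable_fun setT (X (t n)) by apply: mX; exact: ltW.
have un : u n * c n = p (t n) (r n) * r n ^+ d by rewrite /u divfK// gt_eqF.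
have outer : laplace_functional P (Y n) (bump (expR (- lam)) (expR (- 1))) <=
    u n * c n * (2 * C * m * I1).
  rewrite -lee_fin -(laplace_functional_bump P (mY n)) EFinM un.
  apply: (@le_trans _ _ ((p (t n) (r n) * r n ^+ d)%:E *
    \int[tuple_lebesgue R d]_x (test_fun 1 lam (tdot x x))%:E)%E); last first.
    by apply: lee_wpmul2l; rewrite ?lee_fin.
  apply: (comparison_outer mXn p_ge0 p_ni pdens (r_gt0 n)).
  - exact: measurable_test_fun.
  - by move=> v; apply: test_fun_ge0 => //; exact: ltW.
  - by move=> v v1; apply: test_fun_out; [exact: ltW|left; exact: ltW].
have inner : u n * c n * (2 * C * m^-1 * I2) <=
    laplace_functional P (Y n) (bump (expR (- 1)) (expR (- lam^-1))).
  rewrite -lee_fin -(laplace_functional_bump P (mY n)) EFinM un.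
  apply: (@le_trans _ _ ((p (t n) (r n) * r n ^+ d)%:E *
    \int[tuple_lebesgue R d]_x (test_fun lam^-1 1 (tdot x x))%:E)%E).
    by apply: lee_wpmul2l; rewrite ?lee_fin.
  apply: (comparison_inner mXn p_ge0 p_ni pdens (r_gt0 n)).
  - exact: measurable_test_fun.
  - by move=> v; apply: test_fun_ge0; exact: ltW.
  - by apply: test_fun_out; [exact: ltW|left; exact: ltW].
  - by move=> v v1; apply: test_fun_out; [exact: ltW|right; exact: ltW].
have n1 : I1 / m <= laplace_functional P (Y n) (bump (expR (- lam)) (expR (- 1))) / c n.
  by near: n.
have n2 : laplace_functional P (Y n) (bump (expR (- 1)) (expR (- lam^-1))) / c n <= I2 * m.
  by near: n.
have Cn0 : C != 0 by rewrite gt_eqF.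
have mn0 : m != 0 by rewrite gt_eqF.
apply/andP; split.
  rewrite ler_pdivlMr in n1 => //; have {n1 outer} := le_trans n1 outer.
  rewrite [leRHS](_ : _ = u n * (2 * C * m * I1) * c n); last by ring.
  rewrite ler_pM2r// => h.
  (* The value [I1] cancels, so only the constant 2 C and the two factors m remain. *)
  rewrite -(ler_pM2r (_ : 0 < 2 * C * m * I1)); last by rewrite !mulr_gt0.
  apply: le_trans h; rewrite le_eqVlt; apply/orP; left; apply/eqP.
  by field; rewrite Cn0 mn0.
rewrite ler_pdivrMr in n2 => //; have {n2 inner} := le_trans inner n2.
rewrite [leLHS](_ : _ = u n * (2 * C * m^-1 * I2) * c n); last by ring.
rewrite ler_pM2r// => h.
rewrite -(ler_pM2r (_ : 0 < 2 * C * m^-1 * I2)); last by rewrite !mulr_gt0// invr_gt0.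
apply: (le_trans h); rewrite le_eqVlt; apply/orP; left; apply/eqP.
by field; rewrite Cn0 mn0.
Unshelve. all: by end_near. Qed.
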